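(* There is a constant $c$ such that for all binary strings $x,y$ with $|x|=|y|$ and $E_1(x,y)\ge 6\log|x|$, each of the four prefix information distances $D$ (prefix-free non-bipartite, prefix-stable non-bipartite, prefix-free bipartite, prefix-stable bipartite) satisfies $|D(x,y)-E_1(x,y)|\le c$, where $E_1(x,y)=\max(\mathrm{KP}(x\mid y),\mathrm{KP}(y\mid x))$.
   Context: A computable partial function $U(p,x)$ (binary strings to binary strings) is prefix-free if for each $x$ the set of $p$ with $U(p,x)$ defined contains no string together with a proper prefix of it; it is prefix-stable if whenever $U(p,x)$ is defined, $U(p',x)=U(p,x)$ for every extension $p'$ of $p$. Non-bipartite distance: $E_U(x,y)=\min\{|p|: U(p,x)=y\text{ and }U(p,y)=x\}$; bipartite distance for a pair $(U,U')$: $E_{U,U'}(x,y)=\min\{|p|: U(p,x)=y\text{ and }U'(p,y)=x\}$. The prefix-free (resp. prefix-stable) non-bipartite information distance is the minimal, up to an additive constant, function $E_U$ over prefix-free (resp. prefix-stable) computable partial $U$; the prefix-free (resp. prefix-stable) bipartite information distance is the minimal, up to an additive constant, function $E_{U,U'}$ over pairs of prefix-free (resp. prefix-stable) computable partial functions. $\mathrm{KP}(y\mid x)$ is conditional prefix complexity $\min\{|p|:V(p,x)=y\}$ for an optimal prefix-free $V$. Logarithms are base 2. *)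

(* Defs.v *)
From mathcomp Require Import all_boot.
From Stdlib Require Import Reals.

Set Implicit Arguments.
Unset Strict Implicit.
Unset Printing Implicit Defensive.

Inductive PR : Type :=
| PZero : PR
| PSucc : PR
| PProj : nat -> PR
| PComp : PR -> list PR -> PR
| PRec  : PR -> PR -> PR
| PMu   : PR -> PR.

Inductive eval : PR -> seq nat -> nat -> Prop :=
| ev_zero l : eval PZero l 0
| ev_succ x l : eval PSucc (x :: l) x.+1
| ev_proj i l : eval (PProj i) l (nth 0 l i)
| ev_comp f gs l ys z : evals gs l ys -> eval f ys z -> eval (PComp f gs) l z
| ev_rec0 f g l z : eval f l z -> eval (PRec f g) (0 :: l) z
| ev_recS f g n l r z :
    eval (PRec f g) (n :: l) r -> eval g (n :: r :: l) z ->
    eval (PRec f g) (n.+1 :: l) z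
| ev_mu f l n :
    eval f (n :: l) 0 ->
    (forall m, m < n -> exists k, eval f (m :: l) k.+1) ->
    eval (PMu f) l n
with evals : list PR -> seq nat -> seq nat -> Prop :=
| evs_nil l : evals nil l [::]
| evs_cons g gs l y ys : eval g l y -> evals gs l ys -> evals (g :: gs) l (y :: ys).

Definition bstring := seq bool.

(* bijective base-2 numbering: [::] |-> 0, [false] |-> 1, [true] |-> 2, ... *)
Fixpoint enc (s : bstring) : nat :=
  match s with
  | [::] => 0
  | b :: s' => (enc s').*2.+1 + b
  end.

(* A computable partial function U(p, x) on binary strings is given by a
   program e; "U(p,x) = y" is  app e p x y. *)
Definition app (e : PR) (p x y : bstring) : Prop :=
  eval e [:: enc p; enc x] (enc y).

Definition prefix_free (e : PR) : Prop :=
  forall x p q y z, app e p x y -> app e q x z -> prefix p q -> p = q.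

Definition prefix_stable (e : PR) : Prop :=
  forall p p' x y, app e p x y -> prefix p p' -> app e p' x y.

(* min{|p| : P p} <= min{|q| : Q q} + c   (with min of empty set = +oo) *)
Definition min_le (P Q : bstring -> Prop) (c : nat) : Prop :=
  forall q, Q q -> exists p, P p /\ size p <= size q + c.

Definition is_min_len (P : bstring -> Prop) (n : nat) : Prop :=
  (exists p, P p /\ size p = n) /\ (forall p, P p -> n <= size p).

(* KP_V(y | x) = min{|p| : V(p,x) = y};  KP uses an optimal prefix-free V *)
Definition KP_set (V : PR) (y x : bstring) : bstring -> Prop :=
  fun p => app V p x y.

Definition optimal_KP (V : PR) : Prop :=
  prefix_free V /\
  forall W, prefix_free W ->
    exists c, forall x y, min_le (KP_set V y x) (KP_set W y x) c.

(* non-bipartite: E_U(x,y) = min{|p| : U(p,x)=y and U(p,y)=x} *)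
Definition nb_set (U : PR) (x y : bstring) : bstring -> Prop :=
  fun p => app U p x y /\ app U p y x.

(* bipartite: E_{U,U'}(x,y) = min{|p| : U(p,x)=y and U'(p,y)=x} *)
Definition b_set (U U' : PR) (x y : bstring) : bstring -> Prop :=
  fun p => app U p x y /\ app U' p y x.

Definition optimal_nb (cls : PR -> Prop) (U : PR) : Prop :=
  cls U /\
  forall W, cls W -> exists c, forall x y, min_le (nb_set U x y) (nb_set W x y) c.

Definition optimal_b (cls : PR -> Prop) (U U' : PR) : Prop :=
  cls U /\ cls U' /\
  forall W W', cls W -> cls W' ->
    exists c, forall x y, min_le (b_set U U' x y) (b_set W W' x y) c.

Definition within (P : bstring -> Prop) (e c : nat) : Prop :=
  exists d, is_min_len P d /\ d <= e + c /\ e <= d + c.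

(* 6 * log_2 n <= m   (real logarithm base 2; Stdlib's ln 0 = 0) *)
Definition six_log_le (n m : nat) : Prop :=
  Rle (Rmult (INR 6) (Rdiv (ln (INR n)) (ln (INR 2)))) (INR m).

(* Main.v *)
(* Lower bounds. If [U] is prefix-free or prefix-stable, the targets reachable from
   [x] have incomparable programs, so the Kraft sums of all the lengths witnessed so
   far are at most 2 (one more unit covers the trivial description of length [|x|]).
   Laying the requests on a line one after the other, each in a segment of twice
   its weight, gives a prefix-free machine of the same complexity up to O(1);
   optimality of [V] then bounds [KP(y|x)] and [KP(x|y)].

   Upper bounds. It suffices to give every pair [{x, y}] with [E_1(x, y) <= k] a
   code of length [k + O(1)], online, so that the codes at each vertex form a
   prefix-free set: the code and either endpoint determine the other one. A code is
   a head of about [4 log n] bits followed by a tail. A fixed hash table splits the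
   heads, separately for every vertex, into O(n) units, and a vertex opens units for
   a level [k] only on demand; as its total weight is small and there are at most
   [n + 1] levels, it never runs out of units. For an edge [(x, y)] the head must
   lie in the current unit of [x] and in that of [y]. Choosing it at random among
   the lightly loaded ones would, by an exponential moment argument, keep the loads
   balanced; a potential function makes the choice deterministic, and [k >= 6 log n]
   leaves enough room for the deviations. Both the hash table and the head are found
   by exhaustive search, so the allocation is computable. *)
From Stdlib Require Import Classical Reals Lra.
Require Import Defs.
From mathcomp Require Import all_boot.
From mathcomp Require Import zify.

Set Implicit Arguments.
Unset Strict Implicit.
Unset Printing Implicit Defensive.

(** * Computable functions *)

(** A one-sided layout cannot serve edges: the place that it finds at [x] says nothing about what is
    free at [y], while a code must be new at both ends. So prefix-freeness is enforced through
    heads: codes in distinct units have distinct heads, and codes in one unit have one length, so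
    there only equality must be avoided. The danger is that codes of edges at [x] pile up on the
    heads shared with one unit of another vertex [z], leaving no room for a later edge between [x]
    and [z]. A random admissible head falls into a given unit of [z] with probability at most
    [32 / q <= 1 / m], so each new code multiplies the mean of [2 ^ load] by at most [1 + 1 / m].
    The potential is [2 ^ load] divided by these factors and scaled to an integer. The exponent 4 in
    the number of heads comes from triples of units: one unit of [x], one of [y] and one of [z]
    share [N / q ^ 3] heads on average, and the union bound over more than [2 ^ (3 * n)] triples
    needs this average to be of order [n], where [q] is of order [n] as well. *)

Definition computable (m : nat) (f : seq nat -> nat) : Prop :=
  exists e, forall l, size l = m -> eval e l (f l).

Lemma computable_ext m f g :
  computable m f -> (forall l, size l = m -> f l = g l) -> computable m g.
Proof. by move=> [e He] fg; exists e => l sl; rewrite -fg //; exact: He. Qed.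

Lemma evals_map (T : Type) (e : T -> PR) (v : T -> nat) (s : seq T) l :
  (forall x, eval (e x) l (v x)) -> evals (map e s) l (map v s).
Proof.
by move=> H; elim: s => [|x s IH] /=; [exact: evs_nil | exact: evs_cons].
Qed.

Lemma computable_nthi m i : computable m (fun l => nth 0 l i).
Proof. by exists (PProj i) => l _; exact: ev_proj. Qed.

Lemma nth_iter_behead (l : seq nat) j i :
  nth 0 (iter j behead l) i = nth 0 l (j + i).
Proof.
elim: j i => [|j IH] i //=.
by rewrite nth_behead IH addnS.
Qed.

(** Every bounded sum, search or iteration puts its own variables in front of the list, so a
    variable bound further out appears behind some [behead]s. *)
Lemma computable_nth j m i : computable m (fun l => nth 0 (iter j behead l) i).
Proof.
by apply: (computable_ext (computable_nthi m (j + i))) => l _; rewrite nth_iter_behead.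
Qed.

Lemma computable_comp m (gs : seq (seq nat -> nat)) F :
  computable (size gs) F -> (forall i, i < size gs -> computable m (nth (fun _ => 0) gs i)) ->
  computable m (fun l => F [seq g l | g <- gs]).
Proof.
move=> [e He] H.
have [es [Ses Hes]] : exists es, size es = size gs /\
   forall l, size l = m -> evals es l [seq g l | g <- gs].
  elim: gs H {He} => [|g gs IH] H; first by exists [::]; split=> // l _ /=; exact: evs_nil.
  have [|es [ses Hes]] := IH; first by move=> i ilt; exact: (H i.+1).
  have [e' He'] := H 0 isT; exists (e' :: es); split; first by rewrite /= ses.
  by move=> l sl; apply: evs_cons; [exact: He' | exact: Hes].
exists (PComp e es) => l sl; apply: ev_comp (Hes l sl) _.
by apply: He; rewrite size_map.
Qed.

Lemma computable_const m c : computable m (fun _ => c).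
Proof.
elim: c => [|c [e He]]; first by exists PZero => l _; exact: ev_zero.
exists (PComp PSucc [:: e]) => l sl; apply: (@ev_comp _ _ _ [:: c]); last exact: ev_succ.
by apply: evs_cons; [exact: He | exact: evs_nil].
Qed.

Lemma nth_map_iota (l : seq nat) : [seq nth 0 l i | i <- iota 0 (size l)] = l.
Proof.
apply: (@eq_from_nth _ 0); rewrite size_map size_iota // => i ilt.
by rewrite (nth_map 0) ?size_iota // nth_iota.
Qed.

(** Made for loop bodies: the counter and the accumulator at the front of the list are exchanged for
    other values, while the parameters behind them stay. *)
Lemma computable_subst k m (gs : seq (seq nat -> nat)) F :
  computable (size gs + m) F ->
  (forall i, i < size gs -> computable (k + m) (nth (fun _ => 0) gs i)) ->
  computable (k + m) (fun l => F ([seq g l | g <- gs] ++ iter k behead l)).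
Proof.
move=> HF H; set ps := [seq (fun l => nth 0 l i) | i <- iota k m].
have sps : size (gs ++ ps) = size gs + m by rewrite size_cat size_map size_iota.
apply: (computable_ext (f := fun l => F [seq g l | g <- gs ++ ps])).
  apply: computable_comp; rewrite sps // => i ilt.
  rewrite nth_cat; case: ltnP => h; first exact: H.
  rewrite (nth_map 0); first by exact: computable_nthi.
  by rewrite size_iota; lia.
move=> l sl; rewrite map_cat -map_comp; congr (F (_ ++ _)).
have ss : size (iter k behead l) = m.
  by elim: k m l sl {H ps sps HF} => //= k IH m l sl; rewrite size_behead (IH m.+1) // sl addnS.
rewrite -[RHS]nth_map_iota ss -[X in iota X]addn0 iotaDl -map_comp.
by apply: eq_map => i /=; rewrite nth_iter_behead.
Qed.

Lemma computable_cons m g F : computable m.+1 F -> computable m g ->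
  computable m (fun l => F (g l :: l)).
Proof. by move=> HF Hg; apply: (@computable_subst 0 m [:: g]) => //; case. Qed.

Lemma computable1 F : computable 1 (fun l => F (nth 0 l 0)) ->
  forall m a, computable m a -> computable m (fun l => F (a l)).
Proof.
move=> HF m a Ha.
apply: (@computable_comp m [:: a] (fun l => F (nth 0 l 0)) HF).
by case.
Qed.

Lemma computable2 F : computable 2 (fun l => F (nth 0 l 0) (nth 0 l 1)) ->
  forall m a b, computable m a -> computable m b -> computable m (fun l => F (a l) (b l)).
Proof.
move=> HF m a b Ha Hb.
apply: (@computable_comp m [:: a; b] (fun l => F (nth 0 l 0) (nth 0 l 1)) HF).
by case=> [|[]].
Qed.

Lemma computable3 F :
  computable 3 (fun l => F (nth 0 l 0) (nth 0 l 1) (nth 0 l 2)) ->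
  forall m a b c, computable m a -> computable m b -> computable m c ->
    computable m (fun l => F (a l) (b l) (c l)).
Proof.
move=> HF m a b c Ha Hb Hc.
apply: (@computable_comp m [:: a; b; c]
  (fun l => F (nth 0 l 0) (nth 0 l 1) (nth 0 l 2)) HF).
by case=> [|[|[]]].
Qed.

Lemma computable4 F :
  computable 4 (fun l => F (nth 0 l 0) (nth 0 l 1) (nth 0 l 2) (nth 0 l 3)) ->
  forall m a b c d, computable m a -> computable m b -> computable m c ->
    computable m d -> computable m (fun l => F (a l) (b l) (c l) (d l)).
Proof.
move=> HF m a b c d Ha Hb Hc Hd.
apply: (@computable_comp m [:: a; b; c; d]
  (fun l => F (nth 0 l 0) (nth 0 l 1) (nth 0 l 2) (nth 0 l 3)) HF).
by case=> [|[|[|[]]]].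
Qed.

Lemma computable5 F :
  computable 5 (fun l => F (nth 0 l 0) (nth 0 l 1) (nth 0 l 2) (nth 0 l 3) (nth 0 l 4)) ->
  forall m a b c d e, computable m a -> computable m b -> computable m c ->
    computable m d -> computable m e -> computable m (fun l => F (a l) (b l) (c l) (d l) (e l)).
Proof.
move=> HF m a b c d e Ha Hb Hc Hd He.
apply: (@computable_comp m [:: a; b; c; d; e]
  (fun l => F (nth 0 l 0) (nth 0 l 1) (nth 0 l 2) (nth 0 l 3) (nth 0 l 4)) HF).
by case=> [|[|[|[|[]]]]].
Qed.

Lemma computable7 F :
  computable 7 (fun l => F (nth 0 l 0) (nth 0 l 1) (nth 0 l 2) (nth 0 l 3) (nth 0 l 4)
                           (nth 0 l 5) (nth 0 l 6)) ->
  forall m a b c d e g h, computable m a -> computable m b -> computable m c ->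
    computable m d -> computable m e -> computable m g -> computable m h ->
    computable m (fun l => F (a l) (b l) (c l) (d l) (e l) (g l) (h l)).
Proof.
move=> HF m a b c d e g h Ha Hb Hc Hd He Hg Hh.
apply: (@computable_comp m [:: a; b; c; d; e; g; h]
  (fun l => F (nth 0 l 0) (nth 0 l 1) (nth 0 l 2) (nth 0 l 3) (nth 0 l 4)
              (nth 0 l 5) (nth 0 l 6)) HF).
by case=> [|[|[|[|[|[|[]]]]]]].
Qed.

Lemma computable_iteri m n st a :
  computable m n -> computable m a ->
  computable m.+2 (fun l => st (nth 0 l 0) (nth 0 l 1) (behead (behead l))) ->
  computable m (fun l => iteri (n l) (fun i s => st i s l) (a l)).
Proof.
move=> Hn [ea Ha] [es Hs].
apply: (@computable_cons m n
  (fun l => iteri (nth 0 l 0) (fun i s => st i s (behead l)) (a (behead l)))) => //.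
exists (PRec ea es) => -[|k l] //= [sl].
elim: k => [|k IH] /=; first by apply: ev_rec0; exact: Ha.
apply: ev_recS IH _.
by apply: (Hs (k :: _ :: l)); rewrite /= sl.
Qed.

Lemma computable_S m a : computable m a -> computable m (fun l => (a l).+1).
Proof.
by apply: (@computable1 succn); exists PSucc => -[|x [|]] // _; exact: ev_succ.
Qed.

Ltac computability_leaf := first [exact: computable_const
  | exact: (@computable_nth 0) | exact: (@computable_nth 1) | exact: (@computable_nth 2)
  | exact: (@computable_nth 3) | exact: (@computable_nth 4) | exact: (@computable_nth 5)
  | exact: (@computable_nth 6) | exact: (@computable_nth 7) | exact: (@computable_nth 8)].

Lemma computable_pred m a : computable m a -> computable m (fun l => (a l).-1).
Proof.
apply: (@computable1 predn).
apply: (computable_ext (f := fun l => iteri (nth 0 l 0) (fun i _ => i) 0)).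
  by apply: (computable_iteri (st := fun i _ _ => i)); computability_leaf.
by move=> l _; case: (nth 0 l 0).
Qed.

Lemma computable_add m a b : computable m a -> computable m b ->
  computable m (fun l => a l + b l).
Proof.
apply: (@computable2 addn).
apply: (computable_ext (f := fun l => iteri (nth 0 l 0) (fun i s => s.+1) (nth 0 l 1))).
  apply: (computable_iteri (st := fun i s _ => s.+1)); try computability_leaf.
  by apply: computable_S; computability_leaf.
by move=> l _; elim: (nth 0 l 0) => //= n ->.
Qed.

Lemma computable_sub m a b : computable m a -> computable m b ->
  computable m (fun l => a l - b l).
Proof.
apply: (@computable2 subn).
apply: (computable_ext (f := fun l => iteri (nth 0 l 1) (fun i s => s.-1) (nth 0 l 0))).
  apply: (computable_iteri (st := fun i s _ => s.-1)); try computability_leaf.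
  by apply: computable_pred; computability_leaf.
by move=> l _; elim: (nth 0 l 1) => [|n IH] /=; rewrite ?subn0 // IH subnS.
Qed.

Lemma computable_mul m a b : computable m a -> computable m b ->
  computable m (fun l => a l * b l).
Proof.
apply: (@computable2 muln).
apply: (computable_ext (f := fun l => iteri (nth 0 l 0) (fun i s => nth 0 l 1 + s) 0)).
  apply: (computable_iteri (st := fun i s l => nth 0 l 1 + s)); try computability_leaf.
  by apply: computable_add; computability_leaf.
by move=> l _; elim: (nth 0 l 0) => //= n ->.
Qed.

Lemma computable_exp m a b : computable m a -> computable m b ->
  computable m (fun l => a l ^ b l).
Proof.
apply: (@computable2 expn).
apply: (computable_ext (f := fun l => iteri (nth 0 l 1) (fun i s => nth 0 l 0 * s) 1)).
  apply: (computable_iteri (st := fun i s l => nth 0 l 0 * s)); try computability_leaf.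
  by apply: computable_mul; computability_leaf.
by move=> l _; elim: (nth 0 l 1) => //= n ->; rewrite expnS.
Qed.

Lemma computable_eq0 m a : computable m a -> computable m (fun l => a l == 0).
Proof.
move=> Ha; apply: (computable_ext (f := fun l => 1 - a l)).
  by apply: computable_sub => //; computability_leaf.
by move=> l _; case: (a l).
Qed.

Lemma computable_neg m (a : seq nat -> bool) : computable m (fun l => a l) ->
  computable m (fun l => ~~ a l).
Proof.
move=> /computable_eq0 H; apply: (computable_ext H) => l _.
by case: (a l).
Qed.

Lemma computable_leq m a b : computable m a -> computable m b ->
  computable m (fun l => a l <= b l).
Proof. by move=> Ha Hb; rewrite /leq; apply: computable_eq0; exact: computable_sub. Qed.

Lemma computable_ltn m a b : computable m a -> computable m b ->
  computable m (fun l => a l < b l).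
Proof. by move=> Ha Hb; apply: computable_leq => //; exact: computable_S. Qed.

Lemma computable_and m (a b : seq nat -> bool) :
  computable m (fun l => a l) -> computable m (fun l => b l) ->
  computable m (fun l => a l && b l).
Proof.
move=> Ha Hb; apply: (computable_ext (computable_mul Ha Hb)) => l _.
by rewrite mulnb.
Qed.

Lemma computable_or m (a b : seq nat -> bool) :
  computable m (fun l => a l) -> computable m (fun l => b l) ->
  computable m (fun l => a l || b l).
Proof.
move=> /computable_neg Ha /computable_neg Hb.
apply: (computable_ext (computable_neg (computable_and Ha Hb))) => l _.
by rewrite negb_and !negbK.
Qed.

Lemma computable_imp m (a b : seq nat -> bool) :
  computable m (fun l => a l) -> computable m (fun l => b l) ->
  computable m (fun l => a l ==> b l).
Proof.
move=> /computable_neg Ha Hb.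
by apply: (computable_ext (computable_or Ha Hb)) => l _; rewrite implybE.
Qed.

Lemma computable_eq m a b : computable m a -> computable m b ->
  computable m (fun l => a l == b l).
Proof.
move=> Ha Hb.
apply: (computable_ext (computable_and (computable_leq Ha Hb) (computable_leq Hb Ha))).
by move=> l _; rewrite -eqn_leq.
Qed.

Lemma computable_if m (c : seq nat -> bool) a b :
  computable m (fun l => c l) -> computable m a -> computable m b ->
  computable m (fun l => if c l then a l else b l).
Proof.
move=> Hc Ha Hb.
apply: (computable_ext
  (computable_add (computable_mul Hc Ha) (computable_mul (computable_neg Hc) Hb))).
by move=> l _; case: (c l); rewrite /= ?mul1n ?mul0n ?addn0.
Qed.

Lemma computable_sum m n E :
  computable m n ->
  computable m.+1 (fun l => E (nth 0 l 0) (behead l)) ->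
  computable m (fun l => \sum_(0 <= i < n l) E i l).
Proof.
move=> Hn HE.
apply: (computable_ext (f := fun l => iteri (n l) (fun i s => s + E i l) 0)).
  apply: (computable_iteri (st := fun i s l => s + E i l)) => //; try computability_leaf.
  apply: computable_add; first by computability_leaf.
  apply: (@computable_subst 2 m [:: fun l => nth 0 l 0] (fun l => E (nth 0 l 0) (behead l))) => //.
  by case=> // _; computability_leaf.
move=> l _; elim: (n l) => [|k IH] /=; first by rewrite big_geq.
by rewrite big_nat_recr //= IH.
Qed.

Lemma computable_all m n (P : nat -> seq nat -> bool) :
  computable m n ->
  computable m.+1 (fun l => P (nth 0 l 0) (behead l)) ->
  computable m (fun l => all (fun i => P i l) (iota 0 (n l))).
Proof.
move=> Hn HP.
apply: (computable_ext (f := fun l => \sum_(0 <= i < n l) ~~ P i l == 0)).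
  apply: computable_eq0.
  by apply: (computable_sum (E := fun i l => ~~ P i l)) => //; apply: computable_neg.
move=> l _; elim: (n l) => [|k IH]; first by rewrite big_geq.
rewrite -[X in iota 0 X]addn1 iotaD all_cat big_nat_recr //= addn_eq0 andbT add0n.
by case: (\sum_(0 <= i < k) _ == 0) (all _ _) IH => [] [] //= _; case: (P k l).
Qed.

Lemma computable_has m n (P : nat -> seq nat -> bool) :
  computable m n ->
  computable m.+1 (fun l => P (nth 0 l 0) (behead l)) ->
  computable m (fun l => has (fun i => P i l) (iota 0 (n l))).
Proof.
move=> Hn HP.
have := computable_neg (computable_all (P := fun i l => ~~ P i l) Hn (computable_neg HP)).
move=> /computable_ext; apply => l _.
by rewrite -has_predC; congr nat_of_bool; apply: eq_has => i /=; rewrite negbK.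
Qed.

(** The index found is the number of [i] such that nothing up to [i] satisfies [P]. So bounded
    search is a sum and stays total; its value is [n] when nothing is found. *)
Lemma find_iota_sum (P : pred nat) n :
  find P (iota 0 n) = \sum_(0 <= i < n) all (predC P) (iota 0 i.+1).
Proof.
elim: n => [|n IH]; first by rewrite big_geq.
rewrite -[X in find P (iota 0 X)]addn1 iotaD find_cat size_iota big_nat_recr // -IH.
rewrite -[X in all _ (iota 0 X)]addn1 iotaD all_cat all_predC add0n /= andbT.
case: ifP => h /=; first by rewrite addn0.
by rewrite hasNfind ?h // size_iota; case: (P n).
Qed.

Lemma computable_find m n (P : nat -> seq nat -> bool) :
  computable m n ->
  computable m.+1 (fun l => P (nth 0 l 0) (behead l)) ->
  computable m (fun l => find (fun i => P i l) (iota 0 (n l))).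
Proof.
move=> Hn HP.
apply: (computable_ext (f := fun l =>
  \sum_(0 <= i < n l) all (fun j => ~~ P j l) (iota 0 i.+1))); last first.
  by move=> l _; rewrite find_iota_sum.
apply: (computable_sum (E := fun i l => all (fun j => ~~ P j l) (iota 0 i.+1))) => //.
apply: (computable_all (n := fun l => (nth 0 l 0).+1) (P := fun j l => ~~ P j (behead l))).
  by apply: computable_S; computability_leaf.
apply: computable_neg.
apply: (@computable_subst 2 m [:: fun l => nth 0 l 0] (fun l => P (nth 0 l 0) (behead l))) => //.
by case=> // _; computability_leaf.
Qed.

Lemma computable_ifb m (c a b : seq nat -> bool) :
  computable m (fun l => c l) -> computable m (fun l => a l) -> computable m (fun l => b l) ->
  computable m (fun l => if c l then a l else b l : bool).
Proof.
move=> hc ha hb; apply: (computable_ext (computable_if hc ha hb)) => l _.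
by case: (c l).
Qed.

Ltac computability_base := lazymatch goal with
  | |- computable _ (fun _ => ?c) => exact: computable_const
  | |- computable _ (fun l => nth 0 _ _) => computability_leaf
  | |- computable _ (fun l => nat_of_bool (@?a l && @?b l)) => apply: computable_and
  | |- computable _ (fun l => nat_of_bool (@?a l || @?b l)) => apply: computable_or
  | |- computable _ (fun l => nat_of_bool (@?a l ==> @?b l)) => apply: computable_imp
  | |- computable _ (fun l => nat_of_bool (~~ @?a l)) => apply: computable_neg
  | |- computable _ (fun l => nat_of_bool (@?a l == @?b l)) => apply: computable_eq
  | |- computable _ (fun l => nat_of_bool (@?a l <= @?b l)) => apply: computable_leq
  | |- computable _ (fun l => nat_of_bool (all (@?a l) (iota 0 (@?b l)))) => apply: computable_all
  | |- computable _ (fun l => nat_of_bool (has (@?a l) (iota 0 (@?b l)))) => apply: computable_has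
  | |- computable _ (fun l => find (@?a l) (iota 0 (@?b l))) => apply: computable_find
  | |- computable _ (fun l => @?a l + @?b l) => apply: computable_add
  | |- computable _ (fun l => @?a l - @?b l) => apply: computable_sub
  | |- computable _ (fun l => @?a l * @?b l) => apply: computable_mul
  | |- computable _ (fun l => @?a l ^ @?b l) => apply: computable_exp
  | |- computable _ (fun l => (@?a l).+1) => apply: computable_S
  | |- computable _ (fun l => (@?a l).-1) => apply: computable_pred
  | _ => first [apply: computable_sum | apply: computable_ifb | apply: computable_if]
  end.
Ltac computability := cbv beta; first [assumption | computability_base]; cbv beta.

Lemma computable_div m a b : computable m a -> computable m b ->
  computable m (fun l => a l %/ b l).
Proof.
apply: (@computable2 divn).
(* A quotient by zero is zero by convention, whereas the search would run up to its bound. *)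
apply: (computable_ext (f := fun l => if nth 0 l 1 == 0 then 0 else
   find (fun i => nth 0 l 0 < i.+1 * nth 0 l 1) (iota 0 (nth 0 l 0).+1))).
  by repeat computability.
move=> l _; move: (nth 0 l 0) (nth 0 l 1) => x [|d]; first by rewrite divn0.
rewrite [_.+1 == 0]/=.
apply/eqP; rewrite eqn_leq; apply/andP; split.
- rewrite leqNgt; apply/negP => h.
  have := before_find 0 h; rewrite nth_iota ?ltn_ceil //.
  by rewrite ltnS leq_div.
- set k := find _ _.
  have hs : has (fun i => x < i.+1 * d.+1) (iota 0 x.+1).
    by apply/hasP; exists x; rewrite ?mem_iota //; nia.
  have := nth_find 0 hs; rewrite -/k nth_iota; last first.
    by have := hs; rewrite has_find size_iota.
  by rewrite add0n -ltn_divLR // ltnS.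
Qed.

Lemma computable_mod m a b : computable m a -> computable m b ->
  computable m (fun l => a l %% b l).
Proof.
apply: (@computable2 modn).
apply: (computable_ext (f := fun l => nth 0 l 0 - nth 0 l 0 %/ nth 0 l 1 * nth 0 l 1)).
  by apply: computable_sub; [computability_leaf | apply: computable_mul; [apply: computable_div|]; computability_leaf].
by move=> l _; rewrite {1}(divn_eq (nth 0 l 0) (nth 0 l 1)) addKn.
Qed.

Lemma trunc_log2_find n : trunc_log 2 n = find (fun i => n < 2 ^ i.+1) (iota 0 n.+1).
Proof.
have hs : has (fun i => n < 2 ^ i.+1) (iota 0 n.+1).
  apply/hasP; exists n; first by rewrite mem_iota add0n leq0n ltnSn.
  by apply: (leq_trans (ltn_expl n (ltnSn 1))); rewrite leq_exp2l.
apply/eqP; rewrite eqn_leq; apply/andP; split.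
- case: n hs => [|n] hs; first by rewrite trunc_log0.
  have := nth_find 0 hs; rewrite nth_iota; last by have := hs; rewrite has_find size_iota.
  rewrite add0n => h; rewrite leqNgt; apply/negP => h2.
  have := trunc_logP (ltnSn 1) (ltn0Sn n); rewrite leqNgt => /negP []; apply: leq_trans h _.
  by rewrite leq_exp2l.
- rewrite leqNgt; apply/negP => h.
  have := before_find 0 h; rewrite nth_iota.
    by rewrite add0n trunc_log_ltn.
  by move: hs; rewrite has_find size_iota; lia.
Qed.

Lemma computable_trunc_log m a : computable m a ->
  computable m (fun l => trunc_log 2 (a l)).
Proof.
apply: (@computable1 (trunc_log 2)).
apply: (computable_ext (f := fun l =>
  find (fun i => nth 0 l 0 < 2 ^ i.+1) (iota 0 (nth 0 l 0).+1))); first by repeat computability.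
by move=> l _; rewrite trunc_log2_find.
Qed.

Lemma computable_maxn m a b : computable m a -> computable m b ->
  computable m (fun l => maxn (a l) (b l)).
Proof. by move=> Ha Hb; rewrite /maxn; apply: computable_if => //; apply: computable_ltn. Qed.

(** * Clocked evaluation of programs *)

Fixpoint PR_nested_ind (P : PR -> Prop)
  (HZ : P PZero) (HS : P PSucc) (HP : forall i, P (PProj i))
  (HC : forall f gs, P f -> foldr (fun g acc => P g /\ acc) True gs -> P (PComp f gs))
  (HR : forall f g, P f -> P g -> P (PRec f g)) (HM : forall f, P f -> P (PMu f))
  (e : PR) : P e :=
  let rec := PR_nested_ind HZ HS HP HC HR HM in
  match e with
  | PZero => HZ
  | PSucc => HS
  | PProj i => HP i
  | PComp f gs => HC f gs (rec f)
     (* The local recursion over the arguments supplies the hypotheses for the programs nested in a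
        list, which the automatic induction principle omits. *)
     ((fix go (s : list PR) : foldr (fun g acc => P g /\ acc) True s :=
        match s with
        | [::] => I
        | g :: s' => conj (rec g) (go s')
        end) gs)
  | PRec f g => HR f g (rec f) (rec g)
  | PMu f => HM f (rec f)
  end.

Lemma evals_consP g gs l ys : evals (g :: gs) l ys ->
  exists y ys', [/\ ys = y :: ys', eval g l y & evals gs l ys'].
Proof. by move=> h; inversion h; subst; eexists; eexists; split; eauto. Qed.

Lemma eval_compP f gs l z : eval (PComp f gs) l z ->
  exists2 ys, evals gs l ys & eval f ys z.
Proof. by move=> h; inversion h; subst; eexists; eauto. Qed.

Lemma eval_rec0P f g l z : eval (PRec f g) (0 :: l) z -> eval f l z.
Proof. by move=> h; inversion h. Qed.

Lemma eval_recSP f g n l z : eval (PRec f g) (n.+1 :: l) z ->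
  exists2 r, eval (PRec f g) (n :: l) r & eval g (n :: r :: l) z.
Proof. by move=> h; inversion h; subst; eexists; eauto. Qed.

Lemma eval_muP f l z : eval (PMu f) l z ->
  eval f (z :: l) 0 /\ forall m, m < z -> exists k, eval f (m :: l) k.+1.
Proof. by move=> h; inversion h. Qed.

Definition mono (r : nat -> nat) : Prop :=
  forall t t' z, t <= t' -> r t = z.+1 -> r t' = z.+1.

(* [r (t :: l)] is [0] when the evaluation has not succeeded within [t] steps,
   and [z.+1] when it has succeeded with value [z]. *)
Definition stepped (e : PR) (m : nat) (r : seq nat -> nat) : Prop :=
  [/\ computable m.+1 r,
      forall l, size l = m -> mono (fun t => r (t :: l))
    & forall l, size l = m -> forall z, eval e l z <-> exists t, r (t :: l) = z.+1].

(** Evaluation with bounded time is decidable. Since an answer, once given, persists, finitely many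
    partial evaluations can all be read at the largest of their times. *)
Lemma stepped_exists e m : exists r, stepped e m r.
Proof.
elim/PR_nested_ind: e m.
- move=> m; exists (fun _ => 1); split; first by computability_leaf.
    by move=> l _ t t' z _.
  move=> l _ z; split; first by move=> h; inversion h; exists 0.
  by move=> [_ [<-]]; exact: ev_zero.
(* Evaluation has no rule for [PSucc] on the empty list, so there the clock never answers. *)
- case=> [|m].
    exists (fun _ => 0); split; [by computability_leaf | by move=> l _ t t' z _ | ].
    case=> // _ z; split; last by case.
    by move=> h; inversion h.
  exists (fun l => (nth 0 l 1).+2); split; [by repeat computability | by move=> l _ t t' z _ |].
  case=> // x l _ z /=; split; first by move=> h; inversion h; exists 0.
  by move=> [_ [<-]]; exact: ev_succ.
- move=> i m; exists (fun l => (nth 0 l i.+1).+1).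
  split; [by repeat computability | by move=> l _ t t' z _ |].
  move=> l _ z /=; split; first by move=> h; inversion h; exists 0.
  by move=> [_ [<-]]; exact: ev_proj.
- move=> f gs IHf IHgs m.
  have [rf [Cf Mf Ef]] := IHf (size gs).
  have [rs [Srs Crs Mrs Ers]] : exists rs : seq (seq nat -> nat),
    [/\ size rs = size gs,
        forall i, i < size rs -> computable m.+1 (nth (fun _ => 0) rs i),
        forall l, size l = m -> forall i, i < size rs ->
           mono (fun t => nth (fun _ => 0) rs i (t :: l))
      & forall l, size l = m -> forall ys,
         evals gs l ys <-> exists t, [seq r (t :: l) | r <- rs] = [seq y.+1 | y <- ys]].
    elim: gs IHgs {rf Cf Mf Ef} => [_|g gs IH [IHg IHgs]].
      exists [::]; split=> // l _ ys; split.
        by move=> h; inversion h; exists 0.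
      by move=> [t]; case: ys => //= _; exact: evs_nil.
    have [rs [Srs Crs Mrs Ers]] := IH IHgs.
    have [r [Cr Mr Er]] := IHg m.
    exists (r :: rs); split=> /=; first by rewrite Srs.
    - by case.
    - by move=> l sl [|i] ilt; [exact: Mr | exact: Mrs].
    - move=> l sl ys; split.
        case/evals_consP=> y [ys0 [-> /(Er _ sl) [t1 e1] /(Ers _ sl) [t2 e2]]].
        exists (maxn t1 t2) => /=; congr (_ :: _).
          by apply: (Mr _ sl) e1; exact: leq_maxl.
        apply: (@eq_from_nth _ 0); first by rewrite -e2 !size_map.
        move=> i; rewrite size_map => ilt.
        have [j ej] : exists z, nth (fun _ => 0) rs i (t2 :: l) = z.+1.
          exists (nth 0 ys0 i).
          rewrite -(nth_map _ 0 (fun r => r (t2 :: l))) // e2 (nth_map 0) //.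
          by rewrite -(size_map succn) -e2 size_map.
        rewrite (nth_map (fun _ => 0)) // (Mrs _ sl i ilt t2 _ j) ?leq_maxr //.
        by rewrite -e2 (nth_map (fun _ => 0)) // ej.
      case: ys => [|y ys] [t] //= [e1 e2]; apply: evs_cons.
        by apply/(Er _ sl); exists t.
      by apply/(Ers _ sl); exists t.
  exists (fun l => if all (fun r => r l != 0) rs then
            rf (nth 0 l 0 :: [seq (r l).-1 | r <- rs]) else 0).
  have Mall l t t' : size l = m -> t <= t' -> all (fun r => r (t :: l) != 0) rs ->
     [seq r (t :: l) | r <- rs] = [seq r (t' :: l) | r <- rs].
    move=> sl tt' /(all_nthP (fun _ => 0)) h; apply: (@eq_from_nth _ 0); first by rewrite !size_map.
    move=> i; rewrite size_map => ilt; rewrite !(nth_map (fun _ => 0)) //.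
    set r := nth _ _ i; have [z ez] : exists z, r (t :: l) = z.+1.
      by have := h i ilt; rewrite -/r; case: (r _) => // z _; exists z.
    by rewrite ez; symmetry; exact: (Mrs _ sl i ilt t t' z tt' ez).
  have pm t l : [seq (r (t :: l)).-1 | r : seq nat -> nat <- rs] =
                map predn [seq r (t :: l) | r <- rs] by rewrite -map_comp.
  split.
  + apply: computable_if; last by computability_leaf.
      rewrite {Srs Mrs Ers Mall pm}; elim: rs Crs => [|r rs IH] H /=; first by computability_leaf.
      apply: computable_and; last by apply: IH => i ilt; exact: (H i.+1).
      by apply: computable_neg; apply: computable_eq0; exact: (H 0).
    apply: (computable_ext (f := fun l =>
      rf [seq g l | g <- (fun l => nth 0 l 0) :: [seq (fun l => (r l).-1) | r <- rs]])).
      apply: computable_comp => /=; first by rewrite size_map Srs.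
      case=> [|i]; rewrite ?size_map; first by move=> _; computability_leaf.
      rewrite ltnS => ilt; rewrite /= (nth_map (fun _ => 0)) //.
      by apply: computable_pred; exact: Crs.
    by move=> l _ /=; rewrite -map_comp.
  + move=> l sl t t' z tt' /=; case: ifP => // h1 e1.
    have eqt := Mall l t t' sl tt' h1.
    have -> : all (fun r => r (t' :: l) != 0) rs.
      rewrite -(all_map _ (fun x => x != 0)) -eqt (all_map _ (fun x => x != 0)).
      exact: h1.
    rewrite pm -eqt -pm; apply: (Mf _ _ t) => //.
    by rewrite size_map.
  + move=> l sl z; split.
      case/eval_compP=> ys /(Ers _ sl) [t1 e1].
      have sys : size ys = size gs by rewrite -Srs -(size_map succn ys) -e1 size_map.
      move/(Ef _ sys) => [t2 e2].
      have h1 : all (fun r => r (t1 :: l) != 0) rs.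
        rewrite -(all_map (fun r => r (t1 :: l)) (fun x => x != 0)) e1 all_map.
        by apply/allP.
      exists (maxn t1 t2) => /=.
      have eqt := Mall l t1 _ sl (leq_maxl t1 t2) h1.
      have -> : all (fun r => r (maxn t1 t2 :: l) != 0) rs.
        rewrite -(all_map _ (fun x => x != 0)) -eqt (all_map _ (fun x => x != 0)).
        exact: h1.
      rewrite pm -eqt e1 -map_comp map_id.
      by apply: (Mf _ sys) e2; exact: leq_maxr.
    move=> [t] /=; case: ifP => // h1 e1.
    apply: (@ev_comp _ _ _ [seq (r (t :: l)).-1 | r <- rs]).
      apply/(Ers _ sl); exists t; rewrite -map_comp.
      apply: (@eq_from_nth _ 0); first by rewrite !size_map.
      move=> i; rewrite size_map => ilt; rewrite !(nth_map (fun _ => 0)) //=.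
      by have := all_nthP (fun _ => 0) h1 i ilt; case: (nth _ _ _ _).
    by apply/Ef; [rewrite size_map | exists t].
- move=> f g IHf IHg; case=> [|m].
    exists (fun _ => 0); split; [by computability_leaf | by move=> l _ t t' z _ | ].
    case=> // _ z; split; last by case.
    by move=> h; inversion h.
  have [rf [Cf Mf Ef]] := IHf m.
  have [rg [Cg Mg Eg]] := IHg m.+2.
  (* The accumulator is itself a clocked result: [0] means that some stage is still undefined, and
     it blocks all later ones. *)
  pose R t l n := iteri n (fun i s => if s == 0 then 0 else rg (t :: i :: s.-1 :: l))
                    (rf (t :: l)).
  have MR l n : size l = m -> mono (fun t => R t l n).
    move=> sl; elim: n => [|n IH] t t' z tt' /=; first exact: Mf.
    rewrite -!/(R _ _ _); case: eqP => // h1 e1.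
    have [s es] : exists s, R t l n = s.+1 by case: (R t l n) h1 => // s; exists s.
    rewrite (IH _ _ _ tt' es) /=; apply: (Mg _ _ t) => //=; first by rewrite sl.
    by move: e1; rewrite es.
  exists (fun l => R (nth 0 l 0) (behead (behead l)) (nth 0 l 1)); split.
  + apply: (@computable_iteri _ (fun l => nth 0 l 1)
      (fun i s l => if s == 0 then 0 else rg (nth 0 l 0 :: i :: s.-1 :: behead (behead l)))
      (fun l => rf (nth 0 l 0 :: behead (behead l)))).
    * by computability_leaf.
    * apply: (@computable_subst 2 m [:: fun l => nth 0 l 0] rf) => //.
      by case=> // _; computability_leaf.
    * apply: computable_if; [by repeat computability | by computability_leaf |].
      apply: (@computable_subst 4 m [:: (fun l => nth 0 (behead (behead l)) 0);
        (fun l => nth 0 l 0); (fun l => (nth 0 l 1).-1)] rg) => //.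
      by case=> [|[|[|]]] //= _; repeat computability.
  + by case=> //= n l [sl]; exact: MR.
  + case=> //= n l [sl] z; elim: n z => [|n IH] z.
      split; first by move/eval_rec0P => h; apply/Ef.
      by move=> h; apply: ev_rec0; apply/Ef.
    split.
      case/eval_recSP=> r /IH [t1 e1].
      have sl2 : size (n :: r :: l) = m.+2 by rewrite /= sl.
      move/(Eg _ sl2) => [t2 e2].
      exists (maxn t1 t2); rewrite /= -/(R _ _ _).
      have -> : R (maxn t1 t2) l n = r.+1 by apply: MR e1 => //; exact: leq_maxl.
      by apply: (Mg _ _ t2) e2 => //; exact: leq_maxr.
    move=> [t]; rewrite /= -/(R _ _ _); case: eqP => // /eqP h1 e1.
    apply: (@ev_recS _ _ _ _ (R t l n).-1).
      by apply/IH; exists t; rewrite prednK // lt0n.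
    by apply/Eg; [rewrite /= sl | exists t].
- move=> f IHf m; have [r [Cr Mr Er]] := IHf m.+1.
  (* The first argument whose clocked value is [0] (not yet known) or [1] (the value zero). The
     search succeeds only in the second case, when all smaller arguments are known to have positive
     values. *)
  pose F t l := find (fun i => r (t :: i :: l) <= 1) (iota 0 t).
  pose R t l := if (F t l < t) && (r (t :: F t l :: l) == 1) then (F t l).+1 else 0.
  have RP t l z : R t l = z.+1 <->
      [/\ z < t, r (t :: z :: l) = 1 & forall i, i < z -> 1 < r (t :: i :: l)].
    rewrite /R; split.
      case: ifP => // /andP [h1 /eqP h2] [<-]; split=> // i ilt.
      have := before_find 0 ilt; rewrite nth_iota ?add0n; last exact: (ltn_trans ilt).
      by move/negbT; rewrite -ltnNge.
    move=> [h1 h2 h3].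
    have -> : F t l = z.
      have -> : F t l = find (fun i => r (t :: i :: l) <= 1) (iota 0 z ++ z :: iota z.+1 (t - z.+1)).
        by rewrite /F -[z :: _]/(iota z (t - z.+1).+1) -[X in iota X (_ - _).+1]add0n -iotaD -addSnnS subnKC.
      rewrite find_cat.
      have -> : has (fun i => r (t :: i :: l) <= 1) (iota 0 z) = false.
        apply/negbTE; rewrite -all_predC; apply/allP => i; rewrite mem_iota add0n /=.
        by move=> /h3; rewrite -ltnNge.
      by rewrite size_iota /= h2 addn0.
    by rewrite h1 h2.
  exists (fun l => R (nth 0 l 0) (behead l)).
  have CF : computable m.+1 (fun l => F (nth 0 l 0) (behead l)).
    apply: (@computable_find _ (fun l => nth 0 l 0)
       (fun i l => r (nth 0 l 0 :: i :: behead l) <= 1)); first by computability_leaf.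
    apply: computable_leq; last by computability_leaf.
    apply: (@computable_subst 2 m [:: (fun l => nth 0 (behead l) 0); (fun l => nth 0 l 0)] r) => //.
    by case=> [|[|]] // _; computability_leaf.
  split.
  + apply: computable_if; last by computability_leaf.
      apply: computable_and; first by apply: computable_ltn => //; computability_leaf.
      apply: computable_eq; last by computability_leaf.
      apply: (@computable_subst 1 m [:: (fun l => nth 0 l 0);
        (fun l => F (nth 0 l 0) (behead l))] r) => //.
      by case=> [|[|]] // _; computability_leaf.
    exact: computable_S.
  + move=> l sl t t' z tt' /= /RP [h1 h2 h3]; apply/RP; split.
    * exact: leq_trans tt'.
    * by apply: (Mr _ _ t) h2 => //=; rewrite sl.
    * move=> i /h3; case e1 : (r _) => [|k] //; rewrite ltnS => k0.
      by rewrite (Mr (i :: l) _ t t' k) //= sl.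
  + move=> l sl z; split.
      have sl2 i : size (i :: l) = m.+1 by rewrite /= sl.
      case/eval_muP => /(Er _ (sl2 z)) [t1 e1] H1.
      have [t2 e2] : exists t2, forall i, i < z -> 1 < r (t2 :: i :: l).
        elim: z H1 {t1 e1} => [|z IH] H1; first by exists 0.
        have [|t2 e2] := IH; first by move=> i ilt; apply: H1; exact: ltnW.
        have [k hk] := H1 z (ltnSn z); move/(Er _ (sl2 z)): hk => [t3 e3].
        exists (maxn t2 t3) => i; rewrite ltnS leq_eqVlt => /orP [/eqP ->|/e2].
          by rewrite (Mr _ (sl2 z) t3 _ k.+1) // leq_maxr.
        case e4 : (r _) => [|k'] // k'0.
        by rewrite (Mr _ (sl2 i) t2 _ k') // leq_maxl.
      (* Only arguments below the time are inspected, so the time must exceed [z] too. *)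
      exists (maxn z.+1 (maxn t1 t2)); apply/RP => /=; split.
      - exact: leq_maxl.
      - by apply: (Mr _ (sl2 z) t1) e1; lia.
      - move=> i /e2; case e4 : (r _) => [|k'] // k'0.
        by rewrite (Mr _ (sl2 i) t2 _ k') //; lia.
    move=> [t] /RP [/= h1 h2 h3]; apply: ev_mu.
      by apply/Er; [rewrite /= sl | exists t].
    move=> i /h3; case e4 : (r _) => [|[|k]] // _.
    by exists k; apply/Er; [rewrite /= sl | exists t].
Qed.

(** * Programs from decidable searches, and strings as numbers *)

(** Two answers of the monotone clock agree at the later time; no induction on the two mutual
    relations is required. *)
Lemma eval_det e l z z' : eval e l z -> eval e l z' -> z = z'.
Proof.
have [r [_ M E]] := stepped_exists e (size l).
move=> /(E l erefl) [t1 e1] /(E l erefl) [t2 e2].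
have := M l erefl t1 (maxn t1 t2) z (leq_maxl _ _) e1.
by rewrite (M l erefl t2 (maxn t1 t2) z' (leq_maxr _ _) e2) => -[].
Qed.

(** [PMu] stops at the value zero, hence it is applied to the negation of [D]. As [D] is total, the
    search diverges only if there is no witness. *)
Lemma search_program m (D : seq nat -> bool) g :
  computable m.+1 (fun l => D l) -> computable m.+1 g ->
  exists e, forall l, size l = m -> forall z, eval e l z <->
    exists w, [/\ D (w :: l), forall i, i < w -> ~~ D (i :: l) & z = g (w :: l)].
Proof.
move=> /computable_neg [d Hd] [pg Hg].
exists (PComp pg (PMu d :: [seq PProj i | i <- iota 0 m])) => l sl.
have step w : D (w :: l) -> (forall i, i < w -> ~~ D (i :: l)) ->
    eval (PComp pg (PMu d :: [seq PProj i | i <- iota 0 m])) l (g (w :: l)).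
  move=> h1 h2; apply: (@ev_comp _ _ _ (w :: l)); last by apply: Hg; rewrite /= sl.
  apply: evs_cons; last first.
    rewrite -{2}(nth_map_iota l) sl.
    by apply: evals_map => i; exact: ev_proj.
  apply: ev_mu; first by have := Hd (w :: l); rewrite h1 /= sl; exact.
  move=> i /h2 h3; exists 0.
  by have := Hd (i :: l); rewrite h3 /= sl; exact.
move=> z; split; last by move=> [w [h1 h2 ->]]; exact: step.
move=> h; case/eval_compP: (h) => ys /evals_consP [w [ys' [_ /eval_muP [h1 h2] _]] _].
have D1 : D (w :: l).
  have := Hd (w :: l); rewrite /= sl => /(_ erefl) /(eval_det h1).
  by case: (D _).
have D2 i : i < w -> ~~ D (i :: l).
  move=> /h2 [k hk]; have := Hd (i :: l); rewrite /= sl => /(_ erefl) /(eval_det hk).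
  by case: (D _).
by exists w; split=> //; apply: (eval_det h); exact: step.
Qed.

(** Turns the decidable graph of a machine into a program. A single bound [t] dovetails witness and
    output; all witnesses give the same output, so the first one found is right. *)
Lemma re_program (D : nat -> nat -> nat -> nat -> bool) :
  computable 4 (fun l => D (nth 0 l 0) (nth 0 l 1) (nth 0 l 2) (nth 0 l 3)) ->
  (forall w p x y w' y', D w p x y -> D w' p x y' -> y = y') ->
  exists W, forall p x y, eval W [:: p; x] y <-> exists w, D w p x y.
Proof.
move=> CD FD.
pose H y t p x := has (fun w => D w p x y) (iota 0 t.+1).
have CH : computable 4 (fun l => H (nth 0 l 0) (nth 0 l 1) (nth 0 l 2) (nth 0 l 3)).
  apply: computable_has; first by repeat computability.
  apply: (@computable4 (fun a b c d => D a b c d) CD); by computability_leaf.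
have CH2 : computable 3 (fun l => has (fun y => H y (nth 0 l 0) (nth 0 l 1) (nth 0 l 2))
     (iota 0 (nth 0 l 0).+1)).
  apply: computable_has; first by repeat computability.
  by apply: (@computable4 (fun a b c d => H a b c d) CH); computability_leaf.
have CH3 : computable 3 (fun l => find (fun y => H y (nth 0 l 0) (nth 0 l 1) (nth 0 l 2))
     (iota 0 (nth 0 l 0).+1)).
  apply: computable_find; first by repeat computability.
  by apply: (@computable4 (fun a b c d => H a b c d) CH); computability_leaf.
have [W HW] := search_program (D := fun l =>
   has (fun y => H y (nth 0 l 0) (nth 0 l 1) (nth 0 l 2)) (iota 0 (nth 0 l 0).+1)) CH2 CH3.
exists W => p x y; rewrite HW //; split.
  move=> [t [h1 _ ->]]; have {}h1 : has (fun y => H y t p x) (iota 0 t.+1) := h1.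
  change (exists w, D w p x (find (fun y => H y t p x) (iota 0 t.+1))).
  have := nth_find 0 h1; rewrite nth_iota; last by have := h1; rewrite has_find size_iota.
  by rewrite add0n => /hasP [w _ h]; exists w.
move=> [w Dw].
pose P t := has (fun y => H y t p x) (iota 0 t.+1).
have exP : exists t, P t.
  exists (maxn w y); apply/hasP; exists y; first by rewrite mem_iota; lia.
  by apply/hasP; exists w => //; rewrite mem_iota; lia.
exists (ex_minn exP); case: ex_minnP => t Pt mint; split=> //.
  by move=> i ilt; apply/negP => /mint; rewrite leqNgt ilt.
have := nth_find 0 Pt; rewrite nth_iota; last by have := Pt; rewrite /P has_find size_iota.
by rewrite add0n => /hasP [w' _ h]; apply: FD Dw h.
Qed.

(** * Binary strings and their numbers *)

Fixpoint lsb_val (s : bstring) : nat := if s is b :: s' then b + (lsb_val s').*2 else 0.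

Lemma lsb_val_lt s : lsb_val s < 2 ^ size s.
Proof. by elim: s => //= b s IH; rewrite expnS; case: b => /=; lia. Qed.

Lemma enc_lsb_val s : (enc s).+1 = 2 ^ size s + lsb_val s.
Proof. by elim: s => //= b s IH; rewrite expnS; lia. Qed.

(** By [enc_lsb_val] the successor of [enc s] is [2 ^ size s + lsb_val s]; its leading power of two
    gives the length, the rest the value. *)
Definition len (c : nat) := trunc_log 2 c.+1.
Definition num (c : nat) := c.+1 - 2 ^ len c.
Definition code (k v : nat) := (2 ^ k + v).-1.

Lemma len_enc s : len (enc s) = size s.
Proof.
rewrite /len enc_lsb_val; have := lsb_val_lt s => h.
by apply: trunc_log_eq => //; rewrite expnS; lia.
Qed.

Lemma num_enc s : num (enc s) = lsb_val s.
Proof. by rewrite /num len_enc enc_lsb_val addKn. Qed.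

Lemma code_enc s : code (size s) (lsb_val s) = enc s.
Proof. by rewrite /code -enc_lsb_val. Qed.

Fixpoint str (k v : nat) : bstring := if k is k'.+1 then odd v :: str k' v./2 else [::].

Lemma size_str k v : size (str k v) = k.
Proof. by elim: k v => //= k IH v; rewrite IH. Qed.

Lemma lsb_val_str k v : v < 2 ^ k -> lsb_val (str k v) = v.
Proof.
elim: k v => [|k IH] v /=; first by rewrite expn0; lia.
rewrite expnS => h; rewrite IH; last by lia.
by rewrite odd_double_half.
Qed.

Lemma str_lsb_val s : str (size s) (lsb_val s) = s.
Proof.
elim: s => //= b s IH; rewrite oddD odd_double oddb addbF.
by rewrite half_bit_double IH.
Qed.

Lemma lsb_val_inj s s' : size s = size s' -> lsb_val s = lsb_val s' -> s = s'.
Proof. by move=> e1 e2; rewrite -(str_lsb_val s) -(str_lsb_val s') e1 e2. Qed.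

Lemma enc_str k v : v < 2 ^ k -> enc (str k v) = code k v.
Proof. by move=> h; rewrite -code_enc size_str lsb_val_str. Qed.

Lemma enc_inj : injective enc.
Proof.
move=> s s' e; apply: lsb_val_inj; first by rewrite -len_enc e len_enc.
by rewrite -num_enc e num_enc.
Qed.

Lemma enc_surj c : exists s, enc s = c.
Proof.
have h : 2 ^ len c <= c.+1 by apply: trunc_logP.
have h2 : c.+1 < 2 ^ (len c).+1 by apply: trunc_log_ltn.
exists (str (len c) (num c)); rewrite enc_str /code /num; first by lia.
by move: h2; rewrite expnS; lia.
Qed.

Lemma lsb_val_cat p s : lsb_val (p ++ s) = lsb_val p + 2 ^ size p * lsb_val s.
Proof. by elim: p => /= [|b p ->]; rewrite ?mul1n // expnS; lia. Qed.

(** The reason why the first bit is the least significant one: taking a prefix is reduction modulo a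
    power of two, so the head [P %% N] of a code consists of its first bits. *)
Lemma prefix_lsb_val p p' : prefix p p' -> size p <= size p' /\ lsb_val p' %% 2 ^ size p = lsb_val p.
Proof.
case/prefixP => s ->; rewrite size_cat leq_addr; split=> //.
by rewrite lsb_val_cat addnC mulnC modnMDl modn_small // lsb_val_lt.
Qed.

Lemma lsb_val_prefix p p' : size p <= size p' -> lsb_val p' %% 2 ^ size p = lsb_val p -> prefix p p'.
Proof.
move=> h1 h2; apply/prefixP; exists (drop (size p) p').
suff -> : p = take (size p) p' by rewrite size_takel // cat_take_drop.
apply: lsb_val_inj; first by rewrite size_takel.
rewrite -h2 -{1}(cat_take_drop (size p) p') lsb_val_cat size_takel //.
rewrite addnC mulnC modnMDl modn_small //.
by have := lsb_val_lt (take (size p) p'); rewrite size_takel.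
Qed.

(** * The allocation step *)

Lemma sum_nat_le n (F G : nat -> nat) : (forall i, i < n -> F i <= G i) ->
  \sum_(0 <= i < n) F i <= \sum_(0 <= i < n) G i.
Proof. by move=> h; rewrite !big_nat; apply: leq_sum => i /andP [_]; exact: h. Qed.

Lemma sum_nat_eq n (F G : nat -> nat) : (forall i, i < n -> F i = G i) ->
  \sum_(0 <= i < n) F i = \sum_(0 <= i < n) G i.
Proof. by move=> h; rewrite big_nat [RHS]big_nat; apply: eq_bigr => i /andP [_]; exact: h. Qed.

Lemma sum_nat_ge n (F : nat -> nat) i : i < n -> F i <= \sum_(0 <= j < n) F j.
Proof.
by move=> ilt; rewrite (bigD1_seq i) /= ?leq_addr ?iota_uniq // mem_index_iota ilt.
Qed.

Lemma sum_nat_pos n (F : nat -> nat) : 0 < \sum_(0 <= i < n) F i ->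
  exists2 i, i < n & 0 < F i.
Proof.
elim: n => [|n IH]; first by rewrite big_geq.
rewrite big_nat_recr //= addn_gt0 => /orP [/IH [i h1 h2]|h]; last by exists n.
by exists i => //; exact: ltnW.
Qed.

Lemma sum_nat_atmost1 n (P : pred nat) :
  (forall i j, i < n -> j < n -> P i -> P j -> i = j) -> \sum_(0 <= i < n) P i <= 1.
Proof.
elim: n => [|n IH] h; first by rewrite big_geq.
rewrite big_nat_recr //=; case Pn : (P n); last first.
  by rewrite addn0; apply: IH => i j h1 h2; apply: h; exact: ltnW.
rewrite big1_seq // => i; rewrite mem_index_iota => /andP [_ /andP [_ ilt]].
case Pi : (P i) => //; have := h i n (ltnW ilt) (ltnSn n) Pi Pn; lia.
Qed.

Lemma sum_nat_set n (F G : nat -> nat) i : i < n -> (forall j, j != i -> F j = G j) ->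
  \sum_(0 <= j < n) F j + G i = \sum_(0 <= j < n) G j + F i.
Proof.
move=> ilt h; have u := iota_uniq 0 (n - 0).
have im : i \in index_iota 0 n by rewrite mem_index_iota.
rewrite (bigD1_seq i) //= [in RHS](bigD1_seq i) //= (eq_bigr G) //.
by lia.
Qed.

Lemma sum_nat_lt_all n (P : pred nat) : \sum_(0 <= i < n) P i < n ->
  exists2 i, i < n & ~~ P i.
Proof.
move=> h; case: (boolP (all P (iota 0 n))) => [/allP a|].
  move: h; rewrite (@sum_nat_eq n _ (fun => 1)).
    by rewrite sum_nat_const_nat subn0 muln1 ltnn.
  by move=> i ilt; rewrite a // mem_iota.
by rewrite -has_predC => /hasP [i]; rewrite mem_iota => /andP [_ ilt] /= nP; exists i.
Qed.

Lemma sum_nat_mulr n (F : nat -> nat) c :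
  (\sum_(0 <= i < n) F i) * c = \sum_(0 <= i < n) F i * c.
Proof. by rewrite big_distrl. Qed.

Lemma sum_nat_mull n (F : nat -> nat) c :
  c * (\sum_(0 <= i < n) F i) = \sum_(0 <= i < n) c * F i.
Proof. by rewrite big_distrr. Qed.

Lemma sum_nat_bool_le n (P : pred nat) : \sum_(0 <= i < n) P i <= n.
Proof.
rewrite -[X in _ <= X](subn0 n) -[X in _ <= X]muln1 -sum_nat_const_nat.
by apply: leq_sum => i _; case: (P i).
Qed.

(* A row [R] describes the codes in use at one vertex: slot [e = y * K + E] holds
   [0], or [P.+1] when the edge to [y] has received the code [P] at level [E].
   The head of a code is [P %% N], and [g] sends heads to units; all codes at a
   vertex whose heads lie in one unit have the same length. *)
Definition head_of (N a : nat) := a.-1 %% N.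

Definition occ (N : nat) (g R : nat -> nat) (u e : nat) : bool :=
  (R e != 0) && (g (head_of N (R e)) == u).

Definition cnt (N EE : nat) (g R : nat -> nat) (u : nat) : nat :=
  \sum_(0 <= e < EE) occ N g R u e.

Definition load (N EE K : nat) (g gz R : nat -> nat) (u z w : nat) : nat :=
  \sum_(0 <= e < EE) [&& occ N g R u e, e %/ K != z & gz (head_of N (R e)) == w].

(** The last clause makes one of any two units of a level full. So a level has at most one partly
    filled unit, which limits the room wasted on levels with few requests. *)
Definition row_ok (N EE K : nat) (T g R : nat -> nat) : bool :=
  all (fun e => (R e != 0) ==>
    (cnt N EE g R (g (head_of N (R e))) <= T (e %% K)) &&
    all (fun e' => (R e' != 0) ==>
      if g (head_of N (R e)) == g (head_of N (R e')) then
        (e %% K == e' %% K) && ((R e == R e') ==> (e == e'))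
      else (e %% K == e' %% K) ==>
        (T (e %% K) <= cnt N EE g R (g (head_of N (R e)))) ||
        (T (e %% K) <= cnt N EE g R (g (head_of N (R e'))))) (iota 0 EE)) (iota 0 EE).

(* The potential: an averaged code keeps it from growing, and it bounds the load
   that [x] puts on the heads it shares with any other vertex [z]. Edges to [z]
   itself do not count in [load], being served only once per level. *)
Definition row_pot (N EE K M q m : nat) (f : nat -> nat -> nat) (x : nat) (R : nat -> nat) : nat :=
  \sum_(0 <= u < q) \sum_(0 <= z < M) \sum_(0 <= w < q)
     (z != x) * (2 ^ load N EE K (f x) (f z) R u z w * m ^ cnt N EE (f x) R u *
        m.+1 ^ (EE - cnt N EE (f x) R u)).

Definition pot (N EE K M q m : nat) (f : nat -> nat -> nat) (A : nat -> nat -> nat) : nat :=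
  \sum_(0 <= x < M) row_pot N EE K M q m f x (A x).

(** A boolean, so that a code can be found by testing candidates. The bound counts each of the
    [M ^ 2 * q ^ 2] terms of the potential with its value for the empty table. *)
Definition inv (N EE K M q m : nat) (T : nat -> nat) (f A : nat -> nat -> nat) : bool :=
  all (fun x => row_ok N EE K T (f x) (A x)) (iota 0 M) &&
  (pot N EE K M q m f A <= M ^ 2 * q ^ 2 * m.+1 ^ EE).

Definition set_row (R : nat -> nat) (e P : nat) : nat -> nat :=
  fun e' => if e' == e then P.+1 else R e'.

(** * Units of one vertex *)

Section Row.
Variables (N EE K : nat) (T : nat -> nat) (g : nat -> nat).

Lemma row_okP R : reflect
  (forall e, e < EE -> R e != 0 ->
    cnt N EE g R (g (head_of N (R e))) <= T (e %% K) /\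
    forall e', e' < EE -> R e' != 0 ->
      if g (head_of N (R e)) == g (head_of N (R e')) then
        e %% K = e' %% K /\ (R e = R e' -> e = e')
      else e %% K = e' %% K ->
        (T (e %% K) <= cnt N EE g R (g (head_of N (R e)))) \/
        (T (e %% K) <= cnt N EE g R (g (head_of N (R e')))))
  (row_ok N EE K T g R).
Proof.
have io e : (e \in iota 0 EE) = (e < EE) by rewrite mem_iota.
apply: (iffP allP) => h e.
  move=> elt ne; move: (h e); rewrite io => /(_ elt) /implyP /(_ ne) /andP [h1 /allP h2].
  split=> // e' elt' ne'; move: (h2 e'); rewrite io => /(_ elt') /implyP /(_ ne').
  case: ifP => _.
    by move=> /andP [/eqP -> /implyP h3]; split=> // /eqP /h3 /eqP.
  by move=> /implyP h3 /eqP /h3 /orP.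
rewrite io => elt; apply/implyP => ne; have [h1 h2] := h e elt ne.
rewrite h1 /=; apply/allP => e'; rewrite io => elt'; apply/implyP => ne'.
have := h2 e' elt' ne'; case: ifP => _.
  by move=> [-> h3]; rewrite eqxx /=; apply/implyP => /eqP /h3 ->.
by move=> h3; apply/implyP => /eqP /h3 /orP.
Qed.

Lemma sum_nat_set0 (F G : nat -> nat) e : e < EE -> (forall j, j != e -> F j = G j) ->
  G e = 0 -> \sum_(0 <= j < EE) F j = \sum_(0 <= j < EE) G j + F e.
Proof. by move=> elt h G0; rewrite -(sum_nat_set elt h) G0 addn0. Qed.

Lemma cnt_set R e P u : e < EE -> R e = 0 ->
  cnt N EE g (set_row R e P) u = cnt N EE g R u + (g (P %% N) == u).
Proof.
move=> elt Re; rewrite /cnt (@sum_nat_set0 _ (fun e' => occ N g R u e') e) //.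
- by rewrite /occ /set_row eqxx.
- by move=> j /negbTE je; rewrite /occ /set_row je.
- by rewrite /occ Re.
Qed.

Lemma load_set gz R e P u z w : e < EE -> R e = 0 ->
  load N EE K g gz (set_row R e P) u z w =
  load N EE K g gz R u z w + [&& g (P %% N) == u, e %/ K != z & gz (P %% N) == w].
Proof.
move=> elt Re; rewrite /load (@sum_nat_set0 _
  (fun e => [&& occ N g R u e, e %/ K != z & gz (head_of N (R e)) == w]) e) //.
- by rewrite /occ /set_row eqxx.
- by move=> j /negbTE je; rewrite /occ /set_row je.
- by rewrite /occ Re.
Qed.

(* A unit that can receive one more entry of level [E]. *)
Definition good_unit R E u : Prop :=
  [/\ cnt N EE g R u < T E,
      forall e, e < EE -> R e != 0 -> g (head_of N (R e)) = u -> e %% K = E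
    & forall e, e < EE -> R e != 0 -> e %% K = E -> g (head_of N (R e)) != u ->
        T E <= cnt N EE g R (g (head_of N (R e)))].

Lemma row_ok_set R e P u : row_ok N EE K T g R -> e < EE -> R e = 0 ->
  good_unit R (e %% K) u -> g (P %% N) = u -> (forall e', e' < EE -> R e' <> P.+1) ->
  row_ok N EE K T g (set_row R e P).
Proof.
move=> /row_okP ok elt Re [gu1 gu2 gu3] gP fresh; apply/row_okP.
have cs v := cnt_set P v elt Re.
have cge v : cnt N EE g R v <= cnt N EE g (set_row R e P) v by rewrite cs leq_addr.
have cu : cnt N EE g (set_row R e P) u <= T (e %% K) by rewrite cs gP eqxx addn1.
have se : set_row R e P e = P.+1 by rewrite /set_row eqxx.
have sn e' : e' != e -> set_row R e P e' = R e' by rewrite /set_row => /negbTE ->.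
have hP : g (head_of N P.+1) = u by [].
move=> e1 lt1; case: (eqVneq e1 e) => [-> _|ne1].
  rewrite se hP; split=> // e2 lt2; case: (eqVneq e2 e) => [-> _|ne2].
    by rewrite se hP eqxx.
  rewrite sn // => nz2; case: ifP => [/eqP h|/negbT h].
    rewrite (gu2 e2) //; split=> // h2; case: (fresh e2 lt2 (esym h2)).
  by move=> h2; right; rewrite h2 in gu3 *; apply: leq_trans (cge _); apply: gu3;
     rewrite // eq_sym.
rewrite (sn e1) // => nz1; have [h1 h2] := ok e1 lt1 nz1; split.
  rewrite cs gP; case: eqP => [h|_]; last by rewrite addn0.
  by rewrite addn1 -h (gu2 e1).
move=> e2 lt2; case: (eqVneq e2 e) => [-> _|ne2].
  rewrite se hP; case: ifP => [/eqP h|/negbT h].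
    by rewrite (gu2 e1) //; split=> // h3; case: (fresh e1 lt1 h3).
  by move=> h3; left; rewrite h3; apply: leq_trans (cge _); apply: gu3.
rewrite sn // => nz2; have := h2 e2 lt2 nz2; case: ifP => // _ h3 /h3 [h|h]; [left|right];
  exact: leq_trans h (cge _).
Qed.

(** If no unit of level [E] has room, an empty one must be left. Each full unit has absorbed weight
    at least [Om] out of at most [W], and each of the [K - e0] levels has at most one unit that is
    in use and not full; by the last inequality this does not exhaust the [q] units. *)
Lemma good_unit_exists R E q e0 W Om (wt : nat -> nat) :
  row_ok N EE K T g R -> 0 < K -> (forall h, h < N -> g h < q) -> 0 < N ->
  (forall e, e < EE -> R e != 0 -> e0 <= e %% K) ->
  (forall E', e0 <= E' -> E' < K -> Om <= T E' * wt E') ->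
  \sum_(0 <= e < EE) (R e != 0) * wt (e %% K) <= W ->
  W + Om * (K - e0) < Om * q -> 0 < T E ->
  exists2 u, u < q & good_unit R E u.
Proof.
move=> /row_okP ok K0 gq N0 lev HOm HW Hq TE.
have gqR e : g (head_of N (R e)) < q by apply: gq; rewrite ltn_mod.
case: (boolP (has (fun e => [&& R e != 0, e %% K == E & cnt N EE g R (g (head_of N (R e))) < T E])
          (iota 0 EE))).
  move=> /hasP [e]; rewrite mem_iota => /andP [_ elt] /and3P [nz /eqP eE lt].
  exists (g (head_of N (R e))) => //; have [_ h] := ok e elt nz; split=> //.
    by move=> e' elt' nz' eq; have := h e' elt' nz'; rewrite eq eqxx eE => -[-> _].
  move=> e' elt' nz' eE' neq; have := h e' elt' nz'; rewrite eq_sym (negbTE neq) eE eE'.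
  by move=> /(_ erefl) [|//]; rewrite leqNgt lt.
move=> /hasPn none.
suff [u ult cu0] : exists2 u, u < q & cnt N EE g R u = 0.
  exists u => //; split; first by rewrite cu0.
    move=> e elt nz eu; have := @sum_nat_ge EE (fun e => occ N g R u e) e elt.
    by rewrite -/(cnt _ _ _ _ _) cu0 /occ nz eu eqxx.
  move=> e elt nz eE _; have := none e; rewrite mem_iota nz eE eqxx /= -leqNgt.
  exact.
pose full u := has (fun e => occ N g R u e && (T (e %% K) <= cnt N EE g R u)) (iota 0 EE).
pose open u E' := has (fun e => [&& occ N g R u e, e %% K == E'
    & cnt N EE g R u < T (e %% K)]) (iota 0 EE).
have used u : (0 < cnt N EE g R u) <= full u + \sum_(e0 <= E' < K) open u E'.
  case c0 : (0 < _) => //.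
  have [e elt] := sum_nat_pos c0; case oc : (occ _ _ _ _ _) => // _.
  case: (leqP (T (e %% K)) (cnt N EE g R u)) => h.
    suff -> : full u by rewrite leq_addr.
    by apply/hasP; exists e; rewrite ?mem_iota // oc h.
  apply: leq_trans (leq_addl _ _).
  have [nz _] := andP oc.
  rewrite (bigD1_seq (e %% K)) /= ?iota_uniq //; last first.
    by rewrite mem_index_iota lev // ltn_mod.
  suff -> : open u (e %% K) by [].
  by apply/hasP; exists e; rewrite ?mem_iota // oc eqxx h.
have open1 E' : \sum_(0 <= u < q) open u E' <= 1.
  apply: sum_nat_atmost1 => u u' _ _.
  case/hasP=> e; rewrite mem_iota => /andP [_ elt] /and3P [/andP [nz /eqP eu] /eqP eE lt].
  case/hasP=> e'; rewrite mem_iota => /andP [_ elt'] /and3P [/andP [nz' /eqP eu'] /eqP eE' lt'].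
  have [_ /(_ e' elt' nz')] := ok e elt nz.
  rewrite eu eu' eE eE'; case: eqP => // _ /(_ erefl).
  by rewrite leqNgt -eE lt leqNgt eE -eE' lt' => -[].
have nopen : \sum_(0 <= u < q) \sum_(e0 <= E' < K) open u E' <= K - e0.
  rewrite exchange_big /=.
  apply: (@leq_trans (\sum_(e0 <= E' < K) 1)); last by rewrite sum_nat_const_nat muln1.
  by apply: leq_sum => E' _.
have nfull : Om * (\sum_(0 <= u < q) full u) <= W.
  apply: leq_trans HW.
  rewrite sum_nat_mull.
  apply: (@leq_trans (\sum_(0 <= u < q) \sum_(0 <= e < EE) occ N g R u e * wt (e %% K))).
    apply: sum_nat_le => u _; case fu : (full u); last by rewrite muln0.
    rewrite muln1; case/hasP: fu => e; rewrite mem_iota => /andP [_ elt].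
    move=> /andP [/andP [nz /eqP eu] le].
    apply: leq_trans (HOm (e %% K) _ _) _; [exact: lev | by rewrite ltn_mod |].
    apply: leq_trans (leq_mul le (leqnn _)) _; rewrite /cnt sum_nat_mulr.
    apply: sum_nat_le => e' elt'; case oc : (occ _ _ _ _ _) => //.
    have [nz' /eqP eu'] := andP oc.
    have [_ /(_ e' elt' nz')] := ok e elt nz.
    by rewrite eu eu' eqxx => -[-> _].
  rewrite exchange_big /=; apply: sum_nat_le => e elt.
  rewrite -sum_nat_mulr leq_mul2r; apply/orP; right.
  case nz : (R e != 0); last by rewrite big1 // => u _; rewrite /occ nz.
  by apply: sum_nat_atmost1 => u u' _ _ /andP [_ /eqP <-] /andP [_ /eqP <-].
have : \sum_(0 <= u < q) (0 < cnt N EE g R u) < q.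
  apply: leq_ltn_trans (_ : \sum_(0 <= u < q) full u + (K - e0) < q).
    apply: leq_trans (leq_add (leqnn _) nopen); rewrite -big_split /=.
    by apply: sum_nat_le => u _.
  rewrite -(@ltn_pmul2l Om); last by case: (Om) Hq; rewrite ?mul0n ?addn0.
  by rewrite mulnDr; apply: leq_ltn_trans Hq; rewrite leq_add2r.
by case/sum_nat_lt_all => u ult; rewrite -eqn0Ngt => /eqP cu0; exists u.
Qed.

End Row.

Definition upd (K : nat) (A : nat -> nat -> nat) (x y E P : nat) : nat -> nat -> nat :=
  fun x' => if x' == x then set_row (A x) (y * K + E) P
            else if x' == y then set_row (A y) (x * K + E) P else A x'.

Definition head_load (N EE : nat) (R : nat -> nat) (h : nat) : nat :=
  \sum_(0 <= e < EE) ((R e != 0) && (head_of N (R e) == h)).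

Lemma sum_nat_pred1 n (P : pred nat) i : (forall j, P j -> j = i) ->
  \sum_(0 <= j < n) P j <= P i.
Proof.
move=> h; case Pi : (P i).
  by apply: sum_nat_atmost1 => j k _ _ /h -> /h ->.
by rewrite big1 // => j _; case Pj : (P j) => //; rewrite -(h _ Pj) Pj in Pi.
Qed.

(** * Lightly loaded heads and free tails *)

Section HeadLoad.
Variables (N EE K : nat).

Lemma head_load_sum (g gz R : nat -> nat) u z w :
  (forall e, e < EE -> occ N g R u e -> e %/ K != z) ->
  \sum_(0 <= h < N) ((g h == u) && (gz h == w)) * head_load N EE R h
    <= load N EE K g gz R u z w.
Proof.
move=> ne; rewrite /head_load /load.
rewrite (@sum_nat_eq _ _ (fun h => \sum_(0 <= e < EE) ((g h == u) && (gz h == w)) *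
   ((R e != 0) && (head_of N (R e) == h)))); last by move=> h _; rewrite sum_nat_mull.
rewrite exchange_big /=; apply: sum_nat_le => e elt.
rewrite (@sum_nat_eq _ _ (fun h => (g h == u) && (gz h == w) &&
   ((R e != 0) && (head_of N (R e) == h)) : nat)); last by move=> h _; rewrite mulnb.
apply: leq_trans (@sum_nat_pred1 _ _ (head_of N (R e)) _) _.
  by move=> j /andP [_ /andP [_ /eqP ->]].
rewrite eqxx andbT; case: (boolP (occ N g R u e)) => [oc|]; last first.
  by rewrite /occ; case: (R e != 0); case: (g _ == u); rewrite /= ?andbF.
rewrite ne //=; case/andP: oc => -> ->; by rewrite andbT.
Qed.

(** Markov's inequality: the mean load over [I] is at most [cap / 8], and a heavy head carries at
    least [cap / 2]. *)
Lemma heavy_heads (I : pred nat) R cap L :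
  \sum_(0 <= h < N) I h * head_load N EE R h <= L ->
  8 * L <= (\sum_(0 <= h < N) I h) * cap -> 0 < cap ->
  4 * (\sum_(0 <= h < N) (I h && ~~ (2 * head_load N EE R h < cap))) <= \sum_(0 <= h < N) I h.
Proof.
move=> h1 h2 cap0; rewrite -(@leq_pmul2r cap) //; apply: leq_trans h2.
suff : (\sum_(0 <= h < N) (I h && ~~ (2 * head_load N EE R h < cap))) * cap <= 2 * L by lia.
apply: leq_trans (leq_mul (leqnn 2) h1).
rewrite sum_nat_mulr sum_nat_mull; apply: sum_nat_le => h _.
by case: (I h); rewrite //= mul1n; case: ltnP; rewrite //= mul1n.
Qed.

(** Each entry with head [h] in one of the rows blocks a single tail, and there are fewer than [cap]
    such entries. *)
Lemma free_tail R R' h cap : 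
  head_load N EE R h + head_load N EE R' h < cap -> h < N ->
  exists2 t, t < cap & forall e, e < EE -> R e <> (h + N * t).+1 /\ R' e <> (h + N * t).+1.
Proof.
move=> hl hN; have N0 : 0 < N by case: (N) hN.
pose used R0 t := has (fun e => R0 e == (h + N * t).+1) (iota 0 EE).
have us R0 : \sum_(0 <= t < cap) used R0 t <= head_load N EE R0 h.
  apply: (@leq_trans (\sum_(0 <= t < cap) \sum_(0 <= e < EE) (R0 e == (h + N * t).+1))).
    apply: sum_nat_le => t _; case us : (used R0 t) => //.
    case/hasP: us => e; rewrite mem_iota => /andP [_ elt] eq.
    by apply: leq_trans (sum_nat_ge _ elt); rewrite eq.
  rewrite exchange_big /=; apply: sum_nat_le => e _.
  case: (posnP (R0 e)) => [->|R0e]; first by rewrite big1.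
  apply: leq_trans (@sum_nat_pred1 _ _ ((R0 e).-1 %/ N) _) _.
    by move=> t /eqP ->; rewrite /= addnC mulnC divnMDl // divn_small // addn0.
  case: eqP => // eq.
  by rewrite eq /head_of /= addnC mulnC modnMDl modn_small ?eqxx.
have : \sum_(0 <= t < cap) (used R t || used R' t) < cap.
  apply: leq_ltn_trans hl; apply: leq_trans (leq_add (us R) (us R')).
  by rewrite -big_split /=; apply: sum_nat_le => t _; case: (used R t) (used R' t) => [] [].
case/sum_nat_lt_all => t tlt; rewrite negb_or => /andP [/hasPn n1 /hasPn n2].
exists t => // e elt; have ei : e \in iota 0 EE by rewrite mem_iota.
by split; apply/eqP; [exact: n1 | exact: n2].
Qed.

End HeadLoad.

(** Only the terms of unit [u] change. There the counter contributes the factor [m / m.+1], and the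
    power of two doubles for at most one in [m] of the admissible heads, so the mean factor is at
    most [(1 + 1 / m) * m / (m + 1) = 1]. If [z] is the other end of the new edge, the head is bound
    to a unit of [z], but this edge is left out of [load]. *)
Lemma row_pot_avg N EE K M q m (f : nat -> nat -> nat) x R e u (G : pred nat) (P : nat -> nat) :
  e < EE -> R e = 0 ->
  (forall h, h < N -> G h -> f x h = u /\ P h %% N = h) ->
  (forall z w, z < M -> w < q -> z != x -> e %/ K != z ->
     m * (\sum_(0 <= h < N) (G h && (f z h == w))) <= \sum_(0 <= h < N) G h) ->
  \sum_(0 <= h < N) G h * row_pot N EE K M q m f x (set_row R e (P h)) <=
  (\sum_(0 <= h < N) G h) * row_pot N EE K M q m f x R.
Proof.
move=> elt Re GP Hw; rewrite /row_pot.
have push (s : nat -> nat -> nat -> nat -> nat) :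
   \sum_(0 <= h < N) G h * (\sum_(0 <= u < q) \sum_(0 <= z < M) \sum_(0 <= w < q) s h u z w) =
   \sum_(0 <= u < q) \sum_(0 <= z < M) \sum_(0 <= w < q) \sum_(0 <= h < N) G h * s h u z w.
  under eq_bigr => h _ do rewrite big_distrr /=.
  rewrite exchange_big /=; apply: eq_bigr => u' _.
  under eq_bigr => h _ do rewrite big_distrr /=.
  rewrite exchange_big /=; apply: eq_bigr => z _.
  under eq_bigr => h _ do rewrite big_distrr /=.
  by rewrite exchange_big.
rewrite push sum_nat_mull; apply: sum_nat_le => u' u'lt.
rewrite sum_nat_mull; apply: sum_nat_le => z zlt.
rewrite sum_nat_mull; apply: sum_nat_le => w wlt.
case: (eqVneq z x) => [_|zx].
  by rewrite big1 // => h _; rewrite mul0n muln0.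
rewrite mul1n.
case: (eqVneq u' u) => [->|u'u]; last first.
  rewrite sum_nat_mulr; apply: sum_nat_le => h hlt; case Gh : (G h) => //.
  have [unit_of Ph] := GP h hlt Gh.
  by rewrite cnt_set // load_set // Ph unit_of eq_sym (negbTE u'u) /= !addn0 mul1n.
case: (posnP (\sum_(0 <= h < N) G h)) => [G0|/sum_nat_pos [h0 h0lt]].
  rewrite big1_seq // => h; rewrite mem_index_iota => /andP [_ /andP [_ hlt]].
  by have := sum_nat_ge (fun h => G h : nat) hlt; rewrite G0; case: (G h).
rewrite lt0b => Gh0; have [fh0 Ph0] := GP h0 h0lt Gh0.
have cE : cnt N EE (f x) R u < EE.
  have := @sum_nat_bool_le EE (fun e' => occ N (f x) (set_row R e (P h0)) u e').
  by rewrite -/(cnt _ _ _ _ _) cnt_set // Ph0 fh0 eqxx addn1.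
set c := cnt _ _ _ R u in cE *; set l := load _ _ _ _ _ R _ _ _.
(* The old term without one factor [m.+1]; the factor is there because slot [e] is empty, whence
   [c < EE]. *)
pose X := 2 ^ l * m ^ c * m.+1 ^ (EE - c.+1).
have -> : 2 ^ l * m ^ c * m.+1 ^ (EE - c) = X * m.+1.
  by rewrite /X -(subnSK cE) expnSr; nia.
pose b h : bool := (e %/ K != z) && (f z h == w).
have term h : h < N -> G h * (1 * (2 ^ load N EE K (f x) (f z) (set_row R e (P h)) u z w *
    m ^ cnt N EE (f x) (set_row R e (P h)) u *
    m.+1 ^ (EE - cnt N EE (f x) (set_row R e (P h)) u))) = X * (m * (G h + (G h && b h))).
  move=> hlt; case Gh : (G h); last by rewrite /= !muln0.
  have [unit_of Ph] := GP h hlt Gh.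
  rewrite cnt_set // load_set // Ph unit_of eqxx /= -/(b h) addn1 !mul1n -/l -/c /X expnD expnS.
  by case: (b h); rewrite /= ?expn1 ?expn0; nia.
rewrite (sum_nat_eq term) -!sum_nat_mull big_split /= [X in _ <= X]mulnCA leq_mul2l.
apply/orP; right; rewrite mulnDr mulnS [X in X + _ <= _]mulnC [X in X <= _]addnC leq_add2r.
case: (boolP (e %/ K != z)) => ez; first by rewrite /b ez /=; apply: Hw.
by rewrite big1 ?muln0 // => h _; rewrite /b (negbTE ez) andbF.
Qed.

(** A single term is at most the whole sum. Cancelling the common power of [m.+1] leaves a bound on
    the exponent [load] in terms of the filling of the unit. *)
Lemma pot_load N EE K M q m f A B x u z w :
  pot N EE K M q m f A <= B * m.+1 ^ EE -> x < M -> u < q -> z < M -> w < q -> z != x ->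
  2 ^ load N EE K (f x) (f z) (A x) u z w * m ^ cnt N EE (f x) (A x) u <=
    B * m.+1 ^ cnt N EE (f x) (A x) u.
Proof.
move=> hp xlt ult zlt wlt zx; set c := cnt _ _ _ _ _; set l := load _ _ _ _ _ _ _ _ _.
have cE : c <= EE by exact: sum_nat_bool_le.
rewrite -(@leq_pmul2r (m.+1 ^ (EE - c))) ?expn_gt0 // -[X in _ <= X]mulnA -expnD subnKC //.
apply: leq_trans hp.
rewrite /pot; apply: leq_trans (sum_nat_ge _ xlt).
rewrite /row_pot; apply: leq_trans (sum_nat_ge _ ult).
apply: leq_trans (sum_nat_ge _ zlt).
apply: leq_trans (sum_nat_ge _ wlt).
by rewrite zx mul1n.
Qed.

(* Pairs of units meet in about the expected number of heads, triples in not much more. *)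
Definition spread (N M q : nat) (f : nat -> nat -> nat) : Prop :=
  (forall x y u v, x < M -> y < M -> x != y -> u < q -> v < q ->
     N <= 4 * q ^ 2 * \sum_(0 <= h < N) ((f x h == u) && (f y h == v))) /\
  (forall x y z u v w, x < M -> y < M -> z < M -> x != y -> z != x -> z != y ->
     u < q -> v < q -> w < q ->
     (\sum_(0 <= h < N) [&& f x h == u, f y h == v & f z h == w]) * q ^ 3 <= 4 * N).

Lemma slot_lt M K y E : y < M -> E < K -> y * K + E < M * K.
Proof. by move=> yM EK; nia. Qed.

Lemma slotK K y E : E < K -> (y * K + E) %/ K = y.
Proof. by move=> EK; rewrite divnMDl ?divn_small ?addn0 //; lia. Qed.

Lemma slot_mod K y E : E < K -> (y * K + E) %% K = E.
Proof. by move=> EK; rewrite modnMDl modn_small. Qed.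

(** * Choosing a code for one edge *)

Section Alloc.
Variables (N EE K M q m e0 : nat) (T : nat -> nat) (f : nat -> nat -> nat).
Hypotheses (N0 : 0 < N) (q0 : 0 < q) (EEK : EE = M * K) (mq : 32 * m <= q).
Hypothesis flt : forall x h, x < M -> h < N -> f x h < q.
Hypothesis spr : spread N M q f.

(** Unit [u] holds only codes of level [E], and the slot of [y] at that level is empty; hence no
    edge to [y] has its code in [u], and [load] misses nothing by ignoring such edges. The 32 is the
    8 of [heavy_heads] times the 4 lost in [spread]. *)
Lemma load_heads x y u v E cap A :
  x < M -> y < M -> y != x -> u < q -> v < q -> E < K -> 0 < cap ->
  pot N EE K M q m f A <= M ^ 2 * q ^ 2 * m.+1 ^ EE ->
  good_unit N EE K T (f x) (A x) E u -> A x (y * K + E) = 0 ->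
  (forall c l, c <= T E -> 2 ^ l * m ^ c <= M ^ 2 * q ^ 2 * m.+1 ^ c -> 32 * q ^ 2 * l <= N * cap) ->
  4 * (\sum_(0 <= h < N) ((f x h == u) && (f y h == v) && ~~ (2 * head_load N EE (A x) h < cap)))
    <= \sum_(0 <= h < N) ((f x h == u) && (f y h == v)).
Proof.
move=> xM yM yx uq vq EK cap0 hp [gu1 gu2 _] A0 HL.
apply: (@heavy_heads N EE (fun h => (f x h == u) && (f y h == v)) (A x) cap
  (load N EE K (f x) (f y) (A x) u y v)) => //.
  apply: head_load_sum => e elt /andP [nz /eqP eu].
  apply/eqP => ey; have ee : e = y * K + E by rewrite [LHS](divn_eq e K) ey (gu2 e).
  by rewrite ee A0 in nz.
have hl := HL _ _ (ltnW gu1) (pot_load hp xM uq yM vq yx).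
have [s2 _] := spr; have := s2 x y u v xM yM; rewrite eq_sym yx => /(_ isT uq vq) hI.
set I := \sum_(0 <= h < N) _ in hI *; set l := load _ _ _ _ _ _ _ _ _ in hl *.
have : 32 * q ^ 2 * l <= 4 * q ^ 2 * I * cap by apply: leq_trans hl _; rewrite leq_mul2r hI orbT.
by rewrite -!(mulnA, mulnCA (q ^ 2)); nia.
Qed.

Theorem alloc_step (A : nat -> nat -> nat) x y E cap W Om wt :
  x < M -> y < M -> x != y -> e0 <= E -> E < K -> 0 < cap ->
  inv N EE K M q m T f A ->
  A x (y * K + E) = 0 -> A y (x * K + E) = 0 ->
  (forall x e, x < M -> e < EE -> A x e != 0 -> e0 <= e %% K) ->
  (forall E', e0 <= E' -> E' < K -> Om <= T E' * wt E') ->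
  (forall x', (x' == x) || (x' == y) ->
     \sum_(0 <= e < EE) (A x' e != 0) * wt (e %% K) <= W) ->
  W + Om * (K - e0) < Om * q -> 0 < T E ->
  (forall c l, c <= T E -> 2 ^ l * m ^ c <= M ^ 2 * q ^ 2 * m.+1 ^ c -> 32 * q ^ 2 * l <= N * cap) ->
  exists2 P, P < N * cap & inv N EE K M q m T f (upd K A x y E P).
Proof.
move=> xM yM xy eE EK cap0 /andP [/allP rows hp] Ax Ay lev HOm HW Hq TE HL.
have yx : y != x by rewrite eq_sym.
have K0 : 0 < K by lia.
have rowok x' : x' < M -> row_ok N EE K T (f x') (A x') by move=> h; apply: rows; rewrite mem_iota.
have [u uq gu] : exists2 u, u < q & good_unit N EE K T (f x) (A x) E u.
  apply: (@good_unit_exists N EE K T (f x) (A x) E q e0 W Om wt) => //; first exact: rowok.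
  - by move=> h; exact: flt.
  - by move=> e; exact: lev.
  - by apply: HW; rewrite eqxx.
have [v vq gv] : exists2 v, v < q & good_unit N EE K T (f y) (A y) E v.
  apply: (@good_unit_exists N EE K T (f y) (A y) E q e0 W Om wt) => //; first exact: rowok.
  - by move=> h; exact: flt.
  - by move=> e; exact: lev.
  - by apply: HW; rewrite eqxx orbT.
have hx := load_heads xM yM yx uq vq EK cap0 hp gu Ax HL.
have hy := load_heads yM xM xy vq uq EK cap0 hp gv Ay HL.
pose I h := (f x h == u) && (f y h == v).
pose lx h := 2 * head_load N EE (A x) h < cap.
pose ly h := 2 * head_load N EE (A y) h < cap.
pose G h := [&& I h, lx h & ly h].
have {}hx : 4 * (\sum_(0 <= h < N) (I h && ~~ lx h)) <= \sum_(0 <= h < N) I h by [].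
have {}hy : 4 * (\sum_(0 <= h < N) (I h && ~~ ly h)) <= \sum_(0 <= h < N) I h.
  have e1 : \sum_(0 <= h < N) I h = \sum_(0 <= h < N) ((f y h == v) && (f x h == u)).
    by apply: sum_nat_eq => h _; rewrite /I andbC.
  rewrite e1; apply: leq_trans hy; rewrite leq_mul2l /=; apply: sum_nat_le => h _.
  by rewrite /I /ly; case: (f x h == u); case: (f y h == v).
(* At most a quarter of the common heads is heavy at [x] and a quarter at [y]; half of them
   remain. *)
have GI : \sum_(0 <= h < N) I h <= 2 * \sum_(0 <= h < N) G h.
  have : \sum_(0 <= h < N) I h <= \sum_(0 <= h < N) G h + \sum_(0 <= h < N) (I h && ~~ lx h)
      + \sum_(0 <= h < N) (I h && ~~ ly h).
    rewrite -!big_split /=; apply: sum_nat_le => h _; rewrite /G.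
    by case: (I h) (lx h) (ly h) => [] [] [].
  by lia.
have [s2 s3] := spr.
have NG : N <= 8 * q ^ 2 * \sum_(0 <= h < N) G h.
  apply: leq_trans (s2 x y u v xM yM xy uq vq) _.
  by apply: leq_trans (leq_mul (leqnn _) GI) _; rewrite mulnA leq_mul2r; apply/orP; right; lia.
pose used h t := has (fun e => (A x e == (h + N * t).+1) || (A y e == (h + N * t).+1)) (iota 0 EE).
(* The head gives the low bits, the first tail free in both rows the high ones. The choice of the
   tail does not affect the potential. *)
pose P h := h + N * find (fun t => ~~ used h t) (iota 0 cap).
have GP h : h < N -> G h -> [/\ P h < N * cap, P h %% N = h &
    forall e, e < EE -> A x e <> (P h).+1 /\ A y e <> (P h).+1].
  move=> hN /and3P [_ hlx hly].
  have hs : has (fun t => ~~ used h t) (iota 0 cap).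
    have [|t tlt free] := @free_tail N EE (A x) (A y) h cap _ hN.
      by move: hlx hly; rewrite /lx /ly; lia.
    apply/hasP; exists t; first by rewrite mem_iota.
    apply/hasPn => e; rewrite mem_iota => /andP [_ elt]; have [f1 f2] := free e elt.
    by rewrite negb_or; apply/andP; split; apply/eqP.
  have flt' : find (fun t => ~~ used h t) (iota 0 cap) < cap by have := hs; rewrite has_find size_iota.
  have := nth_find 0 hs; rewrite nth_iota // add0n => /hasPn free.
  split.
  - by rewrite /P; nia.
  - by rewrite /P addnC mulnC modnMDl modn_small.
  - move=> e elt; have := free e; rewrite mem_iota elt => /(_ isT).
    by rewrite negb_or => /andP [/eqP f1 /eqP f2].
(* Origin of the 32 in [mq]: three units share at most [4 * N / q ^ 3] heads, and [G] has at least
   [N / (8 * q ^ 2)] of them. *)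
have GI3 z w : z < M -> w < q -> z != x -> z != y ->
     m * (\sum_(0 <= h < N) (G h && (f z h == w))) <= \sum_(0 <= h < N) G h.
  move=> zM wq zx zy; have := s3 x y z u v w xM yM zM xy zx zy uq vq wq.
  set S := \sum_(0 <= h < N) [&& _, _ & _] => hS.
  have : \sum_(0 <= h < N) (G h && (f z h == w)) <= S.
    apply: sum_nat_le => h _; rewrite /G /I.
    by case: (f x h == u) (f y h == v) (f z h == w) (lx h) (ly h) => [] [] [] [] [].
  set S' := \sum_(0 <= h < N) (G h && _) => hS'.
  set g := \sum_(0 <= h < N) G h in NG *.
  have h1 : S' * q ^ 3 <= 32 * q ^ 2 * g.
    apply: leq_trans (leq_mul hS' (leqnn _)) _; apply: leq_trans hS _.
    by apply: leq_trans (leq_mul (leqnn 4) NG) _; lia.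
  have h2 : S' * q <= 32 * g.
    rewrite -(@leq_pmul2r (q ^ 2)) ?expn_gt0 ?q0 //.
    by rewrite -mulnA -expnS; apply: leq_trans h1 _; lia.
  by have := leq_mul (leqnn S') mq; lia.
have sxE := slot_lt yM EK; have syE := slot_lt xM EK; rewrite -EEK in sxE syE.
have avg x' : x' < M ->
  \sum_(0 <= h < N) G h * row_pot N EE K M q m f x' (upd K A x y E (P h) x') <=
  (\sum_(0 <= h < N) G h) * row_pot N EE K M q m f x' (A x').
  move=> x'M; rewrite /upd; case: (eqVneq x' x) => [->|x'x].
    apply: (@row_pot_avg _ _ _ _ _ _ _ _ _ _ u) => //.
      by move=> h hN Gh; have [_ ? _] := GP h hN Gh; case/and3P: Gh => /andP [/eqP ? _].
    by move=> z w zM wq zx; rewrite slotK // eq_sym; exact: GI3.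
  case: (eqVneq x' y) => [->|x'y].
    apply: (@row_pot_avg _ _ _ _ _ _ _ _ _ _ v) => //.
      by move=> h hN Gh; have [_ ? _] := GP h hN Gh; case/and3P: Gh => /andP [_ /eqP ?].
    by move=> z w zM wq zy; rewrite slotK // eq_sym => zx; exact: GI3.
  by rewrite -sum_nat_mulr.
have G0 : 0 < \sum_(0 <= h < N) G h by case: (\sum_(0 <= h < N) _) NG => //; rewrite muln0; lia.
(* Otherwise every head in [G] would raise the potential by at least one, contrary to the averages
   in [avg] summed over all rows. *)
have [h hN /andP [Gh hpot]] : exists2 h, h < N &
    G h && (pot N EE K M q m f (upd K A x y E (P h)) <= pot N EE K M q m f A).
  case: (boolP (has (fun h => G h && (pot N EE K M q m f (upd K A x y E (P h)) <=
       pot N EE K M q m f A)) (iota 0 N))) => [/hasP [h]|/hasPn none].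
    by rewrite mem_iota => /andP [_ hN] ?; exists h.
  have : \sum_(0 <= h < N) G h * pot N EE K M q m f (upd K A x y E (P h)) <=
         (\sum_(0 <= h < N) G h) * pot N EE K M q m f A.
    rewrite [X in _ <= _ * X]/pot sum_nat_mull.
    under eq_bigr => h _ do rewrite /pot sum_nat_mull.
    by rewrite exchange_big /=; apply: sum_nat_le => x' x'M; exact: avg.
  rewrite leqNgt => /negP []; apply: (@leq_trans ((\sum_(0 <= h < N) G h) * (pot N EE K M q m f A).+1)).
    by rewrite ltn_pmul2l.
  rewrite sum_nat_mulr; apply: sum_nat_le => h hN.
  have := none h; rewrite mem_iota hN => /(_ isT); case: (G h) => //=.
  by rewrite -ltnNge !mul1n.
have [PN Ph free] := GP h hN Gh.
exists (P h) => //; apply/andP; split; last exact: leq_trans hp.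
have /and3P [/andP [/eqP fx /eqP fy] _ _] := Gh.
apply/allP => x'; rewrite mem_iota => /andP [_ x'M]; rewrite /upd.
case: (eqVneq x' x) => [->|x'x].
  apply: (@row_ok_set N EE K T (f x) (A x) (y * K + E) (P h) u) => //; first exact: rowok.
  - by rewrite slot_mod.
  - by rewrite Ph.
  - by move=> e elt; have [] := free e elt.
case: (eqVneq x' y) => [->|x'y]; last exact: rowok.
apply: (@row_ok_set N EE K T (f y) (A y) (x * K + E) (P h) v) => //; first exact: rowok.
- by rewrite slot_mod.
- by rewrite Ph.
- by move=> e elt; have [] := free e elt.
Qed.

End Alloc.

(** * Existence of a spreading hash table *)

(** The inner claim is Bernoulli's inequality [(1 - 1 / (m + 1)) ^ j >= 1 - j / (m + 1)], cleared of
    denominators; the right-hand side is at least one half. *)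
Lemma expS_le2 m j : 2 * j <= m.+1 -> m.+1 ^ j <= 2 * m ^ j.
Proof.
move=> hj.
suff h : m.+1 ^ j * (m.+1 - j) <= m ^ j * m.+1.
  have h2 : m.+1 <= 2 * (m.+1 - j) by lia.
  rewrite -(@leq_pmul2r m.+1) //.
  apply: leq_trans (leq_mul (leqnn _) h2) _; rewrite mulnCA -mulnA leq_mul2l.
  exact: h.
elim: j hj => [|j IH] hj; first by rewrite !expn0 subn0.
have {}IH := IH ltac:(lia).
rewrite !expnS -mulnA mulnCA.
have h3 : m.+1 * (m.+1 - j.+1) <= m * (m.+1 - j) by nia.
apply: leq_trans (leq_mul (leqnn _) h3) _.
by rewrite mulnCA -mulnA leq_mul2l IH orbT.
Qed.

(** Bernoulli again: [(1 + 1 / (m - 1)) ^ m >= 1 + m / (m - 1) >= 2]. For [m = 1] the left-hand side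
    vanishes. *)
Lemma exp_pred_le m : 0 < m -> 2 * m.-1 ^ m <= m ^ m.
Proof.
case: m => // m _; rewrite [m.+1.-1]/=.
case: m => [|m]; first by rewrite exp0n.
suff h j : m.+1 ^ j * (m.+1 + j) <= m.+2 ^ j * m.+1.
  have := h m.+2; rewrite -(@leq_pmul2r m.+1 (2 * _)) //.
  by apply: leq_trans; rewrite mulnAC mulnC leq_mul2l; apply/orP; right; lia.
elim: j => [|j IH]; first by rewrite !expn0 addn0.
rewrite !expnS -!mulnA.
apply: (@leq_trans (m.+2 * (m.+1 ^ j * (m.+1 + j)))); last by rewrite leq_mul2l IH orbT.
by rewrite mulnCA [X in _ <= X]mulnCA leq_mul2l; apply/orP; right; nia.
Qed.

Lemma leq_expr a b e : a <= b -> a ^ e <= b ^ e.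
Proof. by move=> ab; case: e => // e; rewrite leq_exp2r. Qed.

(** * Tail bounds for a random table *)

Section Hash.
Variables (M q N : nat).
Local Notation col := {ffun 'I_M -> 'I_q}.
Local Notation table := {ffun 'I_N -> col}.

Lemma count_match (S : {set 'I_M}) (t : 'I_M -> 'I_q) :
  \sum_(w : col) [forall i in S, w i == t i] = q ^ (M - #|S|).
Proof.
pose a i j : nat := (i \in S) ==> (j == t i).
transitivity (\sum_(w : col) \prod_(i < M) a i (w i)).
  apply: eq_bigr => w _; case: (boolP [forall i in S, _]) => [/forall_inP h|].
    by rewrite big1 // => i _; rewrite /a; case: (boolP (i \in S)) => // /h /eqP ->; rewrite eqxx.
  rewrite negb_forall_in => /exists_inP [i iS ni].
  by rewrite (bigD1 i) //= /a iS (negbTE ni).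
rewrite -(bigA_distr_bigA a).
transitivity (\prod_(i < M) (if i \notin S then q else 1)).
  apply: eq_bigr => i _; rewrite /a; case: (i \in S) => /=.
    by rewrite (bigD1 (t i)) //= eqxx big1 // => j /negbTE ->.
  by rewrite sum_nat_const card_ord muln1.
rewrite -big_mkcond prod_nat_const /=; congr (_ ^ _).
have -> : M - #|S| = #|~: S| by rewrite [RHS]cardsCs setCK card_ord.
by apply: eq_card => i; rewrite !inE.
Qed.

(** Markov's inequality for a product over the columns of a uniformly random table. The columns are
    independent, so the products sum up to the [N]-th power of the sum over one column. *)
Lemma moment (c : col -> nat) (bad : pred table) th :
  (forall F, bad F -> th <= \prod_(h < N) c (F h)) ->
  #|bad| * th <= (\sum_(w : col) c w) ^ N.
Proof.
move=> h; rewrite -[X in _ ^ X](card_ord N) -prod_nat_const.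
rewrite (bigA_distr_bigA (fun _ => c)) -sum_nat_const big_mkcond.
by apply: leq_sum => F _; case: ifP => // /h.
Qed.

Definition hits (S : {set 'I_M}) (t : 'I_M -> 'I_q) (F : table) : nat :=
  \sum_(h < N) [forall i in S, F h i == t i].

(** A lower Chernoff bound; the expected number of hits is [4 * j]. A miss weighs 2 and a hit 1,
    with mean [2 * (1 - 1 / (2 * a))] for [a = q ^ #|S|], while a table with fewer than [j] hits
    weighs at least [2 ^ (N - j)]. *)
Lemma few_hits (S : {set 'I_M}) t j : #|S| <= M -> N = 4 * q ^ #|S| * j -> 0 < q ->
  #|[pred F : table | hits S t F < j]| * 2 ^ j <= (q ^ M) ^ N.
Proof.
move=> SM Nj q0.
pose c (w : col) := 2 - [forall i in S, w i == t i].
have hbad F : [pred F : table | hits S t F < j] F -> 2 ^ (N - j) <= \prod_(h < N) c (F h).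
  move=> /= hlt; apply: (@leq_trans (2 ^ (N - hits S t F))); first by rewrite leq_exp2l //; lia.
  have -> : \prod_(h < N) c (F h) = \prod_(h < N) 2 ^ (~~ [forall i in S, F h i == t i]).
    by apply: eq_bigr => h _; rewrite /c; case: [forall i in S, _].
  rewrite -expn_sum leq_exp2l // leq_subLR /hits -big_split /=.
  rewrite -[X in X <= _](card_ord N) -sum1_card; apply: leq_sum => h _.
  by case: [forall i in S, _].
have := moment hbad.
have -> : \sum_(w : col) c w = q ^ (M - #|S|) * (2 * q ^ #|S|).-1.
  have e : \sum_(w : col) c w + \sum_(w : col) [forall i in S, w i == t i] = 2 * q ^ M.
    rewrite -big_split /= -[q ^ M](_ : #|col| = _); last by rewrite card_ffun !card_ord.
    rewrite mulnC -sum_nat_const; apply: eq_bigr => w _.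
    by rewrite /c; case: [forall i in S, _].
  rewrite count_match in e.
  have e2 : q ^ M = q ^ (M - #|S|) * q ^ #|S| by rewrite -expnD subnK.
  have qS : 0 < q ^ #|S| by rewrite expn_gt0 q0.
  by rewrite -subn1 mulnBr muln1 mulnCA -e2 -e addnK.
set a := q ^ #|S| in Nj *; have a0 : 0 < a by rewrite expn_gt0 q0.
move=> h.
(* There are [2 * j] blocks of [2 * a] columns, and each block gains a factor of one half by
   [exp_pred_le]. *)
have step : 2 ^ (2 * j) * (2 * a).-1 ^ N <= (2 * a) ^ N.
  have -> : N = 2 * a * (2 * j) by rewrite Nj; lia.
  rewrite ![_ ^ (2 * a * _)]expnM -expnMn; apply: leq_expr.
  by apply: exp_pred_le; lia.
rewrite -(@leq_pmul2r (2 ^ (N - j))) ?expn_gt0 // -mulnA -expnD.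
have jN : j <= N by rewrite Nj; nia.
rewrite subnKC // -(@leq_pmul2r (2 ^ j)) ?expn_gt0 //.
have -> : (q ^ M) ^ N = (q ^ (M - #|S|)) ^ N * a ^ N.
  by rewrite -expnMn -expnD subnK.
rewrite -[X in _ <= X]mulnA -expnD subnK //.
apply: (@leq_trans (#|[pred F : table | hits S t F < j]| * 2 ^ (N - j) * 2 ^ (2 * j))).
  by rewrite -!mulnA -!expnD leq_mul2l leq_exp2l //; apply/orP; right; lia.
apply: leq_trans (leq_mul h (leqnn _)) _.
rewrite expnMn -mulnA [X in _ <= X]mulnAC -mulnA leq_mul2l; apply/orP; right.
by rewrite mulnC; apply: leq_trans step _; rewrite expnMn.
Qed.

(** An upper Chernoff bound; the expected number of hits is [j]. A hit weighs 2 and a miss 1, with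
    mean [1 + 1 / a]. Squaring [expS_le2] at [a / 2] gives [(1 + 1 / a) ^ a <= 4]; [q] is even to
    make this half exact. *)
Lemma many_hits (S : {set 'I_M}) t j : #|S| <= M -> N = q ^ #|S| * j -> 0 < q -> ~~ odd q -> 0 < #|S| ->
  #|[pred F : table | 4 * j < hits S t F]| * 2 ^ (2 * j) <= (q ^ M) ^ N.
Proof.
move=> SM Nj q0 oq S0.
pose c (w : col) := 2 ^ [forall i in S, w i == t i].
have hbad F : [pred F : table | 4 * j < hits S t F] F -> 2 ^ (4 * j) <= \prod_(h < N) c (F h).
  by move=> /= hlt; rewrite -expn_sum leq_exp2l // ltnW.
have := moment hbad.
have -> : \sum_(w : col) c w = q ^ (M - #|S|) * (q ^ #|S|).+1.
  transitivity (\sum_(w : col) (1 + [forall i in S, w i == t i])).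
    by apply: eq_bigr => w _; rewrite /c; case: [forall i in S, _].
  rewrite big_split /= count_match sum1_card card_ffun !card_ord.
  by rewrite mulnS -expnD subnK // addnC.
set a := q ^ #|S| in Nj *; have a0 : 0 < a by rewrite expn_gt0 q0.
move=> h.
have oa : ~~ odd a by rewrite /a oddX negb_or oq andbT -lt0n.
have step : a.+1 ^ N <= 2 ^ (2 * j) * a ^ N.
  rewrite Nj ![_ ^ (a * j)]expnM [2 ^ _]expnM -expnMn; apply: leq_expr.
  have := @leq_expr _ _ 2 (@expS_le2 a a./2 ltac:(lia)).
  by rewrite expnMn -!expnM; have -> : a./2 * 2 = a by lia.
have -> : (q ^ M) ^ N = (q ^ (M - #|S|)) ^ N * a ^ N.
  by rewrite -expnMn -expnD subnK.
rewrite -(@leq_pmul2r (2 ^ (2 * j))) ?expn_gt0 // -mulnA -expnD.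
have -> : 2 * j + 2 * j = 4 * j by lia.
apply: leq_trans h _; rewrite expnMn -mulnA leq_mul2l; apply/orP; right.
by rewrite mulnC.
Qed.

(** The union bound: there are more tables than failures of all kinds together. *)
Lemma avoid_all (I : finType) (B : I -> pred table) :
  \sum_(i : I) #|B i| < (q ^ M) ^ N -> exists F, forall i, ~~ B i F.
Proof.
move=> h; case: (boolP [exists F : table, [forall i, ~~ B i F]]) => [/existsP [F /forallP ?]|].
  by exists F.
rewrite negb_exists => /forallP none; move: h; rewrite ltnNge => /negP [].
have -> : (q ^ M) ^ N = \sum_(F : table) 1 by rewrite sum1_card !card_ffun !card_ord.
under [X in _ <= X]eq_bigr => i _ do rewrite -sum1_card big_mkcond.
rewrite exchange_big /=; apply: leq_sum => F _.
have := none F; rewrite negb_forall => /existsP [i]; rewrite negbK => Bi.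
by rewrite (bigD1 i) //= /in_mem /= Bi.
Qed.

End Hash.

Lemma forall_set2 (T : finType) (rT : eqType) (x y : T) (F : T -> rT) u v : x != y ->
  [forall i in [set x; y], F i == (if i == x then u else v)] = (F x == u) && (F y == v).
Proof.
move=> xy; have yx : (y == x) = false by rewrite eq_sym (negbTE xy).
apply/forall_inP/andP => [h|[h1 h2] i].
  by move: (h x) (h y); rewrite !inE !eqxx orbT yx => /(_ isT) -> /(_ isT) ->.
by rewrite !inE => /orP [] /eqP ->; rewrite ?eqxx ?yx.
Qed.

Lemma forall_set3 (T : finType) (rT : eqType) (x y z : T) (F : T -> rT) u v w :
  x != y -> z != x -> z != y ->
  [forall i in z |: [set x; y], F i == (if i == x then u else if i == y then v else w)] =
  [&& F x == u, F y == v & F z == w].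
Proof.
move=> xy /negbTE zx /negbTE zy; have yx : (y == x) = false by rewrite eq_sym (negbTE xy).
apply/forall_inP/and3P => [h|[h1 h2 h3] i].
  move: (h x) (h y) (h z); rewrite !inE !eqxx !orbT yx zx zy.
  by move=> /(_ isT) -> /(_ isT) -> /(_ isT) ->.
by rewrite !inE => /orP [/eqP ->|/orP [] /eqP ->]; rewrite ?zx ?zy ?eqxx ?yx.
Qed.

(** The tables failing for one pair of units make up at most [2 ^ - j2] of all, those failing for
    one triple at most [2 ^ - (2 * j3)]. As [j2] and [j3] are large multiples of [4 ^ l] and
    [2 ^ l], and [n < 2 * 2 ^ l], each of the two families spoils at most a quarter of the
    tables. *)
Lemma spread_exists_ord n l (M := 2 ^ n) (q := 2 ^ (l + 6)) (N := 2 ^ (4 * l + 22)) :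
  2 ^ l <= n < 2 ^ l.+1 ->
  exists F : {ffun 'I_N -> {ffun 'I_M -> 'I_q}},
   (forall x y u v, x != y ->
     N <= 4 * q ^ 2 * \sum_(h < N) ((F h x == u) && (F h y == v))) /\
   (forall x y z u v w, x != y -> z != x -> z != y ->
     (\sum_(h < N) [&& F h x == u, F h y == v & F h z == w]) * q ^ 3 <= 4 * N).
Proof.
move=> /andP [ln nl]; rewrite expnS in nl.
have flog : l < 2 ^ l by exact: ltn_expl.
pose I2 := ('I_M * 'I_M * 'I_q * 'I_q)%type.
pose I3 := ('I_M * 'I_M * 'I_M * 'I_q * 'I_q * 'I_q)%type.
pose j2 := 2 ^ (2 * l + 8); pose j3 := 2 ^ (l + 4).
have q0 : 0 < q by rewrite expn_gt0.
have N2 : N = 4 * q ^ 2 * j2.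
  by rewrite /N /q /j2 -[4]/(2 ^ 2) -expnM -!expnD; congr (2 ^ _); lia.
have N3 : N = q ^ 3 * j3 by rewrite /N /q /j3 -expnM -!expnD; congr (2 ^ _); lia.
have oq : ~~ odd q by rewrite /q addnS expnS oddM.
pose B2 (t : I2) : pred {ffun 'I_N -> {ffun 'I_M -> 'I_q}} :=
  let: (x, y, u, v) := t in
  fun F => (x != y) && (hits [set x; y] (fun i => if i == x then u else v) F < j2).
pose B3 (t : I3) : pred {ffun 'I_N -> {ffun 'I_M -> 'I_q}} :=
  let: (x, y, z, u, v, w) := t in
  fun F => [&& x != y, z != x, z != y & 4 * j3 <
     hits (z |: [set x; y]) (fun i => if i == x then u else if i == y then v else w) F].
have c2 t : #|B2 t| * 2 ^ j2 <= (q ^ M) ^ N.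
  case: t => [[[x y] u] v]; rewrite /B2.
  case: (eqVneq x y) => [_|xy]; first by rewrite (eq_card0 (A := fun F => false && _)).
  have s2 : #|[set x; y]| = 2 by rewrite cards2 xy.
  have M2 : #|[set x; y]| <= M by rewrite -[X in _ <= X](card_ord M) max_card.
  have Ns : N = 4 * q ^ #|[set x; y]| * j2 by rewrite s2.
  exact: (few_hits _ M2 Ns q0).
have c3 t : #|B3 t| * 2 ^ (2 * j3) <= (q ^ M) ^ N.
  case: t => [[[[[x y] z] u] v] w]; rewrite /B3.
  case: (eqVneq x y) => [_|xy]; first by rewrite (eq_card0 (A := fun F => false && _)).
  case: (eqVneq z x) => [_|zx]; first by rewrite (eq_card0 (A := fun F => false && _)).
  case: (eqVneq z y) => [_|zy]; first by rewrite (eq_card0 (A := fun F => false && _)).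
  have s3 : #|z |: [set x; y]| = 3 by rewrite cardsU1 cards2 xy !inE (negbTE zx) (negbTE zy).
  have M3 : #|z |: [set x; y]| <= M by rewrite -[X in _ <= X](card_ord M) max_card.
  have Ns : N = q ^ #|z |: [set x; y]| * j3 by rewrite s3.
  by apply: (many_hits _ M3 Ns q0 oq); rewrite s3.
pose B (t : I2 + I3) := match t with inl t2 => B2 t2 | inr t3 => B3 t3 end.
have Tot0 : 0 < (q ^ M) ^ N by rewrite !expn_gt0.
have [|F HF] := @avoid_all M q N _ B.
  rewrite big_sumType /=.
  have S2 : 4 * (\sum_i #|B2 i|) <= (q ^ M) ^ N.
    have e1 : 4 * 2 ^ (j2 - 2) = 2 ^ (j2).
      rewrite -[4]/(2 ^ 2) -expnD subnKC // /j2 addnS expnS.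
      by have := expn_gt0 2 (2 * l + 7); lia.
    rewrite -(@leq_pmul2r (2 ^ (j2 - 2))) ?expn_gt0 // mulnAC e1.
    rewrite mulnC big_distrl /=; apply: (@leq_trans (#|{: I2}| * (q ^ M) ^ N)).
      by rewrite -sum_nat_const; apply: leq_sum => t _; exact: c2.
    rewrite mulnC leq_mul2l; apply/orP; right.
    rewrite !card_prod !card_ord /M /q -!expnD leq_exp2l //.
    have : j2 = 256 * (2 ^ l * 2 ^ l) by rewrite /j2 expnD mul2n -addnn expnD mulnC.
    by nia.
  have S3 : 4 * (\sum_i #|B3 i|) <= (q ^ M) ^ N.
    have e1 : 4 * 2 ^ (2 * j3 - 2) = 2 ^ (2 * j3).
      rewrite -[4]/(2 ^ 2) -expnD subnKC // /j3 addnS expnS.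
      by have := expn_gt0 2 (l + 3); lia.
    rewrite -(@leq_pmul2r (2 ^ (2 * j3 - 2))) ?expn_gt0 // mulnAC e1.
    rewrite mulnC big_distrl /=; apply: (@leq_trans (#|{: I3}| * (q ^ M) ^ N)).
      by rewrite -sum_nat_const; apply: leq_sum => t _; exact: c3.
    rewrite mulnC leq_mul2l; apply/orP; right.
    rewrite !card_prod !card_ord /M /q -!expnD leq_exp2l //.
    have : j3 = 16 * 2 ^ l by rewrite /j3 expnD mulnC.
    by nia.
  change (\sum_i #|B2 i| + \sum_i #|B3 i| < (q ^ M) ^ N).
  by move: S2 S3 Tot0; move: (\sum_i _) (\sum_i _) (_ ^ N) => a b c; lia.
exists F; split.
  move=> x y u v xy; have := HF (inl (x, y, u, v)); rewrite /= xy -leqNgt => h.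
  rewrite [X in X <= _]N2 leq_mul2l; apply/orP; right; apply: leq_trans h _.
  by rewrite /hits; apply: leq_sum => h _; rewrite forall_set2.
move=> x y z u v w xy zx zy; have := HF (inr (x, y, z, u, v, w)).
rewrite /= xy zx zy -leqNgt => h.
rewrite [X in _ <= 4 * X]N3 mulnCA mulnC leq_mul2l; apply/orP; right; apply: leq_trans h.
by rewrite /hits; apply: leq_sum => h _; rewrite forall_set3.
Qed.

Lemma spread_exists n l (M := 2 ^ n) (q := 2 ^ (l + 6)) (N := 2 ^ (4 * l + 22)) :
  2 ^ l <= n < 2 ^ l.+1 ->
  exists f, (forall x h, f x h < q) /\ spread N M q f.
Proof.
move=> /spread_exists_ord [F []]; rewrite -/M -/q -/N => h2 h3.
pose f (x h : nat) : nat := match insub h, insub x with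
  | Some h', Some x' => F h' x' | _, _ => 0 end.
have fE x h (xM : x < M) (hN : h < N) : f x h = F (Ordinal hN) (Ordinal xM).
  by rewrite /f !insubT.
exists f; split.
  move=> x h; rewrite /f; case: insub => [h'|]; last by rewrite expn_gt0.
  by case: insub => [x'|]; [exact: ltn_ord | rewrite expn_gt0].
split.
  move=> x y u v xM yM xy uq vq.
  apply: leq_trans (h2 (Ordinal xM) (Ordinal yM) (Ordinal uq) (Ordinal vq) xy) _.
  rewrite leq_mul2l big_mkord; apply/orP; right; apply: leq_sum => -[h hN] _.
  by rewrite /= (fE x h xM hN) (fE y h yM hN).
move=> x y z u v w xM yM zM xy zx zy uq vq wq.
apply: leq_trans (h3 (Ordinal xM) (Ordinal yM) (Ordinal zM) (Ordinal uq) (Ordinal vq)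
  (Ordinal wq) xy zx zy).
rewrite leq_mul2r big_mkord; apply/orP; right; apply: leq_sum => -[h hN] _.
by rewrite /= (fE x h xM hN) (fE y h yM hN) (fE z h zM hN).
Qed.

(** * Computability of the allocation *)

(** Finite tables are coded as numbers whose digits are the entries. An empty slot is the digit
    zero, so the empty table is the number [0] and an entry is put by an addition. *)
Definition digit (b s i : nat) : nat := (s %/ b ^ i) %% b.

(* Parameters for strings of length [n], with [r = 2 ^ flog n <= n < 2 * r]:
   [64 * r] units, [2 ^ 22 * r ^ 4] heads, levels [E] from [6 * flog n] to
   [top_level n], and codes of length [E + 30]. A unit of level [E] is full
   when it holds [2 ^ (E + 12) / r] codes. *)
Definition flog (n : nat) := trunc_log 2 n.
Definition unit_count (n : nat) := 2 ^ (flog n + 6).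
Definition head_count (n : nat) := 2 ^ (4 * flog n + 22).
Definition vertex_count (n : nat) := 2 ^ n.
Definition top_level (n : nat) := maxn (6 * flog n) n.
Definition level_count (n : nat) := (top_level n).+1.
Definition slot_count (n : nat) := vertex_count n * level_count n.
Definition pot_base (n : nat) := 2 ^ (flog n + 1).
Definition unit_cap (n E : nat) := 2 ^ (E + 12 - flog n).
Definition entry_base (n : nat) := 2 ^ (top_level n + 31).

Definition unit_of (n F x h : nat) := digit (unit_count n) F (x * head_count n + h).
Definition entry_row (n s x e : nat) := digit (entry_base n) s (x * slot_count n + e).

Definition spreadb (n F : nat) : bool :=
  all (fun x => all (fun y => (x != y) ==>
    all (fun u => all (fun v =>
      (head_count n <= 4 * unit_count n ^ 2 * \sum_(0 <= h < head_count n) ((unit_of n F x h == u) && (unit_of n F y h == v))) &&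
      all (fun z => (z != x) ==> (z != y) ==> all (fun w =>
        (\sum_(0 <= h < head_count n) [&& unit_of n F x h == u, unit_of n F y h == v & unit_of n F z h == w]) * unit_count n ^ 3
           <= 4 * head_count n) (iota 0 (unit_count n))) (iota 0 (vertex_count n)))
      (iota 0 (unit_count n))) (iota 0 (unit_count n))) (iota 0 (vertex_count n))) (iota 0 (vertex_count n)).

(** The least spreading table depends on [n] alone, so allocation and decoding share it. The bound
    of the search is the number of all tables. *)
Definition hash_table (n : nat) : nat := find (spreadb n) (iota 0 (unit_count n ^ (vertex_count n * head_count n))).

Definition state_ok (n F s : nat) : bool :=
  inv (head_count n) (slot_count n) (level_count n) (vertex_count n) (unit_count n) (pot_base n) (unit_cap n) (unit_of n F) (entry_row n s).

Definition put_entry (n s x y E P : nat) : nat :=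
  s + P.+1 * (entry_base n ^ (x * slot_count n + (y * level_count n + E)) + entry_base n ^ (y * slot_count n + (x * level_count n + E))).

(** * The allocation in time *)

Section Run.
Variable run : nat -> nat -> nat -> nat.

(* Codes of strings of length at most [k] are the numbers below [2 ^ k.+1 - 1]. *)
Definition reach (t k a b : nat) : bool :=
  has (fun p => run t p a == b.+1) (iota 0 (2 ^ k.+1).-1).

(** The top level is open to every pair and stands for all longer programs, so that finitely many
    levels suffice. *)
Definition legal (n t x y E : nat) : bool :=
  [&& x != y, 6 * flog n <= E &
    (E == top_level n) || (reach t E (code n x) (code n y) && reach t E (code n y) (code n x))].

(** The time is read as a mixed-radix number with digits stage, source, target and level: every
    request comes up once in each stage, and the stage is the clock given to the programs. *)
Definition req_level n t := t %% level_count n.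
Definition req_dst n t := (t %/ level_count n) %% vertex_count n.
Definition req_src n t := (t %/ level_count n %/ vertex_count n) %% vertex_count n.
Definition req_stage n t := t %/ level_count n %/ vertex_count n %/ vertex_count n.

Definition entry_at (n s x y E : nat) := entry_row n s x (y * level_count n + E).

Definition pick_code (n F s x y E : nat) : nat :=
  find (fun P => state_ok n F (put_entry n s x y E P)) (iota 0 (2 ^ (E + 30))).

(** [find] returns its bound when no code keeps the invariant, and the request is then dropped. The
    proof of [served] shows that this does not happen to a legal request with both slots empty. *)
Definition try_put (n F s x y E : nat) : nat :=
  if pick_code n F s x y E < 2 ^ (E + 30) then put_entry n s x y E (pick_code n F s x y E) else s.

Definition step (n F t s : nat) : nat :=
  if [&& legal n (req_stage n t) (req_src n t) (req_dst n t) (req_level n t),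
         entry_at n s (req_src n t) (req_dst n t) (req_level n t) == 0 & entry_at n s (req_dst n t) (req_src n t) (req_level n t) == 0]
  then try_put n F s (req_src n t) (req_dst n t) (req_level n t) else s.

Definition state (n t : nat) : nat := iteri t (fun i s => step n (hash_table n) i s) 0.

(* The program [[:: false]] is reserved for [x = y]; other programs start with [true]. *)
Definition graph_dec (t p x y : nat) : bool :=
  ((p == 1) && (x == y)) ||
  [&& len y == len x, 31 <= len p, p == 2 * ((p - 2) %/ 2) + 2,
      len p - 31 < level_count (len x) &
      entry_at (len x) (state (len x) t) (num x) (num y) (len p - 31) ==
        (num ((p - 2) %/ 2)).+1].

End Run.

Ltac computability ::= cbv beta; first [assumption | lazymatch goal with
  | |- computable _ (fun l => @?a l %/ @?b l) => apply: computable_div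
  | |- computable _ (fun l => @?a l %% @?b l) => apply: computable_mod
  | |- computable _ (fun l => maxn (@?a l) (@?b l)) => apply: computable_maxn
  | |- computable _ (fun l => trunc_log 2 (@?a l)) => apply: computable_trunc_log
  | _ => computability_base end]; cbv beta.

Lemma computable_flog m a : computable m a ->
  computable m (fun l => flog (a l)).
Proof. by apply: (@computable1 flog); rewrite /flog; repeat computability. Qed.

Lemma computable_unit_count m a : computable m a ->
  computable m (fun l => unit_count (a l)).
Proof. by apply: (@computable1 unit_count); rewrite /unit_count /flog; repeat computability. Qed.

Lemma computable_head_count m a : computable m a ->
  computable m (fun l => head_count (a l)).
Proof. by apply: (@computable1 head_count); rewrite /head_count /flog; repeat computability. Qed.

Lemma computable_vertex_count m a : computable m a ->
  computable m (fun l => vertex_count (a l)).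
Proof. by apply: (@computable1 vertex_count); rewrite /vertex_count; repeat computability. Qed.

Lemma computable_top_level m a : computable m a ->
  computable m (fun l => top_level (a l)).
Proof. by apply: (@computable1 top_level); rewrite /top_level /flog; repeat computability. Qed.

Lemma computable_level_count m a : computable m a ->
  computable m (fun l => level_count (a l)).
Proof. by apply: (@computable1 level_count); rewrite /level_count /top_level /flog; repeat computability. Qed.

Lemma computable_slot_count m a : computable m a ->
  computable m (fun l => slot_count (a l)).
Proof. by apply: (@computable1 slot_count); rewrite /slot_count /level_count /vertex_count /top_level /flog; repeat computability. Qed.

Lemma computable_pot_base m a : computable m a ->
  computable m (fun l => pot_base (a l)).
Proof. by apply: (@computable1 pot_base); rewrite /pot_base /flog; repeat computability. Qed.

Lemma computable_unit_cap m a b : computable m a -> computable m b ->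
  computable m (fun l => unit_cap (a l) (b l)).
Proof. by apply: (@computable2 unit_cap); rewrite /unit_cap /flog; repeat computability. Qed.

Lemma computable_entry_base m a : computable m a ->
  computable m (fun l => entry_base (a l)).
Proof. by apply: (@computable1 entry_base); rewrite /entry_base /top_level /flog; repeat computability. Qed.

Lemma computable_digit m a b c : computable m a -> computable m b -> computable m c ->
  computable m (fun l => digit (a l) (b l) (c l)).
Proof. by apply: (@computable3 digit); rewrite /digit; repeat computability. Qed.

Lemma computable_len m a : computable m a ->
  computable m (fun l => len (a l)).
Proof. by apply: (@computable1 len); rewrite /len; repeat computability. Qed.

Lemma computable_num m a : computable m a ->
  computable m (fun l => num (a l)).
Proof. by apply: (@computable1 num); rewrite /num /len; repeat computability. Qed.

Lemma computable_code m a b : computable m a -> computable m b ->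
  computable m (fun l => code (a l) (b l)).
Proof. by apply: (@computable2 code); rewrite /code; repeat computability. Qed.

Ltac computability ::= cbv beta; first [assumption | lazymatch goal with
  | |- computable _ (fun l => @?a l %/ @?b l) => apply: computable_div
  | |- computable _ (fun l => @?a l %% @?b l) => apply: computable_mod
  | |- computable _ (fun l => maxn (@?a l) (@?b l)) => apply: computable_maxn
  | |- computable _ (fun l => trunc_log 2 (@?a l)) => apply: computable_trunc_log
  | |- computable _ (fun l => flog (@?a l)) => apply: computable_flog
  | |- computable _ (fun l => unit_count (@?a l)) => apply: computable_unit_count
  | |- computable _ (fun l => head_count (@?a l)) => apply: computable_head_count
  | |- computable _ (fun l => vertex_count (@?a l)) => apply: computable_vertex_count
  | |- computable _ (fun l => top_level (@?a l)) => apply: computable_top_level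
  | |- computable _ (fun l => level_count (@?a l)) => apply: computable_level_count
  | |- computable _ (fun l => slot_count (@?a l)) => apply: computable_slot_count
  | |- computable _ (fun l => pot_base (@?a l)) => apply: computable_pot_base
  | |- computable _ (fun l => unit_cap (@?a l) (@?b l)) => apply: computable_unit_cap
  | |- computable _ (fun l => entry_base (@?a l)) => apply: computable_entry_base
  | |- computable _ (fun l => digit (@?a l) (@?b l) (@?c l)) => apply: computable_digit
  | |- computable _ (fun l => len (@?a l)) => apply: computable_len
  | |- computable _ (fun l => num (@?a l)) => apply: computable_num
  | |- computable _ (fun l => code (@?a l) (@?b l)) => apply: computable_code
  | _ => computability_base end]; cbv beta.

Lemma computable_unit_of m a b c d : computable m a -> computable m b -> computable m c -> computable m d ->
  computable m (fun l => unit_of (a l) (b l) (c l) (d l)).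
Proof. by apply: (@computable4 unit_of); rewrite /unit_of; repeat computability. Qed.

Lemma computable_entry_row m a b c d : computable m a -> computable m b -> computable m c -> computable m d ->
  computable m (fun l => entry_row (a l) (b l) (c l) (d l)).
Proof. by apply: (@computable4 entry_row); rewrite /entry_row; repeat computability. Qed.

Lemma computable_head_of m a b : computable m a -> computable m b ->
  computable m (fun l => head_of (a l) (b l)).
Proof. by apply: (@computable2 head_of); rewrite /head_of; repeat computability. Qed.

Ltac computability_alloc := cbv beta; first [assumption | lazymatch goal with
  | |- computable _ (fun l => unit_of (@?a l) (@?b l) (@?c l) (@?d l)) => apply: computable_unit_of
  | |- computable _ (fun l => entry_row (@?a l) (@?b l) (@?c l) (@?d l)) => apply: computable_entry_row
  | |- computable _ (fun l => head_of (@?a l) (@?b l)) => apply: computable_head_of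
  | _ => computability end]; cbv beta.

Lemma computable_spreadb m a b : computable m a -> computable m b ->
  computable m (fun l => spreadb (a l) (b l)).
Proof. by apply: (@computable2 spreadb); rewrite /spreadb; repeat computability_alloc. Qed.

Lemma computable_hash_table m a : computable m a -> computable m (fun l => hash_table (a l)).
Proof.
apply: (@computable1 hash_table); rewrite /hash_table.
by apply: computable_find; last apply: computable_spreadb; repeat computability_alloc.
Qed.

Lemma computable_cnt m n F s x u : computable m n -> computable m F -> computable m s ->
  computable m x -> computable m u ->
  computable m (fun l => cnt (head_count (n l)) (slot_count (n l)) (unit_of (n l) (F l) (x l)) (entry_row (n l) (s l) (x l)) (u l)).
Proof.
apply: (@computable5 (fun n F s x u => cnt (head_count n) (slot_count n) (unit_of n F x) (entry_row n s x) u)).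
by rewrite /cnt /occ; repeat computability_alloc.
Qed.

Lemma computable_load m n F s x u z w : computable m n -> computable m F -> computable m s ->
  computable m x -> computable m u -> computable m z -> computable m w ->
  computable m (fun l => load (head_count (n l)) (slot_count (n l)) (level_count (n l)) (unit_of (n l) (F l) (x l))
     (unit_of (n l) (F l) (z l)) (entry_row (n l) (s l) (x l)) (u l) (z l) (w l)).
Proof.
apply: (@computable7 (fun n F s x u z w =>
   load (head_count n) (slot_count n) (level_count n) (unit_of n F x) (unit_of n F z) (entry_row n s x) u z w)).
by rewrite /load /occ; repeat computability_alloc.
Qed.

Ltac computability_alloc ::= cbv beta; first [assumption | lazymatch goal with
  | |- computable _ (fun l => unit_of (@?a l) (@?b l) (@?c l) (@?d l)) => apply: computable_unit_of
  | |- computable _ (fun l => entry_row (@?a l) (@?b l) (@?c l) (@?d l)) => apply: computable_entry_row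
  | |- computable _ (fun l => head_of (@?a l) (@?b l)) => apply: computable_head_of
  | |- computable _ (fun l => hash_table (@?a l)) => apply: computable_hash_table
  | |- computable _ (fun l => cnt (@?a l) (@?b l) (@?c l) (@?d l) (@?e l)) => apply: computable_cnt
  | |- computable _ (fun l => load (@?a l) (@?b l) (@?c l) (@?d l) (@?e l) (@?f l) (@?g l) (@?h l) (@?i l)) => apply: computable_load
  | _ => computability end]; cbv beta.

Lemma computable_state_ok m n F s : computable m n -> computable m F -> computable m s ->
  computable m (fun l => state_ok (n l) (F l) (s l)).
Proof.
apply: (@computable3 state_ok); rewrite /state_ok /inv /pot /row_pot /row_ok.
by repeat computability_alloc.
Qed.

Lemma computable_put_entry m n s x y E P : computable m n -> computable m s -> computable m x ->
  computable m y -> computable m E -> computable m P ->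
  computable m (fun l => put_entry (n l) (s l) (x l) (y l) (E l) (P l)).
Proof. by move=> *; rewrite /put_entry; repeat computability_alloc. Qed.

Lemma computable_entry_at m n s x y E : computable m n -> computable m s -> computable m x ->
  computable m y -> computable m E ->
  computable m (fun l => entry_at (n l) (s l) (x l) (y l) (E l)).
Proof. by move=> *; rewrite /entry_at; repeat computability_alloc. Qed.

Lemma computable_pick_code : computable 6 (fun l => pick_code (nth 0 l 0) (nth 0 l 1) (nth 0 l 2)
  (nth 0 l 3) (nth 0 l 4) (nth 0 l 5)).
Proof.
rewrite /pick_code; apply: computable_find; first by repeat computability_alloc.
by cbv beta; apply: computable_state_ok; try apply: computable_put_entry; repeat computability_alloc.
Qed.

Lemma computable_try_put m n F s x y E : computable m n -> computable m F -> computable m s ->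
  computable m x -> computable m y -> computable m E ->
  computable m (fun l => try_put (n l) (F l) (s l) (x l) (y l) (E l)).
Proof.
have h : computable 6 (fun l => try_put (nth 0 l 0) (nth 0 l 1) (nth 0 l 2)
  (nth 0 l 3) (nth 0 l 4) (nth 0 l 5)).
  rewrite /try_put; apply: computable_if; last by repeat computability_alloc.
    by apply: computable_leq; [apply: computable_S; exact: computable_pick_code | repeat computability_alloc].
  by apply: computable_put_entry; try exact: computable_pick_code; repeat computability_alloc.
move=> hn hF hs hx hy hE.
apply: (@computable_comp m [:: n; F; s; x; y; E] (fun l => try_put (nth 0 l 0) (nth 0 l 1)
  (nth 0 l 2) (nth 0 l 3) (nth 0 l 4) (nth 0 l 5)) h).
by case=> [|[|[|[|[|[]]]]]].
Qed.

Section RunComputable.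
Variable run : nat -> nat -> nat -> nat.
Hypothesis computable_run : computable 3 (fun l => run (nth 0 l 0) (nth 0 l 1) (nth 0 l 2)).

Lemma computable_reach m t k a b : computable m t -> computable m k -> computable m a ->
  computable m b -> computable m (fun l => reach run (t l) (k l) (a l) (b l)).
Proof.
apply: (@computable4 (reach run)); rewrite /reach.
apply: computable_has; first by repeat computability_alloc.
by cbv beta; apply: computable_eq; first apply: (computable3 computable_run); repeat computability_alloc.
Qed.

Lemma computable_legal m n t x y E : computable m n -> computable m t -> computable m x ->
  computable m y -> computable m E ->
  computable m (fun l => legal run (n l) (t l) (x l) (y l) (E l)).
Proof.
move=> *; rewrite /legal.
by repeat (cbv beta; first [apply: computable_reach | computability_alloc]).
Qed.

Lemma computable_step m n F t s : computable m n -> computable m F -> computable m t ->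
  computable m s -> computable m (fun l => step run (n l) (F l) (t l) (s l)).
Proof.
move=> *; rewrite /step /req_level /req_src /req_dst /req_stage.
apply: computable_if; last by assumption.
  by repeat (cbv beta; first [apply: computable_legal | apply: computable_entry_at | computability_alloc]).
by apply: computable_try_put; repeat computability_alloc.
Qed.

Lemma computable_state m n t : computable m n -> computable m t ->
  computable m (fun l => state run (n l) (t l)).
Proof.
apply: (@computable2 (state run)); rewrite /state.
apply: (computable_iteri (st := fun i s l => step run (nth 0 l 0) (hash_table (nth 0 l 0)) i s)).
- by computability_alloc.
- by computability_alloc.
- by cbv beta; rewrite -?nth_behead; apply: computable_step; repeat computability_alloc.
Qed.

Lemma computable_graph_dec : computable 4 (fun l =>
  graph_dec run (nth 0 l 0) (nth 0 l 1) (nth 0 l 2) (nth 0 l 3)).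
Proof.
rewrite /graph_dec.
by repeat (cbv beta; lazymatch goal with
  | |- computable _ (fun l => entry_at _ _ _ _ _) => apply: computable_entry_at
  | |- computable _ (fun l => state _ _ _) => apply: computable_state
  | _ => computability_alloc end).
Qed.

End RunComputable.

(** * Kraft's inequality *)

(** Compatibility of programs at a common clock: [code j (P %% 2 ^ j)] numbers the prefix of length
    [j] of the string with number [code j' P]. *)
Definition coherent (run : nat -> nat -> nat -> nat) : Prop :=
  forall t a j j' P b b', j <= j' -> P < 2 ^ j' ->
    run t (code j (P %% 2 ^ j)) a = b.+1 -> run t (code j' P) a = b'.+1 -> b = b'.

Lemma geom_sum L E0 : E0 <= L ->
  \sum_(0 <= E < L.+1) (E0 <= E) * 2 ^ (L - E) < 2 * 2 ^ (L - E0).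
Proof.
elim: L => [|L IH]; first by rewrite leqn0 => /eqP ->; rewrite big_nat1.
rewrite big_nat_recr //= subnn expn0 muln1.
rewrite (@sum_nat_eq _ _ (fun E => 2 * ((E0 <= E) * 2 ^ (L - E)))); last first.
  by move=> E EL; rewrite subSn // expnS; lia.
rewrite -sum_nat_mull => E0L1; case: (leqP E0 L) => E0L; last first.
  rewrite (@sum_nat_eq _ _ (fun _ => 0)) ?big1 //; last by move=> E EL; rewrite leqNgt (leq_trans EL).
  by have := expn_gt0 2 (L.+1 - E0); case: (E0 <= _); lia.
by rewrite subSn // expnS E0L1; move: (IH E0L) => /=; lia.
Qed.

Lemma code_inj k v v' : v < 2 ^ k -> v' < 2 ^ k -> code k v = code k v' -> v = v'.
Proof. by have := expn_gt0 2 k; rewrite /code; lia. Qed.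

Lemma code_len_num p : p = code (len p) (num p) /\ num p < 2 ^ len p.
Proof. by have [s <-] := enc_surj p; rewrite len_enc num_enc code_enc lsb_val_lt. Qed.

Lemma len_lt p k : (p < (2 ^ k.+1).-1) = (len p <= k).
Proof.
have [e h] := code_len_num p; rewrite [in LHS]e /code.
have h1 := expn_gt0 2 k; have h2 := expn_gt0 2 (len p).
case: (leqP (len p) k) => hk.
  have : 2 ^ len p <= 2 ^ k by rewrite leq_exp2l.
  by rewrite expnS; lia.
have : 2 ^ k.+1 <= 2 ^ len p by rewrite leq_exp2l.
by rewrite expnS; lia.
Qed.

Lemma count_residue L j P : j <= L -> P < 2 ^ j ->
  2 ^ (L - j) <= \sum_(0 <= s < 2 ^ L) (s %% 2 ^ j == P).
Proof.
move=> jL Plt; have e : 2 ^ L = 2 ^ (L - j) * 2 ^ j by rewrite -expnD subnK.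
have j0 := expn_gt0 2 j.
apply: (@leq_trans (\sum_(0 <= i < 2 ^ (L - j)) \sum_(0 <= s < 2 ^ L) (s == P + i * 2 ^ j))).
  rewrite -[X in X <= _]subn0 -[X in X <= _]muln1 -sum_nat_const_nat.
  apply: sum_nat_le => i ilt.
  have h : P + i * 2 ^ j < 2 ^ L by rewrite e; nia.
  by apply: leq_trans (sum_nat_ge _ h); rewrite eqxx.
rewrite exchange_big /=; apply: sum_nat_le => s _.
case: (eqVneq (s %% 2 ^ j) P) => [_|ne].
  by apply: sum_nat_atmost1 => i i' _ _ /eqP -> /eqP h; nia.
rewrite big1 // => i _; case: eqP => // es.
by move: ne; rewrite es addnC modnMDl modn_small ?eqxx.
Qed.

Section Kraft.
Variables (run : nat -> nat -> nat -> nat).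
Hypothesis coh : coherent run.

(** Strings of length [L] are counted. By coherence the prefixes of each lead to at most one target,
    and a target first reachable at level [E0] owns at least [2 ^ (L - E0)] of them. All levels from
    [E0] on together weigh less than twice that, and the level [L] granted to each of the [2 ^ n]
    targets adds at most [2 ^ L]. *)
Lemma kraft w a n L : n <= L ->
  \sum_(0 <= Y < 2 ^ n) \sum_(0 <= E < L.+1)
     ((E == L) || reach run w E a (code n Y)) * 2 ^ (L - E) <= 3 * 2 ^ L.
Proof.
move=> nL.
pose hit b s := has (fun j => run w (code j (s %% 2 ^ j)) a == b.+1) (iota 0 L.+1).
have hit1 b b' s : s < 2 ^ L -> hit b s -> hit b' s -> b = b'.
  move=> sL /hasP [j]; rewrite mem_iota => /andP [_ jL] /eqP h1.
  move=> /hasP [j']; rewrite mem_iota => /andP [_ j'L] /eqP h2.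
  have key k k' c c' : k <= k' -> run w (code k (s %% 2 ^ k)) a = c.+1 ->
      run w (code k' (s %% 2 ^ k')) a = c'.+1 -> c = c'.
    move=> kk e1 e2; apply: (coh kk _ _ e2); first by rewrite ltn_mod expn_gt0.
    by rewrite modn_dvdm ?dvdn_exp2l // e1.
  by case: (leqP j j') => [|/ltnW] jj; [apply: (key j j') | symmetry; apply: (key j' j)].
have total : \sum_(0 <= Y < 2 ^ n) \sum_(0 <= s < 2 ^ L) hit (code n Y) s <= 2 ^ L.
  rewrite exchange_big /= -[X in _ <= X]subn0 -[X in _ <= X]muln1 -sum_nat_const_nat.
  apply: sum_nat_le => s sL; apply: sum_nat_atmost1 => Y Y' h h' h1 h2.
  by apply: (@code_inj n) => //; exact: hit1 h1 h2.
have each Y : \sum_(0 <= E < L.+1) reach run w E a (code n Y) * 2 ^ (L - E) <=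
    2 * \sum_(0 <= s < 2 ^ L) hit (code n Y) s.
  case: (boolP (has (fun E => reach run w E a (code n Y)) (iota 0 L.+1))); last first.
    move=> /hasPn none; rewrite big1_seq // => E; rewrite mem_index_iota => /andP [_ /andP [_ EL]].
    by have := none E; rewrite mem_iota add0n leq0n EL /= => /(_ isT) /negbTE ->.
  move=> hs; set E0 := find (fun E => reach run w E a (code n Y)) (iota 0 L.+1).
  have E0L : E0 < L.+1 by have := hs; rewrite has_find size_iota.
  have := nth_find 0 hs; rewrite nth_iota // add0n -/E0 => /hasP [p].
  rewrite mem_iota add0n leq0n /= len_lt => lp /eqP rp.
  apply: (@leq_trans (2 * 2 ^ (L - E0))).
    apply: leq_trans (ltnW (@geom_sum L E0 _)); last by [].
    apply: sum_nat_le => E EL; case re : (reach _ _ _ _ _) => //.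
    case: (leqP E0 E) => // EE0; have := before_find 0 EE0.
    by rewrite nth_iota // add0n re.
  rewrite leq_mul2l /=; have [ep np] := code_len_num p.
  apply: (@leq_trans (2 ^ (L - len p))); first by rewrite leq_exp2l //; lia.
  apply: leq_trans (@count_residue L (len p) (num p) _ np) _; first by lia.
  apply: sum_nat_le => s _; case: eqP => // es.
  suff -> : hit (code n Y) s by [].
  apply/hasP; exists (len p); first by rewrite mem_iota; lia.
  by rewrite es -ep rp.
apply: (@leq_trans (\sum_(0 <= Y < 2 ^ n) (1 + 2 * \sum_(0 <= s < 2 ^ L) hit (code n Y) s))).
  apply: sum_nat_le => Y _; apply: leq_trans (leq_add (leqnn 1) (each Y)).
  apply: (@leq_trans (\sum_(0 <= E < L.+1) ((E == L) * 2 ^ (L - E)) +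
     \sum_(0 <= E < L.+1) (reach run w E a (code n Y) * 2 ^ (L - E)))).
    rewrite -big_split /=; apply: sum_nat_le => E _.
    by case: (E == L); case: (reach _ _ _ _ _); rewrite /= ?mul1n ?addn0 ?leq_addr.
  rewrite leq_add2r (@sum_nat_eq _ _ (fun E => (E == L) : nat)).
    by apply: sum_nat_atmost1 => E E' _ _ /eqP -> /eqP ->.
  by move=> E _; case: eqP => // ->; rewrite subnn.
rewrite big_split /= -sum_nat_mull sum_nat_const_nat subn0 muln1.
have : 2 ^ n <= 2 ^ L by rewrite leq_exp2l.
by move: total; lia.
Qed.

End Kraft.

(** * The allocation as a machine *)

(** There is no carry, because the digit at [i] was zero and [a] is below the base. *)
Lemma digit_add b s i a j : a < b -> digit b s i = 0 ->
  digit b (s + a * b ^ i) j = if j == i then a else digit b s j.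
Proof.
move=> ab; rewrite /digit => d0; have b0 : 0 < b by lia.
have bi k : 0 < b ^ k by rewrite expn_gt0 b0.
have key : (s + a * b ^ i) %/ b ^ i = s %/ b ^ i + a by rewrite addnC divnMDl // addnC.
case: (ltngtP j i) => ji.
- have -> : a * b ^ i = a * b ^ (i - j).-1 * b * b ^ j.
    by rewrite -!mulnA -expnS -expnD; congr (_ * b ^ _); lia.
  by rewrite addnC divnMDl // modnMDl.
- have -> : b ^ j = b ^ i * (b * b ^ (j - i).-1) by rewrite -expnS -expnD; congr (b ^ _); lia.
  rewrite !divnMA key; congr ((_ %/ _) %% _).
  by rewrite [in LHS](divn_eq (s %/ b ^ i) b) d0 addn0 divnMDl // (divn_small ab) addn0.
- by rewrite ji key -modnDml d0 add0n modn_small.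
Qed.

Lemma digit0 b i : digit b 0 i = 0.
Proof. by rewrite /digit div0n mod0n. Qed.

Lemma digits_exist b L (g : nat -> nat) : (forall i, g i < b) ->
  exists2 s, s < b ^ L & forall i, i < L -> digit b s i = g i.
Proof.
move=> gb; elim: L => [|L [s slt IH]]; first by exists 0.
have b0 : 0 < b by apply: leq_ltn_trans (gb 0).
have dL : digit b s L = 0 by rewrite /digit divn_small ?mod0n.
exists (s + g L * b ^ L).
  by rewrite expnS; have := gb L; nia.
move=> i; rewrite ltnS digit_add // => iL; case: eqP => [-> //|/eqP ne].
by apply: IH; rewrite ltn_neqAle ne.
Qed.

Section InvExt.
Variables (N EE K M q m : nat) (T : nat -> nat) (f : nat -> nat -> nat).

Lemma cnt_ext g R R' u : (forall e, e < EE -> R e = R' e) -> cnt N EE g R u = cnt N EE g R' u.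
Proof. by move=> h; apply: sum_nat_eq => e elt; rewrite /occ h. Qed.

Lemma load_ext g gz R R' u z w : (forall e, e < EE -> R e = R' e) ->
  load N EE K g gz R u z w = load N EE K g gz R' u z w.
Proof. by move=> h; apply: sum_nat_eq => e elt; rewrite /occ h. Qed.

(** Takes the place of extensionality: the decoded state and the functional update [upd] are
    compared only on the slots of the table. *)
Lemma inv_ext (A A' : nat -> nat -> nat) : (forall x e, x < M -> e < EE -> A x e = A' x e) ->
  inv N EE K M q m T f A = inv N EE K M q m T f A'.
Proof.
move=> h; rewrite /inv; congr (_ && (_ <= _)).
  apply: eq_in_all => x; rewrite mem_iota => /andP [_ xM].
  have hx e : e < EE -> A x e = A' x e by exact: h.
  apply: eq_in_all => e; rewrite mem_iota => /andP [_ elt].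
  rewrite hx // (cnt_ext _ _ hx); congr (_ ==> (_ && _)).
  apply: eq_in_all => e'; rewrite mem_iota => /andP [_ elt'].
  by rewrite hx // !(cnt_ext _ _ hx).
apply: sum_nat_eq => x xM; have hx e : e < EE -> A x e = A' x e by exact: h.
do 3 (apply: sum_nat_eq => ? _).
by rewrite !(cnt_ext _ _ hx) !(load_ext _ _ _ _ _ hx).
Qed.

Lemma inv0 (A : nat -> nat -> nat) : (forall x e, A x e = 0) -> inv N EE K M q m T f A.
Proof.
move=> h; apply/andP; split.
  by apply/allP => x _; apply/allP => e _; rewrite h.
have c0 x u : cnt N EE (f x) (A x) u = 0 by rewrite /cnt big1 // => e _; rewrite /occ h.
have l0 x z u w : load N EE K (f x) (f z) (A x) u z w = 0.
  by rewrite /load big1 // => e _; rewrite /occ h.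
rewrite /pot /row_pot.
apply: (@leq_trans (\sum_(0 <= x < M) \sum_(0 <= u < q) \sum_(0 <= z < M) \sum_(0 <= w < q) m.+1 ^ EE)).
  do 4 (apply: sum_nat_le => ? _); rewrite c0 l0 subn0 !expn0 !mul1n.
  by case: (_ != _); rewrite ?mul1n.
by rewrite !sum_nat_const_nat !subn0; nia.
Qed.

End InvExt.

Lemma all_iotaP (P : pred nat) n : reflect (forall i, i < n -> P i) (all P (iota 0 n)).
Proof.
apply: (iffP allP) => h i; first by move=> il; apply: h; rewrite mem_iota.
by rewrite mem_iota => /andP [_]; exact: h.
Qed.

Lemma spreadbP n F : reflect (spread (head_count n) (vertex_count n) (unit_count n) (unit_of n F)) (spreadb n F).
Proof.
apply: (iffP (all_iotaP _ _)) => [h|[h2 h3] x xM].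
  split.
    move=> x y u v xM yM xy uq vq.
    move: (h x xM) => /all_iotaP /(_ y yM) /implyP /(_ xy) /all_iotaP /(_ u uq).
    by move=> /all_iotaP /(_ v vq) /andP [].
  move=> x y z u v w xM yM zM xy zx zy uq vq wq.
  move: (h x xM) => /all_iotaP /(_ y yM) /implyP /(_ xy) /all_iotaP /(_ u uq).
  move=> /all_iotaP /(_ v vq) /andP [_] /all_iotaP /(_ z zM) /implyP /(_ zx) /implyP /(_ zy).
  by move=> /all_iotaP /(_ w wq).
apply/all_iotaP => y yM; apply/implyP => xy; apply/all_iotaP => u uq; apply/all_iotaP => v vq.
apply/andP; split; first exact: h2.
apply/all_iotaP => z zM; apply/implyP => zx; apply/implyP => zy; apply/all_iotaP => w wq.
exact: h3.
Qed.

Lemma hash_table_spread n : 0 < n -> spread (head_count n) (vertex_count n) (unit_count n) (unit_of n (hash_table n)).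
Proof.
move=> n0; have [|f [fq [s2 s3]]] := @spread_exists n (flog n).
  by rewrite trunc_logP // trunc_log_ltn.
rewrite -/(head_count n) -/(vertex_count n) -/(unit_count n) in fq s2 s3.
have N0 : 0 < head_count n by rewrite expn_gt0.
have [F Flt HF] := @digits_exist (unit_count n) (vertex_count n * head_count n) (fun i => f (i %/ head_count n) (i %% head_count n))
  (fun i => fq _ _).
have fhE x h : x < vertex_count n -> h < head_count n -> unit_of n F x h = f x h.
  move=> xM hN; rewrite /unit_of HF; last by nia.
  by rewrite divnMDl // divn_small // addn0 modnMDl modn_small.
apply/spreadbP; rewrite /hash_table.
have hs : has (spreadb n) (iota 0 (unit_count n ^ (vertex_count n * head_count n))).
  apply/hasP; exists F; first by rewrite mem_iota.
  apply/spreadbP; split.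
    move=> x y u v xM yM xy uq vq; apply: leq_trans (s2 x y u v xM yM xy uq vq) _.
    by rewrite leq_mul2l; apply/orP; right; apply: sum_nat_le => h hN; rewrite !fhE.
  move=> x y z u v w xM yM zM xy zx zy uq vq wq.
  apply: leq_trans (s3 x y z u v w xM yM zM xy zx zy uq vq wq).
  by rewrite leq_mul2r; apply/orP; right; apply: sum_nat_le => h hN; rewrite !fhE.
have := nth_find 0 hs; rewrite nth_iota //.
by have := hs; rewrite has_find size_iota.
Qed.

Lemma slot_eq K y E y' E' : E < K -> E' < K -> (y * K + E == y' * K + E') = (y == y') && (E == E').
Proof.
move=> h h'; apply/eqP/andP => [e|[/eqP -> /eqP -> //]].
have := f_equal (divn^~ K) e; have := f_equal (modn^~ K) e.
by rewrite /= !modnMDl !modn_small // !divnMDl ?divn_small ?addn0 ?eqxx //; [move=> -> ->; rewrite !eqxx | lia..].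
Qed.

Lemma entry_row_put n s x y E P :
  x < vertex_count n -> y < vertex_count n -> x != y -> E < level_count n -> P.+1 < entry_base n ->
  entry_at n s x y E = 0 -> entry_at n s y x E = 0 ->
  forall x' e, x' < vertex_count n -> e < slot_count n ->
  entry_row n (put_entry n s x y E P) x' e = upd (level_count n) (entry_row n s) x y E P x' e.
Proof.
move=> xM yM xy EK PB s1 s2 x' e x'M elt.
have l1 := slot_lt yM EK; have l2 := slot_lt xM EK.
rewrite /entry_at /entry_row in s1 s2; rewrite /entry_row /put_entry mulnDr addnA.
rewrite digit_add //; last by rewrite digit_add // slot_eq // eq_sym (negbTE xy).
rewrite digit_add //.
rewrite !slot_eq // /upd /set_row.
case: (eqVneq x' x) => [->|ne]; first by rewrite (negbTE xy).
by case: (eqVneq x' y) => [->|ne'].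
Qed.

(** A full unit holds [r * s] codes with [r = 2 ^ l], and [(1 + 1 / m) ^ r <= 2] since [m = 2 * r].
    So the load is at most [s] plus the logarithm of [vertex_count n ^ 2 * unit_count n ^ 2].
    Multiplied by [32 * unit_count n ^ 2], each part takes at most half of [2 ^ (E + 30)]: the first
    exactly half, the second because [6 * l <= E]. *)
Lemma load_bound n E c lo : 6 * flog n <= E -> 0 < n -> c <= unit_cap n E ->
  2 ^ lo * pot_base n ^ c <= vertex_count n ^ 2 * unit_count n ^ 2 * (pot_base n).+1 ^ c ->
  32 * unit_count n ^ 2 * lo <= 2 ^ (E + 30).
Proof.
move=> lE n0; set l := flog n in lE *; set r := 2 ^ l.
have lr : l < r by exact: ltn_expl.
have nr : n < 2 * r by rewrite /r -expnS; exact: trunc_log_ltn.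
set m := pot_base n; have m2 : 2 * r <= m.+1 by rewrite /m /pot_base -/l addn1 expnS -/r ltnW.
set T := unit_cap n E; set s := 2 ^ (E + 12 - 2 * l).
have Ts : T = r * s by rewrite /T /unit_cap -/l /r /s -expnD; congr (2 ^ _); lia.
move=> cT h.
have hT : m.+1 ^ T <= 2 ^ s * m ^ T.
  by rewrite Ts !(expnM _ r) -expnMn; apply: leq_expr; exact: expS_le2.
have m0 : 0 < m by rewrite expn_gt0.
have hc : m.+1 ^ c <= 2 ^ s * m ^ c.
  rewrite -(@leq_pmul2r (m ^ (T - c))) ?expn_gt0 ?m0 // -[X in _ <= X]mulnA -expnD subnKC //.
  apply: leq_trans hT; rewrite -{2}(subnKC cT) expnD leq_mul2l; apply/orP; right.
  by apply: leq_expr.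
have : lo <= 2 * n + 2 * (l + 6) + s.
  rewrite -(@leq_exp2l 2) // -(@leq_pmul2r (m ^ c)) ?expn_gt0 ?m0 //.
  have e : vertex_count n ^ 2 * unit_count n ^ 2 = 2 ^ (2 * n + 2 * (l + 6)).
    by rewrite /vertex_count /unit_count -/l -!expnM -expnD; congr (2 ^ _); lia.
  by apply: leq_trans h _; rewrite e [in X in _ <= X]expnD -mulnA leq_mul2l hc orbT.
move=> hlo; apply: (@leq_trans (2 ^ (2 * l + 17) * (2 * n + 2 * (l + 6) + s))).
  rewrite -[32]/(2 ^ 5) /unit_count -/l -expnM -expnD.
  by rewrite (_ : 5 + (l + 6) * 2 = 2 * l + 17) ?leq_mul2l ?hlo ?orbT //; lia.
have h1 : 2 * n + 2 * (l + 6) <= 2 ^ (l + 5) by rewrite expnD -/r -[2 ^ 5]/32; lia.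
apply: (@leq_trans (2 ^ (2 * l + 17) * (2 ^ (l + 5) + s))).
  by rewrite leq_mul2l leq_add2r h1 orbT.
rewrite mulnDr /s -!expnD.
have -> : 2 * l + 17 + (E + 12 - 2 * l) = E + 29 by lia.
have -> : E + 30 = (E + 29).+1 by lia.
have h2 : 2 ^ (2 * l + 17 + (l + 5)) <= 2 ^ (E + 29) by rewrite leq_exp2l //; lia.
by rewrite [X in _ <= X]expnS; move: h2; move: (2 ^ (E + 29)) (2 ^ _) => a b; lia.
Qed.

(** * Invariants of the run *)

Section State.
Variable run : nat -> nat -> nat -> nat.
Hypothesis run_mono : forall p a, mono (fun t => run t p a).
Hypothesis run_coh : coherent run.

Local Notation st n t := (state run n t).
Local Notation entry n t x y E := (entry_at n (st n t) x y E).

Lemma reach_mono t t' k a b : t <= t' -> reach run t k a b -> reach run t' k a b.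
Proof.
move=> tt /hasP [p pi /eqP rp]; apply/hasP; exists p => //.
by apply/eqP; exact: run_mono tt rp.
Qed.

Lemma legal_mono n t t' x y E : t <= t' -> legal run n t x y E -> legal run n t' x y E.
Proof.
rewrite /legal => tt /and3P [-> -> /orP [-> //|/andP [h1 h2]]] /=.
by rewrite (reach_mono tt h1) (reach_mono tt h2) orbT.
Qed.

Lemma legal_sym n t x y E : legal run n t x y E = legal run n t y x E.
Proof. by rewrite /legal eq_sym [in LHS]andbC [reach _ _ _ _ _ && _]andbC [in RHS]andbC. Qed.

Lemma state_step n t : st n t.+1 = st n t \/ exists P,
  [/\ legal run n (req_stage n t) (req_src n t) (req_dst n t) (req_level n t),
      entry n t (req_src n t) (req_dst n t) (req_level n t) = 0, entry n t (req_dst n t) (req_src n t) (req_level n t) = 0,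
      P < 2 ^ (req_level n t + 30) /\
      state_ok n (hash_table n) (put_entry n (st n t) (req_src n t) (req_dst n t) (req_level n t) P)
    & st n t.+1 = put_entry n (st n t) (req_src n t) (req_dst n t) (req_level n t) P].
Proof.
rewrite /state /= -/(state run n t) /step; case: ifP => [/and3P [lg /eqP s1 /eqP s2]|]; last by left.
rewrite /try_put; case: ifP => [lt|]; last by left.
right; exists (pick_code n (hash_table n) (st n t) (req_src n t) (req_dst n t) (req_level n t)); split=> //; split=> //.
have hs : has (fun P => state_ok n (hash_table n) (put_entry n (st n t) (req_src n t) (req_dst n t) (req_level n t) P))
              (iota 0 (2 ^ (req_level n t + 30))) by rewrite has_find size_iota.
by have := nth_find 0 hs; rewrite nth_iota.
Qed.

Lemma vertex_count_gt0 n : 0 < vertex_count n. Proof. by rewrite expn_gt0. Qed.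
Lemma req_src_lt n t : req_src n t < vertex_count n. Proof. by rewrite ltn_mod vertex_count_gt0. Qed.
Lemma req_dst_lt n t : req_dst n t < vertex_count n. Proof. by rewrite ltn_mod vertex_count_gt0. Qed.
Lemma req_level_lt n t : req_level n t < level_count n. Proof. by rewrite ltn_mod. Qed.
Lemma req_stage_le n t : req_stage n t <= t.
Proof. by rewrite /req_stage -!divnMA; exact: leq_div. Qed.

Lemma entry_lt_base n E P : E < level_count n -> P < 2 ^ (E + 30) -> P.+1 < entry_base n.
Proof.
rewrite /level_count ltnS => EL PE; apply: (@leq_ltn_trans (2 ^ (E + 30))) => //.
by rewrite ltn_exp2l //; lia.
Qed.

Lemma state_slots n t P x' e : legal run n (req_stage n t) (req_src n t) (req_dst n t) (req_level n t) ->
  entry n t (req_src n t) (req_dst n t) (req_level n t) = 0 -> entry n t (req_dst n t) (req_src n t) (req_level n t) = 0 ->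
  P < 2 ^ (req_level n t + 30) -> x' < vertex_count n -> e < slot_count n ->
  entry_row n (put_entry n (st n t) (req_src n t) (req_dst n t) (req_level n t) P) x' e =
  upd (level_count n) (entry_row n (st n t)) (req_src n t) (req_dst n t) (req_level n t) P x' e.
Proof.
move=> /and3P [xy _ _] s1 s2 PE x'M elt; apply: entry_row_put => //; rewrite ?req_src_lt ?req_dst_lt ?req_level_lt //.
by apply: entry_lt_base PE; exact: req_level_lt.
Qed.

Lemma state_inv n t : state_ok n (hash_table n) (st n t).
Proof.
elim: t => [|t IH]; first by apply: inv0 => x e; exact: digit0.
by case: (state_step n t) => [-> //|[P [_ _ _ [_ h] ->]]].
Qed.

Lemma upd_slot (AA : nat -> nat -> nat) K x y E P x' y' E' : E < K -> E' < K ->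
  upd K AA x y E P x' (y' * K + E') =
  if (x' == x) && (y' == y) && (E' == E) || (x' == y) && (y' == x) && (E' == E) && (x' != x)
  then P.+1 else AA x' (y' * K + E').
Proof.
move=> EK E'K; rewrite /upd.
case: (eqVneq x' x) => [->|nx] /=; first by rewrite andbF orbF /set_row slot_eq.
by rewrite andbT; case: (eqVneq x' y) => [->|] //=; rewrite /set_row slot_eq.
Qed.

Lemma entry_step n t x y E : x < vertex_count n -> y < vertex_count n -> E < level_count n ->
  entry n t x y E != 0 -> entry n t.+1 x y E = entry n t x y E.
Proof.
move=> xM yM EK; case: (state_step n t) => [-> //|[P [lg s1 s2 [PE _] ->]]] nz.
have elt : y * level_count n + E < slot_count n by exact: slot_lt.
rewrite /entry_at state_slots // upd_slot // ?req_level_lt //; case: ifP => // /orP [|].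
  by move=> /andP [/andP [/eqP ex /eqP ey] /eqP eE]; move: nz; rewrite ex ey eE s1.
move=> /andP [/andP [/andP [/eqP ex /eqP ey] /eqP eE] _].
by move: nz; rewrite ex ey eE s2.
Qed.

Lemma entry_mono n t t' x y E : x < vertex_count n -> y < vertex_count n -> E < level_count n -> t <= t' ->
  entry n t x y E != 0 -> entry n t' x y E = entry n t x y E.
Proof.
move=> xM yM EK; elim: t' => [|t' IH]; first by rewrite leqn0 => /eqP ->.
rewrite leq_eqVlt => /orP [/eqP -> //|]; rewrite ltnS => tt nz.
by rewrite entry_step // IH.
Qed.

(** A request is checked with its stage as clock, which is never ahead of the time, so legality
    persists by monotonicity. The mirrored slot is covered by the symmetry of [legal]. *)
Lemma entry_legal n t x y E : x < vertex_count n -> y < vertex_count n -> E < level_count n -> entry n t x y E != 0 ->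
  [/\ legal run n t x y E, entry n t y x E = entry n t x y E
    & entry n t x y E <= 2 ^ (E + 30)].
Proof.
move=> xM yM EK; elim: t => [|t IH]; first by rewrite /entry_at /entry_row digit0.
have mon : (legal run n t x y E -> legal run n t.+1 x y E) by apply: legal_mono.
case: (state_step n t) => [e|[P [lg s1 s2 [PE _] e]]].
  by rewrite e => /IH [h1 h2 h3]; split=> //; exact: mon.
have eltx : y * level_count n + E < slot_count n by exact: slot_lt.
have elty : x * level_count n + E < slot_count n by exact: slot_lt.
rewrite e /entry_at !state_slots // !upd_slot // ?req_level_lt //.
case: (boolP ((x == req_src n t) && (y == req_dst n t) && (E == req_level n t))) => [|h1].
  move=> /andP [/andP [/eqP ex /eqP ey] /eqP eE] _.
  rewrite ex ey eE !eqxx; have /and3P [xy _ _] := lg.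
  have yx : (req_dst n t == req_src n t) = false by rewrite eq_sym (negbTE xy).
  rewrite ?(negbTE xy) ?yx /=.
  by split=> //; apply: legal_mono lg; apply: leqW; exact: req_stage_le.
case: (boolP ((x == req_dst n t) && (y == req_src n t) && (E == req_level n t))) => [|h2].
  move=> /andP [/andP [/eqP ex /eqP ey] /eqP eE] _.
  rewrite ex ey eE !eqxx; have /and3P [xy _ _] := lg.
  have yx : (req_dst n t == req_src n t) = false by rewrite eq_sym (negbTE xy).
  rewrite ?(negbTE xy) ?yx /=.
  by split=> //; rewrite legal_sym; apply: legal_mono lg; apply: leqW; exact: req_stage_le.
have c1 : (y == req_src n t) && (x == req_dst n t) && (E == req_level n t) = false.
  by rewrite [(y == _) && _]andbC (negbTE h2).
have c2 : (y == req_dst n t) && (x == req_src n t) && (E == req_level n t) = false.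
  by rewrite [(y == _) && _]andbC (negbTE h1).
by rewrite c1 c2 /= => /IH [g1 g2 g3]; split=> //; exact: mon.
Qed.

Lemma decode n w x y E : x < vertex_count n -> y < vertex_count n -> E < level_count n ->
  let t := ((w * vertex_count n + x) * vertex_count n + y) * level_count n + E in
  [/\ req_src n t = x, req_dst n t = y, req_level n t = E & req_stage n t = w].
Proof.
move=> xM yM EK t; have K0 : 0 < level_count n by [].
have M0 := vertex_count_gt0 n.
have e1 : t %/ level_count n = (w * vertex_count n + x) * vertex_count n + y by rewrite divnMDl // divn_small ?addn0.
have e2 : ((w * vertex_count n + x) * vertex_count n + y) %/ vertex_count n = w * vertex_count n + x.
  by rewrite divnMDl // divn_small ?addn0.
rewrite /req_src /req_dst /req_level /req_stage e1 e2; split.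
- by rewrite modnMDl modn_small.
- by rewrite modnMDl modn_small.
- by rewrite modnMDl modn_small.
- by rewrite divnMDl // divn_small ?addn0.
Qed.

(** A filled slot stems from a legal request, so it is of the top level or its target is reachable
    at its level. Both kinds of terms are present in the Kraft sum. *)
Lemma row_weight n t x : x < vertex_count n ->
  \sum_(0 <= e < slot_count n) (entry_row n (st n t) x e != 0) * 2 ^ (top_level n - e %% level_count n) <= 3 * 2 ^ top_level n.
Proof.
move=> xM.
have nL : n <= top_level n by exact: leq_maxr.
apply: leq_trans (kraft run_coh t (code n x) nL).
rewrite /slot_count big_nat_mul; apply: sum_nat_le => y yM.
rewrite -{1}[y * level_count n]addn0 addnC mulSn big_addn addnK.
apply: sum_nat_le => E EK.
rewrite addnC slot_mod //.
case nz : (entry_row _ _ _ _ != 0) => //.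
have [/and3P [_ _ /orP lg] _ _] := entry_legal xM yM EK nz.
by case: lg => [->|/andP [-> _]]; rewrite ?orbT.
Qed.

Lemma served n w x y E : x < vertex_count n -> y < vertex_count n -> E < level_count n -> legal run n w x y E ->
  exists t, entry n t x y E != 0.
Proof.
move=> xM yM EK lg; have /and3P [xy lE _] := lg.
have n0 : 0 < n.
  case: (posnP n) => // n0; suff e : x = y by rewrite e eqxx in xy.
  by move: xM yM; rewrite n0 /vertex_count expn0; lia.
set t := ((w * vertex_count n + x) * vertex_count n + y) * level_count n + E.
have [eX eY eE eW] := decode w xM yM EK; rewrite -/t in eX eY eE eW.
case: (eqVneq (entry n t x y E) 0) => [s1|nz]; last by exists t.
have s2 : entry n t y x E = 0.
  by case: (eqVneq (entry n t y x E) 0) => // nz; have [_ <- _] := entry_legal yM xM EK nz.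
exists t.+1; rewrite /state /= -/(state run n t) /step eX eY eE eW lg s1 s2 !eqxx /=.
have eltx : y * level_count n + E < slot_count n by exact: slot_lt.
rewrite /try_put.
suff hp : pick_code n (hash_table n) (st n t) x y E < 2 ^ (E + 30).
  rewrite hp /entry_at entry_row_put ?(entry_lt_base EK hp) //.
  by rewrite upd_slot // !eqxx.
set l := flog n in lE; set r := 2 ^ l.
(* A code has [E + 30] bits and its head [4 * l + 22], which leaves [E + 8 - 4 * l] for the tail. *)
have Ncap : head_count n * 2 ^ (E + 8 - 4 * l) = 2 ^ (E + 30).
  by rewrite /head_count -/l -expnD; congr (2 ^ _); lia.
have invt : inv (head_count n) (slot_count n) (level_count n) (vertex_count n) (unit_count n) (pot_base n) (unit_cap n) (unit_of n (hash_table n)) (entry_row n (st n t)).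
  exact: state_inv.
have lr : l < r by exact: ltn_expl.
have nr : n < 2 * r by rewrite /r -expnS; exact: trunc_log_ltn.
have N0 : 0 < head_count n by rewrite expn_gt0.
have q0 : 0 < unit_count n by rewrite expn_gt0.
have mq : 32 * pot_base n <= unit_count n.
  by rewrite /pot_base /unit_count -/l -[32]/(2 ^ 5) -expnD leq_exp2l //; lia.
have flt x' h : x' < vertex_count n -> h < head_count n -> unit_of n (hash_table n) x' h < unit_count n by rewrite ltn_mod.
have lev x' e : x' < vertex_count n -> e < slot_count n -> entry_row n (st n t) x' e != 0 -> 6 * l <= e %% level_count n.
  move=> x'M elt nz; have eK : e %% level_count n < level_count n by rewrite ltn_mod.
  have yM' : e %/ level_count n < vertex_count n by rewrite ltn_divLR.
  have := @entry_legal n t x' (e %/ level_count n) (e %% level_count n) x'M yM' eK.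
  by rewrite /entry_at -divn_eq => /(_ nz) [/and3P []].
(* By the choice of [unit_cap], filling a unit costs the same weight at every level; the two sides
   are equal. *)
have HOm E' : 6 * l <= E' -> E' < level_count n -> 2 ^ (top_level n + 12 - l) <= unit_cap n E' * 2 ^ (top_level n - E').
  by rewrite /level_count /unit_cap -/l => lE' E'L; rewrite -expnD leq_exp2l //; lia.
have HW x' : (x' == x) || (x' == y) ->
   \sum_(0 <= e < slot_count n) (entry_row n (st n t) x' e != 0) * 2 ^ (top_level n - e %% level_count n) <= 3 * 2 ^ top_level n.
  by case/orP=> /eqP ->; apply: row_weight.
(* In multiples of [2 ^ (top_level n + 12)]: the total weight is below 1, the partly filled units
   take at most 2, and 64 are available. *)
have Hq : 3 * 2 ^ top_level n + 2 ^ (top_level n + 12 - l) * (level_count n - 6 * l) < 2 ^ (top_level n + 12 - l) * unit_count n.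
  have h1 : level_count n - 6 * l <= 2 * r by rewrite /level_count /top_level -/l; lia.
  have h2 : unit_count n = 64 * r by rewrite /unit_count -/l expnD mulnC.
  have lL : l <= top_level n by rewrite /top_level -/l; lia.
  have h3 : 2 ^ (top_level n + 12 - l) * r = 2 ^ (top_level n + 12).
    by rewrite /r -expnD subnK //; lia.
  have h4 : 4 * 2 ^ top_level n <= 2 ^ (top_level n + 12).
    by rewrite -[4]/(2 ^ 2) -expnD leq_exp2l //; lia.
  rewrite h2 [X in _ < X]mulnCA h3; have L0 := expn_gt0 2 (top_level n).
  have : 2 ^ (top_level n + 12 - l) * (level_count n - 6 * l) <= 2 * 2 ^ (top_level n + 12).
    by rewrite -h3 mulnCA leq_mul2l h1 orbT.
  by move: h4; move: (2 ^ (top_level n + 12)) (2 ^ top_level n) L0 => a c; lia.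
have cap0 : 0 < 2 ^ (E + 8 - 4 * l) by rewrite expn_gt0.
have T0 : 0 < unit_cap n E by rewrite expn_gt0.
have HL c lo : c <= unit_cap n E -> 2 ^ lo * pot_base n ^ c <= vertex_count n ^ 2 * unit_count n ^ 2 * (pot_base n).+1 ^ c ->
   32 * unit_count n ^ 2 * lo <= head_count n * 2 ^ (E + 8 - 4 * l).
  by rewrite Ncap; exact: load_bound.
have [P PN hP] := alloc_step N0 q0 erefl mq flt (hash_table_spread n0) xM yM xy lE EK cap0 invt
  s1 s2 lev HOm HW Hq T0 HL.
rewrite Ncap in PN.
have okP : state_ok n (hash_table n) (put_entry n (st n t) x y E P).
  rewrite /state_ok (@inv_ext _ _ _ _ _ _ _ _ _ (upd (level_count n) (entry_row n (st n t)) x y E P)) //.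
  by move=> x' e x'M elt; apply: entry_row_put => //; exact: entry_lt_base PN.
have hs : has (fun P => state_ok n (hash_table n) (put_entry n (st n t) x y E P)) (iota 0 (2 ^ (E + 30))).
  by apply/hasP; exists P; rewrite ?mem_iota.
by have := hs; rewrite has_find size_iota.
Qed.

End State.

(** * Decoding the allocation *)

Section GraphMachine.
Variable run : nat -> nat -> nat -> nat.
Hypothesis computable_run : computable 3 (fun l => run (nth 0 l 0) (nth 0 l 1) (nth 0 l 2)).
Hypothesis run_mono : forall p a, mono (fun t => run t p a).
Hypothesis run_coh : coherent run.

Local Notation entry n t x y E := (entry_at n (state run n t) x y E).

Lemma lsb_val_vertex (x : bstring) n : size x = n -> lsb_val x < vertex_count n.
Proof. by move=> <-; exact: lsb_val_lt. Qed.

Lemma graph_dec_str t (p x y : bstring) : graph_dec run t (enc p) (enc x) (enc y) <->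
  (p = [:: false] /\ x = y) \/
  exists p' E, [/\ p = true :: p', size p' = E + 30, size y = size x, E < level_count (size x)
    & entry (size x) t (lsb_val x) (lsb_val y) E = (lsb_val p').+1].
Proof.
rewrite /graph_dec !len_enc !num_enc; split.
  case/orP=> [/andP [/eqP p1 /eqP e]|/and5P [/eqP sy sp /eqP pp lE /eqP h]].
    by left; split; [apply: enc_inj | exact: enc_inj].
  right; case: p sp pp lE h => // b p sp pp lE h.
  (* A string that starts with [false] has an odd number, which the parity test rejects. *)
  have eb : b = true.
    by case: (b) pp => //= /eqP pp; lia.
  exists p, (size p - 30); rewrite eb; split=> //.
  - by move: sp => /=; lia.
  - move: h; rewrite eb /=.
    have -> : ((enc p).*2.+1 + 1 - 2) %/ 2 = enc p by lia.
    by rewrite num_enc subSS.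
case=> [[-> ->]|[p' [E [-> sp sy EK h]]]]; first by rewrite !eqxx.
apply/orP; right; rewrite sy eqxx /= sp.
have -> : ((enc p').*2.+1 + 1 - 2) %/ 2 = enc p' by lia.
have -> : (E + 30).+1 - 31 = E by lia.
rewrite num_enc h EK eqxx /= andbT; apply/andP; split; first by lia.
by apply/eqP; lia.
Qed.

(** The shorter code still contains the head, so both codes lie in one unit of [x]. A unit has a
    single level, hence the lengths agree, and a code occurs in a unit only once. *)
Lemma entry_prefix n t t' x y y' E E' P P' : x < vertex_count n -> y < vertex_count n -> y' < vertex_count n ->
  E < level_count n -> E' < level_count n -> E <= E' -> P' %% 2 ^ (E + 30) = P ->
  entry n t x y E = P.+1 -> entry n t' x y' E' = P'.+1 -> E = E' /\ (P = P' -> y = y').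
Proof.
move=> xM yM yM' EK EK' EE PP e1 e2.
(* Entries never change, so both can be read at the later time. *)
wlog : t t' e1 e2 / t = t'.
  move=> key; apply: (key (maxn t t') (maxn t t')) => //.
    by rewrite -e1; apply: entry_mono; rewrite ?e1 ?leq_maxl.
  by rewrite -e2; apply: entry_mono; rewrite ?e2 ?leq_maxr.
move=> tt; rewrite -tt in e2 => {tt t'}.
have /andP [/all_iotaP rows _] := state_inv run n t.
have /row_okP ok := rows x xM.
have lt1 : y * level_count n + E < slot_count n by exact: slot_lt.
have lt2 : y' * level_count n + E' < slot_count n by exact: slot_lt.
rewrite /entry_at in e1 e2.
have [|_] := ok _ lt1; first by rewrite e1.
move=> /(_ _ lt2); rewrite e2 => /(_ isT).
have [/and3P [_ lE _] _ _] : [/\ legal run n t x y E, entry n t y x E = entry n t x y E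
    & entry n t x y E <= 2 ^ (E + 30)].
  by apply: entry_legal => //; rewrite /entry_at e1.
have -> : head_of (head_count n) (entry_row n (state run n t) x (y * level_count n + E)) = head_of (head_count n) P'.+1.
  rewrite e1 /head_of /= -PP modn_dvdm //.
  by rewrite /head_count dvdn_exp2l //; lia.
rewrite eqxx !slot_mod // e1 => -[-> h]; split=> // eP.
by have /eqP := h (f_equal succn eP); rewrite slot_eq // => /andP [/eqP].
Qed.

(** The bit added to the [E + 30] bits of a code keeps it incomparable with [[:: false]]. One
    program serves both directions because the two mirrored slots hold the same code. *)
Lemma graph_machine : exists W, prefix_free W /\
  (forall x, app W [:: false] x x) /\
  forall (x y : bstring) t E, size x = size y -> x != y ->
    6 * flog (size x) <= E <= top_level (size x) ->
    (E = top_level (size x)) \/ (reach run t E (enc x) (enc y) /\ reach run t E (enc y) (enc x)) ->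
    exists p, [/\ size p = E + 31, app W p x y & app W p y x].
Proof.
have [|W HW] := re_program (computable_graph_dec computable_run).
  move=> w p x y w' y'.
  have [sp <-] := enc_surj p; have [sx <-] := enc_surj x; have [sy <-] := enc_surj y.
  have [sy' <-] := enc_surj y'.
  move=> /graph_dec_str h /graph_dec_str h'; congr enc.
  case: h h' => [[-> <-]|[p1 [E [-> s1 s2 s3 e1]]]] [[q1 q2]|[p2 [E' [q1 r1 r2 r3 e2]]]] //.
  case: q1 => q1; rewrite q1 in s1 e1; have EE : E = E' by lia.
  have PP : lsb_val p2 %% 2 ^ (E + 30) = lsb_val p2 by rewrite modn_small // EE -r1 lsb_val_lt.
  have EE' : E <= E' by rewrite EE.
  have [_ h] := entry_prefix (lsb_val_vertex (erefl (size sx))) (lsb_val_vertex s2) (lsb_val_vertex r2) s3 r3 EE' PP e1 e2.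
  by apply: lsb_val_inj; [rewrite s2 r2 | exact: h].
exists W; split; [|split].
- move=> x p q y z /HW [w /graph_dec_str h] /HW [w' /graph_dec_str h'] pq.
  case: h h' pq => [[-> xy]|[p1 [E [-> s1 s2 s3 e1]]]] [[-> xz]|[p2 [E' [-> r1 r2 r3 e2]]]] //.
  rewrite /= ?eqxx /= => pq; congr cons.
  have [sz vz] := prefix_lsb_val pq.
  have EE' : E <= E' by move: sz; rewrite s1 r1 leq_add2r.
  have PP : lsb_val p2 %% 2 ^ (E + 30) = lsb_val p1 by rewrite -s1.
  have [EE _] := entry_prefix (lsb_val_vertex (erefl (size x))) (lsb_val_vertex s2) (lsb_val_vertex r2) s3 r3 EE' PP e1 e2.
  have /prefixP [s es] := pq.
  have : size s = 0 by have := f_equal size es; rewrite size_cat s1 r1 EE; lia.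
  by move/size0nil => s0; rewrite es s0 cats0.
- by move=> x; apply/HW; exists 0; apply/graph_dec_str; left.
- move=> x y t E sxy xy /andP [lE EL] h.
  have xM := lsb_val_vertex (erefl (size x)); have yM := lsb_val_vertex (esym sxy).
  have EK : E < level_count (size x) by rewrite ltnS.
  have lg : legal run (size x) t (lsb_val x) (lsb_val y) E.
    rewrite /legal lE; apply/andP; split.
      by apply: contra xy => /eqP e; apply/eqP; exact: lsb_val_inj.
    rewrite /= code_enc sxy code_enc -sxy; case: h => [->|[-> ->]]; rewrite ?eqxx ?orbT //.
  have [t' nz] := served run_mono run_coh xM yM EK lg.
  have [_ sym bound] := entry_legal run_mono xM yM EK nz.
  case e : (entry _ _ _ _ _) nz sym bound => [|P] // _ sym PE.
  exists (true :: str (E + 30) P); split.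
  + by rewrite /= size_str; lia.
  + apply/HW; exists t'; apply/graph_dec_str; right; exists (str (E + 30) P), E.
    by rewrite size_str lsb_val_str.
  + apply/HW; exists t'; apply/graph_dec_str; right; exists (str (E + 30) P), E.
    by rewrite size_str lsb_val_str // -sxy.
Qed.

End GraphMachine.

(** * Sequential allocation on one side *)

(** Now the first bit is the most significant one: strings stand for dyadic intervals, and a prefix
    for a larger interval. *)
Fixpoint msb_val (s : bstring) : nat := if s is b :: s' then b * 2 ^ size s' + msb_val s' else 0.

Lemma msb_val_lt s : msb_val s < 2 ^ size s.
Proof. by elim: s => //= b s IH; rewrite expnS; case: b; lia. Qed.

Lemma msb_val_cat p s : msb_val (p ++ s) = msb_val p * 2 ^ size s + msb_val s.
Proof. by elim: p => //= b p ->; rewrite size_cat expnD; lia. Qed.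

Lemma msb_val_surj k P : P < 2 ^ k -> exists2 p : bstring, size p = k & msb_val p = P.
Proof.
elim: k P => [|k IH] P; first by rewrite expn0 ltnS leqn0 => /eqP ->; exists [::].
rewrite expnS => Plt; case: (leqP (2 ^ k) P) => h.
  have [|p sp rp] := IH (P - 2 ^ k); first by lia.
  by exists (true :: p); rewrite /= sp // rp; lia.
by have [p sp rp] := IH P h; exists (false :: p); rewrite /= sp // rp.
Qed.

(** Reverses the bits of [num p], in order to obtain [msb_val] from the number of a string. *)
Definition msb_num (p : nat) : nat :=
  \sum_(0 <= i < len p) (num p %/ 2 ^ i) %% 2 * 2 ^ (len p - i.+1).

Lemma msb_num_enc s : msb_num (enc s) = msb_val s.
Proof.
rewrite /msb_num len_enc num_enc; elim: s => [|b s IH]; first by rewrite big_geq.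
rewrite big_nat_recl // [msb_val _]/= -IH expn0 divn1 [size _]/= subn1 [lsb_val _]/=; congr (_ + _).
  by congr (_ * _); rewrite -muln2 addnC modnMDl; case: b.
apply: eq_bigr => i _; rewrite subSS expnS divnMA; congr (_ %/ _ %% _ * _).
by case: b; lia.
Qed.

Section KraftChaitin.
Variable run : nat -> nat -> nat -> nat.

Definition kc_level n t := t %% n.+1.
Definition kc_dst n t := (t %/ n.+1) %% 2 ^ n.
Definition kc_stage n t := t %/ n.+1 %/ 2 ^ n.

Definition kc_legal n a t : bool :=
  (kc_level n t == n) || reach run (kc_stage n t) (kc_level n t) a (code n (kc_dst n t)).

(** A legal request returns in every later stage; only its first appearance is given a segment. *)
Definition kc_new n a t : bool :=
  kc_legal n a t && all (fun s => ~~ [&& kc_legal n a s, kc_level n s == kc_level n t & kc_dst n s == kc_dst n t]) (iota 0 t).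

Definition kc_start n a t : nat := \sum_(0 <= s < t) kc_new n a s * 2 ^ (n.+1 - kc_level n s).

(* Rounding [kc_start] up loses at most half of the segment of length [2 ^ (n.+1 - kc_level n t)]. *)
Definition kc_code n a t : nat := (kc_start n a t + (2 ^ (n - kc_level n t)).-1) %/ 2 ^ (n - kc_level n t).

Definition kc_graph (t p x y : nat) : bool :=
  [&& len y == len x, kc_new (len x) x t, kc_dst (len x) t == num y,
      len p == kc_level (len x) t + 3 & msb_num p == kc_code (len x) x t].

Hypothesis computable_run : computable 3 (fun l => run (nth 0 l 0) (nth 0 l 1) (nth 0 l 2)).
Hypothesis run_mono : forall p a, mono (fun t => run t p a).
Hypothesis run_coh : coherent run.

Lemma computable_kc_level m n t : computable m n -> computable m t ->
  computable m (fun l => kc_level (n l) (t l)).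
Proof. by move=> *; rewrite /kc_level; repeat computability_alloc. Qed.

Lemma computable_kc_dst m n t : computable m n -> computable m t ->
  computable m (fun l => kc_dst (n l) (t l)).
Proof. by move=> *; rewrite /kc_dst; repeat computability_alloc. Qed.

Lemma computable_kc_legal m n a t : computable m n -> computable m a -> computable m t ->
  computable m (fun l => kc_legal (n l) (a l) (t l)).
Proof.
move=> *; rewrite /kc_legal /kc_stage.
apply: computable_or; first by apply: computable_eq => //; exact: computable_kc_level.
apply: computable_reach => //; first by repeat computability_alloc.
  exact: computable_kc_level.
by apply: computable_code => //; exact: computable_kc_dst.
Qed.

Lemma computable_kc_new m n a t : computable m n -> computable m a -> computable m t ->
  computable m (fun l => kc_new (n l) (a l) (t l)).
Proof.
apply: (@computable3 kc_new); rewrite /kc_new.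
apply: computable_and; first by apply: computable_kc_legal; repeat computability_alloc.
apply: computable_all; first by repeat computability_alloc.
by repeat (cbv beta; lazymatch goal with
  | |- computable _ (fun l => nat_of_bool (kc_legal _ _ _)) => apply: computable_kc_legal
  | |- computable _ (fun l => kc_level _ _) => apply: computable_kc_level
  | |- computable _ (fun l => kc_dst _ _) => apply: computable_kc_dst
  | _ => computability_alloc end).
Qed.

Lemma computable_kc_start m n a t : computable m n -> computable m a -> computable m t ->
  computable m (fun l => kc_start (n l) (a l) (t l)).
Proof.
apply: (@computable3 kc_start); rewrite /kc_start.
by repeat (cbv beta; lazymatch goal with
  | |- computable _ (fun l => nat_of_bool (kc_new _ _ _)) => apply: computable_kc_new
  | |- computable _ (fun l => kc_level _ _) => apply: computable_kc_level
  | _ => computability_alloc end).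
Qed.

Lemma computable_msb_num m p : computable m p -> computable m (fun l => msb_num (p l)).
Proof. by apply: (@computable1 msb_num); rewrite /msb_num; repeat computability_alloc. Qed.

Lemma computable_kc_graph :
  computable 4 (fun l => kc_graph (nth 0 l 0) (nth 0 l 1) (nth 0 l 2) (nth 0 l 3)).
Proof.
rewrite /kc_graph /kc_code.
by repeat (cbv beta; lazymatch goal with
  | |- computable _ (fun l => nat_of_bool (kc_new _ _ _)) => apply: computable_kc_new
  | |- computable _ (fun l => kc_level _ _) => apply: computable_kc_level
  | |- computable _ (fun l => kc_dst _ _) => apply: computable_kc_dst
  | |- computable _ (fun l => kc_start _ _ _) => apply: computable_kc_start
  | |- computable _ (fun l => msb_num _) => apply: computable_msb_num
  | _ => computability_alloc end).
Qed.

Lemma kc_level_le n t : kc_level n t <= n. Proof. by rewrite -ltnS ltn_mod. Qed.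

Lemma kc_start_mono n a t t' : t <= t' -> kc_start n a t <= kc_start n a t'.
Proof. by move=> tt; rewrite /kc_start [X in _ <= X](@big_cat_nat _ _ _ t) //= leq_addr. Qed.

Lemma kc_new_inj n a t t' : kc_new n a t -> kc_new n a t' -> kc_level n t = kc_level n t' -> kc_dst n t = kc_dst n t' ->
  t = t'.
Proof.
have key s s' : s < s' -> kc_new n a s -> kc_new n a s' -> kc_level n s = kc_level n s' -> kc_dst n s <> kc_dst n s'.
  move=> ss /andP [ls _] /andP [_ /allP new] eE eY.
  by have := new s; rewrite mem_iota ss ls eE eY !eqxx => /(_ isT).
move=> nt nt' eE eY; case: (ltngtP t t') => // h.
  by case: (key _ _ h nt nt' eE eY).
by case: (key _ _ h nt' nt (esym eE) (esym eY)).
Qed.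

(** Every request is counted once, and legality at its stage implies reachability at time [t]. The 6
    is the 3 of the Kraft bound, doubled by the length of the segments. *)
Lemma kc_start_total n a t : kc_start n a t <= 6 * 2 ^ n.
Proof.
have := kraft run_coh t a (leqnn n).
set S := (X in X <= _) => hS.
suff : kc_start n a t <= 2 * S by lia.
rewrite /S /kc_start sum_nat_mull.
apply: (@leq_trans (\sum_(0 <= s < t) \sum_(0 <= Y < 2 ^ n) \sum_(0 <= E < n.+1)
   [&& kc_new n a s, kc_dst n s == Y & kc_level n s == E] * 2 ^ (n.+1 - E))).
  apply: sum_nat_le => s _; case nw : (kc_new n a s) => //.
  have Yl : kc_dst n s < 2 ^ n by rewrite ltn_mod expn_gt0.
  have El : kc_level n s < n.+1 by rewrite ltn_mod.
  apply: leq_trans (sum_nat_ge _ Yl); apply: leq_trans (sum_nat_ge _ El).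
  by rewrite !eqxx.
rewrite exchange_big /=; apply: sum_nat_le => Y Yl.
rewrite exchange_big /= sum_nat_mull; apply: sum_nat_le => E El.
rewrite -sum_nat_mulr subSn // expnS mulnCA leq_mul2l /= leq_mul2r; apply/orP; right.
apply: (@leq_trans (has (fun s => [&& kc_new n a s, kc_dst n s == Y & kc_level n s == E]) (iota 0 t))).
  case: (boolP (has _ _)) => [_|/hasPn none].
    apply: sum_nat_atmost1 => s s' _ _ /and3P [h1 /eqP e1 /eqP e2] /and3P [h2 /eqP e3 /eqP e4].
    by apply: (kc_new_inj h1 h2); rewrite ?e1 ?e2.
  rewrite big1_seq // => s; rewrite mem_index_iota => /andP [_ /andP [_ st]].
  by have := none s; rewrite mem_iota st => /(_ isT) /negbTE ->.
case: (boolP (has _ _)) => // /hasP [s]; rewrite mem_iota => /andP [_ st].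
move=> /and3P [/andP [/orP lg _] /eqP <- /eqP <-]; case: lg => [->|r] //.
suff -> : reach run t (kc_level n s) a (code n (kc_dst n s)) by rewrite orbT.
have ws : kc_stage n s <= t by rewrite /kc_stage -divnMA; apply: leq_trans (leq_div _ _) _; exact: ltnW.
case/hasP: r => p pi /eqP rp; apply/hasP; exists p => //.
by apply/eqP; exact: run_mono ws rp.
Qed.

Lemma kc_code_ge n a t : kc_start n a t <= kc_code n a t * 2 ^ (n - kc_level n t).
Proof.
have := expn_gt0 2 (n - kc_level n t); rewrite /kc_code; set d := 2 ^ _ => d0.
have := divn_eq (kc_start n a t + d.-1) d; have := ltn_pmod (kc_start n a t + d.-1) d0; lia.
Qed.

Lemma kc_code_lt n a t t' : kc_new n a t -> t < t' ->
  (kc_code n a t).+1 * 2 ^ (n - kc_level n t) <= kc_start n a t'.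
Proof.
move=> nw tt; apply: leq_trans (kc_start_mono n a tt).
rewrite /kc_start big_nat_recr //= nw mul1n -/(kc_start n a t) subSn ?kc_level_le // expnS.
have := expn_gt0 2 (n - kc_level n t); rewrite /kc_code; set d := 2 ^ _ => d0.
have := leq_divM (kc_start n a t + d.-1) d; lia.
Qed.

(** The segments end by [6 * 2 ^ n <= 2 ^ (n + 3)]; this is the origin of the three additional
    bits. *)
Lemma kc_code_bound n a t : kc_new n a t -> kc_code n a t < 2 ^ (kc_level n t + 3).
Proof.
move=> nw; rewrite -(@leq_pmul2r (2 ^ (n - kc_level n t))) ?expn_gt0 // -expnD.
have -> : kc_level n t + 3 + (n - kc_level n t) = n + 3 by have := kc_level_le n t; lia.
apply: leq_trans (kc_code_lt nw (ltnSn t)) _; apply: leq_trans (kc_start_total _ _ _) _.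
by rewrite mulnC expnD leq_mul2l; apply/orP; right.
Qed.

(** Comparable strings are nested intervals, whereas the intervals of two requests lie in disjoint
    segments. *)
Lemma kc_code_comparable n a t t' j : kc_new n a t -> kc_new n a t' -> kc_level n t' = kc_level n t + j ->
  kc_code n a t' %/ 2 ^ j = kc_code n a t -> t = t'.
Proof.
move=> nw nw' eE eP; have El' := kc_level_le n t'.
set P := kc_code n a t in eP; set P' := kc_code n a t' in eP.
have ed : 2 ^ (n - kc_level n t) = 2 ^ j * 2 ^ (n - kc_level n t').
  by rewrite -expnD; congr (2 ^ _); lia.
have j0 := expn_gt0 2 j.
have h1 : P * 2 ^ j <= P' by rewrite -eP; exact: leq_divM.
have h2 : P' < P.+1 * 2 ^ j by rewrite -eP; exact: ltn_ceil.
have d0 := expn_gt0 2 (n - kc_level n t').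
case: (ltngtP t t') => // tt.
  have := leq_trans (kc_code_lt nw tt) (kc_code_ge n a t').
  by rewrite -/P -/P' ed mulnA leq_pmul2r // leqNgt h2.
have := leq_trans (kc_code_lt nw' tt) (kc_code_ge n a t).
by rewrite -/P -/P' ed mulnA leq_pmul2r // ltnNge h1.
Qed.

Lemma kc_machine : exists2 W, prefix_free W &
  forall (x y : bstring) t E, size x = size y -> E <= size x ->
    (E = size x) \/ reach run t E (enc x) (enc y) ->
    exists2 p, size p = E + 3 & app W p x y.
Proof.
have str (t : nat) (p x y : bstring) : kc_graph t (enc p) (enc x) (enc y) <->
   [/\ size y = size x, kc_new (size x) (enc x) t, kc_dst (size x) t = lsb_val y,
       size p = kc_level (size x) t + 3 & msb_val p = kc_code (size x) (enc x) t].
  rewrite /kc_graph !len_enc !num_enc msb_num_enc; split.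
    by move=> /and5P [/eqP ? ? /eqP ? /eqP ? /eqP ?].
  by move=> [-> -> -> -> ->]; rewrite !eqxx.
have comp (t t' : nat) (p q x y z : bstring) : kc_graph t (enc p) (enc x) (enc y) ->
    kc_graph t' (enc q) (enc x) (enc z) -> prefix p q -> t = t'.
  move=> /str [_ nw _ sp rp] /str [_ nw' _ sq rq] /prefixP [s es].
  apply: (@kc_code_comparable _ _ _ _ (size s) nw nw').
    by have := f_equal size es; rewrite size_cat sp sq; lia.
  by rewrite -rq -rp es msb_val_cat divnMDl ?expn_gt0 // divn_small ?addn0 // msb_val_lt.
have [|W HW] := re_program computable_kc_graph.
  move=> w p x y w' y'.
  have [sp <-] := enc_surj p; have [sx <-] := enc_surj x; have [sy <-] := enc_surj y.
  have [sy' <-] := enc_surj y' => h h'.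
  have ww := comp _ _ _ _ _ _ _ h h' (prefix_refl sp); rewrite -ww in h'.
  case/str: h => s1 _ v1 _ _; case/str: h' => s2 _ v2 _ _; congr enc.
  by apply: lsb_val_inj; [rewrite s1 s2 | rewrite -v1 -v2].
exists W.
  move=> x p q y z /HW [t h] /HW [t' h'] pq.
  have tt := comp _ _ _ _ _ _ _ h h' pq; rewrite -tt in h'.
  case/str: h => _ _ _ s1 _; case/str: h' => _ _ _ s2 _; case/prefixP: pq => s es.
  have : size s = 0 by have := f_equal size es; rewrite size_cat s1 s2; lia.
  by move/size0nil => s0; rewrite es s0 cats0.
move=> x y w E sxy EL h; set n := size x in EL h *.
(* The least time at which the request is legal is the one at which it is new. *)
pose P t := [&& kc_legal n (enc x) t, kc_level n t == E & kc_dst n t == lsb_val y].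
have exP : exists t, P t.
  exists ((w * 2 ^ n + lsb_val y) * n.+1 + E).
  have yl : lsb_val y < 2 ^ n by rewrite /n sxy lsb_val_lt.
  have eE : kc_level n ((w * 2 ^ n + lsb_val y) * n.+1 + E) = E by rewrite /kc_level modnMDl modn_small.
  have ed : ((w * 2 ^ n + lsb_val y) * n.+1 + E) %/ n.+1 = w * 2 ^ n + lsb_val y.
    by rewrite divnMDl // divn_small ?addn0.
  have eY : kc_dst n ((w * 2 ^ n + lsb_val y) * n.+1 + E) = lsb_val y.
    by rewrite /kc_dst ed modnMDl modn_small.
  have eW : kc_stage n ((w * 2 ^ n + lsb_val y) * n.+1 + E) = w.
    by rewrite /kc_stage ed divnMDl ?expn_gt0 // divn_small ?addn0.
  rewrite /P /kc_legal eE eY eW !eqxx andbT.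
  by case: h => [->|h]; rewrite ?eqxx // /n sxy code_enc h orbT.
case: (ex_minnP exP) => t /and3P [lg /eqP eE /eqP eY] mint.
have nw : kc_new n (enc x) t.
  rewrite /kc_new lg; apply/allP => s; rewrite mem_iota => /andP [_ st].
  apply/negP => /and3P [ls es1 es2].
  have : t <= s by apply: mint; rewrite /P ls (eqP es1) (eqP es2) eE eY !eqxx.
  by rewrite leqNgt st.
have [p sp rp] := msb_val_surj (kc_code_bound nw).
exists p; first by rewrite sp eE.
by apply/HW; exists t; apply/str; split=> //; rewrite -?sxy.
Qed.

End KraftChaitin.

(** * Information distances *)

(* All that Kraft's inequality needs from either prefix-freeness or prefix-stability. *)
Definition compatible (U : PR) : Prop :=
  forall p p' x y y', app U p x y -> app U p' x y' -> prefix p p' -> y = y'.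

Lemma prefix_free_compatible U : prefix_free U -> compatible U.
Proof.
move=> pf p p' x y y' h h' pp; have e := pf _ _ _ _ _ h h' pp.
by rewrite -e in h'; apply: enc_inj; exact: eval_det h h'.
Qed.

Lemma prefix_stable_compatible U : prefix_stable U -> compatible U.
Proof.
move=> ps p p' x y y' h h' pp; apply: enc_inj.
exact: eval_det (ps _ _ _ _ h pp) h'.
Qed.

Lemma run_exists (U : PR) : exists run : nat -> nat -> nat -> nat,
  [/\ computable 3 (fun l => run (nth 0 l 0) (nth 0 l 1) (nth 0 l 2)),
      forall p a, mono (fun t => run t p a)
    & forall p x y, eval U [:: p; x] y <-> exists t, run t p x = y.+1].
Proof.
have [r [Cr Mr Er]] := stepped_exists U 2.
exists (fun t p x => r [:: t; p; x]); split.
- by apply: (computable_ext Cr) => -[|a [|b [|c []]]].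
- by move=> p a; exact: Mr.
- by move=> p x y; exact: Er.
Qed.

Section Run.
Variables (U : PR) (run : nat -> nat -> nat -> nat).
Hypothesis run_mono : forall p a, mono (fun t => run t p a).
Hypothesis runE : forall p x y, eval U [:: p; x] y <-> exists t, run t p x = y.+1.

Lemma compatible_coherent : compatible U -> coherent run.
Proof.
move=> comp t a j j' P b b' jj Plt h h'.
have [sa ea] := enc_surj a; have [sb eb] := enc_surj b; have [sb' eb'] := enc_surj b'.
have Pj : P %% 2 ^ j < 2 ^ j by rewrite ltn_mod expn_gt0.
have u1 : app U (str j (P %% 2 ^ j)) sa sb.
  by apply/runE; exists t; rewrite enc_str // ea eb.
have u2 : app U (str j' P) sa sb' by apply/runE; exists t; rewrite enc_str // ea eb'.
rewrite -eb -eb' (comp _ _ _ _ _ u1 u2) //.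
by apply: lsb_val_prefix; rewrite !size_str // !lsb_val_str.
Qed.

Lemma app_reach p x y k : app U p x y -> size p <= k -> exists t, reach run t k (enc x) (enc y).
Proof.
move=> /runE [t h] pk; exists t; apply/hasP; exists (enc p); last by rewrite h.
by rewrite mem_iota add0n len_lt len_enc.
Qed.

(** [W] accepts a program as soon as [U] accepts one of its prefixes; by compatibility two such
    prefixes cannot disagree. *)
Lemma stable_closure : compatible U -> computable 3 (fun l => run (nth 0 l 0) (nth 0 l 1) (nth 0 l 2)) ->
  exists2 W, prefix_stable W & forall p x y, app U p x y -> app W p x y.
Proof.
move=> comp Cr; have coh := compatible_coherent comp.
pose D t p x y := has (fun j => run t (code j (num p %% 2 ^ j)) x == y.+1) (iota 0 (len p).+1).
have [||W HW] := @re_program D.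
- rewrite /D; apply: computable_has; first by repeat computability_alloc.
  cbv beta; apply: computable_eq; last by repeat computability_alloc.
  by apply: (computable3 Cr); repeat computability_alloc.
- move=> w p x y w' y' /hasP [j ji /eqP h] /hasP [j' ji' /eqP h'].
  have {}h : run (maxn w w') (code j (num p %% 2 ^ j)) x = y.+1.
    by apply: run_mono h; exact: leq_maxl.
  have {}h' : run (maxn w w') (code j' (num p %% 2 ^ j')) x = y'.+1.
    by apply: run_mono h'; exact: leq_maxr.
  have key k k' c c' : k <= k' -> run (maxn w w') (code k (num p %% 2 ^ k)) x = c.+1 ->
      run (maxn w w') (code k' (num p %% 2 ^ k')) x = c'.+1 -> c = c'.
    move=> kk e1 e2; apply: (coh _ _ _ _ _ _ _ kk _ _ e2); first by rewrite ltn_mod expn_gt0.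
    by rewrite modn_dvdm ?dvdn_exp2l // e1.
  by case: (leqP j j') => [|/ltnW] jj; [apply: (key j j') | symmetry; apply: (key j' j)].
exists W.
  move=> p p' x y /HW [t /hasP [j]]; rewrite mem_iota len_enc num_enc => /andP [_ jp] /eqP h pp.
  have [sp vp] := prefix_lsb_val pp.
  apply/HW; exists t; apply/hasP; exists j; first by rewrite mem_iota len_enc add0n leq0n ltnS (leq_trans _ sp).
  by rewrite num_enc -h -vp modn_dvdm ?dvdn_exp2l.
move=> p x y /runE [t h]; apply/HW; exists t; apply/hasP; exists (size p).
  by rewrite mem_iota len_enc add0n ltnSn.
by rewrite num_enc modn_small ?lsb_val_lt // code_enc h.
Qed.

End Run.

Lemma KP_le_compatible V U : optimal_KP V -> compatible U ->
  exists c, forall x y p, size x = size y -> app U p x y ->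
    exists2 q, app V q x y & size q <= size p + c.
Proof.
move=> [_ opt] comp; have [run [Cr Mr Er]] := run_exists U.
have coh := compatible_coherent Er comp.
have [W pfW HW] := kc_machine Cr Mr coh.
have [c Hc] := opt W pfW; exists (3 + c) => x y p sxy h.
have [t rt] := app_reach Er h (leqnn _).
(* Beyond level [size x] the trivial request takes over, hence the minimum. *)
have [||q sq hq] := HW x y t (minn (size p) (size x)) sxy; first exact: geq_minr.
  by case: (leqP (size x) (size p)) => hp; [left | right].
have [q' [h' s']] := Hc x y q hq; exists q' => //.
apply: leq_trans s' _; rewrite sq; have := geq_minl (size p) (size x); lia.
Qed.

(** [flog] is the integer part of the real logarithm for positive [n], and zero for [n = 0]. *)
Lemma six_log_trunc n m : six_log_le n m -> 6 * flog n <= m.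
Proof.
case: n => [|n]; first by rewrite /flog trunc_log0 muln0.
have pw k : INR (2 ^ k) = pow (INR 2) k.
  by elim: k => [|k IH]; rewrite ?expn0 // expnS mult_INR IH.
have h2 : Rlt 1 (INR 2) by rewrite /=; lra.
have ln2 : Rlt 0 (ln (INR 2)) by rewrite -ln_1; apply: ln_increasing; lra.
rewrite /six_log_le => h; have hl : 2 ^ flog n.+1 <= n.+1 by exact: trunc_logP.
have : Rle (ln (INR (2 ^ flog n.+1))) (ln (INR n.+1)).
  have : Rle (INR (2 ^ flog n.+1)) (INR n.+1) by apply: le_INR; apply/leP.
  have : Rlt 0 (INR (2 ^ flog n.+1)) by rewrite pw; apply: pow_lt; lra.
  by move=> h0 [/(ln_increasing _ _ h0) ? | ->]; [left | right].
rewrite pw ln_pow; last by lra.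
move=> h3; apply/leP; apply: INR_le; rewrite mult_INR.
apply: Rle_trans h; apply: Rmult_le_compat_l; first exact: pos_INR.
apply: (Rmult_le_reg_r (ln (INR 2))) => //.
by rewrite /Rdiv Rmult_assoc Rinv_l ?Rmult_1_r //; lra.
Qed.

(** The minimum is reached by descent with excluded middle, since membership in [P] need not be
    decidable. *)
Lemma within_intro (P : bstring -> Prop) e c :
  (exists2 p, P p & size p <= e + c) -> (forall p, P p -> e <= size p + c) -> within P e c.
Proof.
move=> [p Pp sp] low.
have [d [[p' [Pp' sp']] dmin]] : exists d, is_min_len P d.
  suff H n : forall p, P p -> size p <= n -> exists d, is_min_len P d by exact: H Pp (leqnn _).
  elim: n {p Pp sp} => [|n IH] p Pp sp.
    by exists 0; split; [exists p; split=> //; apply/eqP; rewrite -leqn0 | ].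
  case: (classic (exists2 p', P p' & size p' < size p)) => [[p' Pp' h]|none].
    by apply: (IH p') => //; rewrite -ltnS; exact: leq_trans h sp.
  exists (size p); split; first by exists p.
  by move=> p' Pp'; rewrite leqNgt; apply/negP => h; apply: none; exists p'.
exists d; split; first by split=> //; exists p'.
split; first exact: leq_trans (dmin p Pp) sp.
by rewrite -sp'; exact: low.
Qed.

(** * Comparison of the distances with conditional complexity *)

Section Distances.
Variables (V : PR).
Hypothesis optV : optimal_KP V.

Lemma exchange_machine : exists W, prefix_free W /\
  forall (x y : bstring) kxy kyx, size x = size y ->
    is_min_len (KP_set V x y) kxy -> is_min_len (KP_set V y x) kyx ->
    six_log_le (size x) (maxn kxy kyx) ->
    exists p, [/\ size p <= maxn kxy kyx + 31, app W p x y & app W p y x].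
Proof.
have [pfV _] := optV; have [run [Cr Mr Er]] := run_exists V.
have coh := compatible_coherent Er (prefix_free_compatible pfV).
have [W [pfW [Wxx HW]]] := graph_machine Cr Mr coh.
exists W; split=> // x y kxy kyx sxy [[p1 [h1 s1]] _] [[p2 [h2 s2]] _] /six_log_trunc lE.
case: (eqVneq x y) => [<-|xy].
  by exists [:: false]; split; [rewrite addnS | exact: Wxx | exact: Wxx].
set E0 := maxn kxy kyx in lE *.
have [|t1 r1] := app_reach Er h1 (_ : size p1 <= E0); first by rewrite s1 leq_maxl.
have [|t2 r2] := app_reach Er h2 (_ : size p2 <= E0); first by rewrite s2 leq_maxr.
(* A larger [E0] is lowered to the top level, where no description has to be witnessed. *)
have [||p [sp hp hp']] := HW x y (maxn t1 t2) (minn E0 (top_level (size x))) sxy xy.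
- by rewrite geq_minr andbT leq_min lE leq_maxl.
- case: (leqP (top_level (size x)) E0) => h; [by left | right].
  by split; [apply: (reach_mono Mr) r2; exact: leq_maxr | apply: (reach_mono Mr) r1; exact: leq_maxl].
exists p; split=> //; rewrite sp leq_add2r; exact: geq_minl.
Qed.

(** Valid for all larger [c], so that the constants of the four distances can be replaced by their
    sum. *)
Lemma nb_within (cls : PR -> Prop) U W : optimal_nb cls U -> (forall U, cls U -> compatible U) ->
  cls W -> 
  exists c0, forall c, c0 <= c ->  forall (x y : bstring) kxy kyx, size x = size y ->
    is_min_len (KP_set V x y) kxy -> is_min_len (KP_set V y x) kyx ->
    (exists p, [/\ size p <= maxn kxy kyx + 31, app W p x y & app W p y x]) ->
    within (nb_set U x y) (maxn kxy kyx) c.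
Proof.
move=> [clsU opt] comp clsW; have [c1 Hc1] := opt W clsW.
have [c2 Hc2] := KP_le_compatible optV (comp U clsU).
exists (31 + c1 + c2) => c cc x y kxy kyx sxy [_ m1] [_ m2] [p [sp h h']].
apply: within_intro.
  have [q [Pq sq]] := Hc1 x y p (conj h h').
  by exists q => //; apply: leq_trans sq _; lia.
move=> q [g g'].
have [q1 k1 s1] := Hc2 x y q sxy g; have [q2 k2 s2] := Hc2 y x q (esym sxy) g'.
have := m1 q2 k2; have := m2 q1 k1; lia.
Qed.

Lemma b_within (cls : PR -> Prop) U U' W : optimal_b cls U U' ->
  (forall U, cls U -> compatible U) -> cls W -> 
  exists c0, forall c, c0 <= c -> forall (x y : bstring) kxy kyx, size x = size y ->
    is_min_len (KP_set V x y) kxy -> is_min_len (KP_set V y x) kyx ->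
    (exists p, [/\ size p <= maxn kxy kyx + 31, app W p x y & app W p y x]) ->
    within (b_set U U' x y) (maxn kxy kyx) c.
Proof.
move=> [clsU [clsU' opt]] comp clsW; have [c1 Hc1] := opt W W clsW clsW.
have [c2 Hc2] := KP_le_compatible optV (comp U clsU).
have [c3 Hc3] := KP_le_compatible optV (comp U' clsU').
exists (31 + c1 + c2 + c3) => c cc x y kxy kyx sxy [_ m1] [_ m2] [p [sp h h']].
apply: within_intro.
  have [q [Pq sq]] := Hc1 x y p (conj h h').
  by exists q => //; apply: leq_trans sq _; lia.
move=> q [g g'].
have [q1 k1 s1] := Hc2 x y q sxy g; have [q2 k2 s2] := Hc3 y x q (esym sxy) g'.
have := m1 q2 k2; have := m2 q1 k1; lia.
Qed.

End Distances.

Theorem theorem5 :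
  forall (V U1 U2 U3 U3' U4 U4' : PR),
    optimal_KP V ->
    optimal_nb prefix_free U1 ->
    optimal_nb prefix_stable U2 ->
    optimal_b prefix_free U3 U3' ->
    optimal_b prefix_stable U4 U4' ->
    exists c : nat,
      forall (x y : bstring) (kxy kyx : nat),
        size x = size y ->
        is_min_len (KP_set V x y) kxy ->   (* kxy = KP(x|y) *)
        is_min_len (KP_set V y x) kyx ->   (* kyx = KP(y|x) *)
        six_log_le (size x) (maxn kxy kyx) ->
        [/\ within (nb_set U1 x y) (maxn kxy kyx) c,
            within (nb_set U2 x y) (maxn kxy kyx) c,
            within (b_set U3 U3' x y) (maxn kxy kyx) c
          & within (b_set U4 U4' x y) (maxn kxy kyx) c].
Proof.
move=> V U1 U2 U3 U3' U4 U4' optV o1 o2 o3 o4.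
have [W [pfW HW]] := exchange_machine optV.
have [run [Cr Mr Er]] := run_exists W.
(* The closure keeps the old programs, so the same exchange programs bound the prefix-stable
   distances. *)
have [W' psW' HW'] := stable_closure Mr Er (prefix_free_compatible pfW) Cr.
have [c1 H1] := nb_within optV o1 prefix_free_compatible pfW.
have [c2 H2] := nb_within optV o2 prefix_stable_compatible psW'.
have [c3 H3] := b_within optV o3 prefix_free_compatible pfW.
have [c4 H4] := b_within optV o4 prefix_stable_compatible psW'.
exists (c1 + c2 + c3 + c4) => x y kxy kyx sxy mxy myx lE.
have [p [sp h h']] := HW x y kxy kyx sxy mxy myx lE.
by split; [apply: H1 | apply: H2 | apply: H3 | apply: H4] => //; try lia;
   exists p; split=> //; exact: HW'.
Qed.
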